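(* Let $H\in M(p,\mathbb{R})$ satisfy $\Re\,\mathrm{eig}(H)\subseteq(0,1)$. Let $\widetilde X_H=\{\widetilde X_H(t)\}_{t\in\mathbb{R}}$ be a rhofLm with Hurst matrix $H$, parameter $A\in M(p,\mathbb{C})$, integrands $\widetilde g_t$ and Lévy measure $\mu$ on $\mathbb{C}^p$. Let $\widetilde\mu(d\mathbf{z})=\frac{\mu(d\mathbf{z})+\mu(\overline{d\mathbf{z}})}{2}$ and $\widetilde\kappa(dx,d\mathbf{z})=dx\otimes\widetilde\mu(d\mathbf{z})$. Assume that $\{f_t\}_{t\in\mathbb{R}}$, $f_t(x,\mathbf{z})=\widetilde g_t(x)\mathbf{z}$, is a minimal representation of $\{\widetilde X_H(t)\}_{t\in\mathbb{R}}$ with respect to $\mathcal{B}(\mathbb{R}\times\mathbb{R}^{2p})\bmod\widetilde\kappa$ (with $\mathbb{C}^p$ identified with $\mathbb{R}^{2p}$). Further assume $A,\overline A\in GL(p,\mathbb{C})$. Then $\widetilde X_H$ is time-reversible, i.e. $\{\widetilde X_H(-t)\}_{t\in\mathbb{R}}\stackrel{\mathrm{f.d.d.}}{=}\{\widetilde X_H(t)\}_{t\in\mathbb{R}}$, if and only if the map $\mathbf{z}\mapsto-A^{-1}\overline A\mathbf{z}$ preserves the measure $\widetilde\mu$, i.e. $$\widetilde\mu\big(-\overline A^{-1}A\,d\mathbf{z}\big)=\widetilde\mu(d\mathbf{z}),$$ meaning $\widetilde\mu(-\overline A^{-1}A\,C)=\widetilde\mu(C)$ for every Borel $C\subseteq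\mathbb{C}^p$.
   Context: Notation. $M(p,\mathbb{R}),M(p,\mathbb{C})$: $p\times p$ real/complex matrices; $GL(p,\mathbb{C})$: invertible complex matrices; $\overline A$: entrywise complex conjugate; $\Re\,\mathrm{eig}(M)$: set of real parts of eigenvalues; $c^M=\exp\{M\log c\}$, $c>0$; $x_+^{-D}=x^{-D}$ if $x>0$ and $0$ otherwise; $x_-^{-D}=|x|^{-D}$ if $x<0$ and $0$ otherwise; $D=H-(1/2)I$. f.d.d. = finite-dimensional distributions. $\mu(\overline{d\mathbf{z}})$ is the measure $C\mapsto\mu(\{\overline{\mathbf{z}}:\mathbf{z}\in C\})$. rhofLm. Let $\widetilde g_t(x)=\frac{e^{\mathbf{i}tx}-1}{\mathbf{i}x}\{x_+^{-D}A+x_-^{-D}\overline{A}\}$, $x\ne0$. Let $\mu$ be a Lévy measure on $\mathcal{B}(\mathbb{C}^p)$ with $\int_{\mathbb{C}^p}\mathbf{z}^*\mathbf{z}\,\mu(d\mathbf{z})<\infty$, $\mu(\{\mathbf{0}\})=0$, and let $\widetilde N(dx,d\mathbf{z})$ be the compensated Poisson random measure on $\mathbb{R}\times\mathbb{C}^p$ with intensity $dx\,\mu(d\mathbf{z})$ (integrals of square-integrable functions being $L^2(\mathbb{P})$-limits of integrals of elementary functions). A rhofLm (real harmonizable operator fractional Lévy motion) is a process $\widetilde X_H(t)=\int_{\mathbb{R}\times\mathbb{C}^p}2\Re(\widetilde g_t(x)\mathbf{z})\widetilde N(dx,d\mathbf{z})$ such that, for each $t\ne0$, the distribution of $\widetilde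 X_H(t)$ is not concentrated on a proper subspace of $\mathbb{R}^p$. The same process (in the sense of f.d.d.) is obtained if $\mu$ is replaced by $\widetilde\mu$. Minimality. A family $\{f_t\}_{t\in T}$ of measurable vector-valued functions on $(\overline\Omega,\mathcal{B},\kappa)$ representing a process is minimal with respect to $\mathcal{B}\bmod\kappa$ if: (1) for every $C\in\mathcal{B}$ there is $C'\in\sigma(\{f_t\}_{t\in T})$ with $\kappa(C\Delta C')=0$; and (2) there is no $C\in\mathcal{B}$ with $\kappa(C)>0$ such that for every $t\in T$, $f_t=0$ a.e. on $C$. Here these two conditions are imposed on the $\mathbb{C}^p$-valued kernels $f_t(x,\mathbf{z})=\widetilde g_t(x)\mathbf{z}$, with $\kappa=\widetilde\kappa$. *)

(* Defs.v *)
From HB Require Import structures.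
From mathcomp Require Import all_boot all_order all_algebra.
From mathcomp Require Import complex.
From mathcomp Require Import all_classical all_reals all_analysis.
From mathcomp Require Import measurable_realfun.
Set Implicit Arguments.
Unset Strict Implicit.
Unset Printing Implicit Defensive.
Import Order.TTheory GRing.Theory Num.Theory.
Import numFieldNormedType.Exports.
Local Open Scope classical_set_scope.
Local Open Scope ring_scope.

(* 'M[T]_(m, n) with its Borel sigma-algebra. *)
Definition borelMx (T : ptopologicalType) (m n : nat) :=
  g_sigma_algebraType (@open 'M[T]_(m, n)).

(* C^p with its Borel sigma-algebra, that is, R^2p: the topology of R[i] is
   available in the library on the convertible alias R[i]^o, and the topology
   of the modulus is that of R^2. *)
Definition Cvec (R : realType) (p : nat) := borelMx R[i]^o p 1.
HB.instance Definition _ (R : realType) (p : nat) :=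
  Measurable.copy (Cvec R p) (borelMx R[i]^o p 1).

Definition xzspace (R : realType) (p : nat) := (R * Cvec R p)%type.
HB.instance Definition _ (R : realType) (p : nat) :=
  Measurable.on (xzspace R p).

Section matrices.
Context {R : realType}.

Definition toC (m n : nat) (M : 'M[R]_(m, n)) : 'M[R[i]]_(m, n) :=
  map_mx (real_complex R) M.

Definition conjM (m n : nat) (M : 'M[R[i]]_(m, n)) : 'M[R[i]]_(m, n) :=
  map_mx (@conjc R) M.

Definition expmx (p : nat) (M : 'M[R]_p) : 'M[R]_p :=
  limn (fun n : nat => \sum_(k < n) (k`!%:R^-1 : R) *: M ^+ k).

Definition powmx (p : nat) (c : R) (M : 'M[R]_p) : 'M[R]_p :=
  expmx (ln c *: M).

(* z^* z *)
Definition sqnorm (p : nat) (z : Cvec R p) : R :=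
  complex.Re (((conjM z)^T *m (z : 'cV[R[i]]_p)) 0 0).

End matrices.

Section kernel.
Context {R : realType} {p : nat}.
Variables (H : 'M[R]_p) (A : 'M[R[i]]_p).

Let D : 'M[R]_p := H - (2^-1)%:M.

Definition xplus (x : R) : 'M[R]_p := if 0 < x then powmx x (- D) else 0.
Definition xminus (x : R) : 'M[R]_p := if x < 0 then powmx `|x| (- D) else 0.

(* At x = 0 the value is 0. *)
Definition gtilde (t x : R) : 'M[R[i]]_p :=
  (((cos (t * x) +i* sin (t * x)) - 1) / (0 +i* x))%C
    *: (toC (xplus x) *m A + toC (xminus x) *m conjM A).

Definition gtilde_z (t : R) (xz : xzspace R p) : Cvec R p :=
  gtilde t xz.1 *m (xz.2 : 'cV[R[i]]_p).

End kernel.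

(* A measure mu on C^p with mu({0}) = 0 and finite second moment; the Levy
   condition on the integral of min(1, |z|^2) follows. *)
Definition levy_measure2 (R : realType) (p : nat)
    (mu : {measure set (Cvec R p) -> \bar R}) :=
  mu [set 0] = 0%E /\ (\int[mu]_z (sqnorm z)%:E < +oo)%E.

Definition mutilde (R : realType) (p : nat) (mu : set (Cvec R p) -> \bar R)
    (C : set (Cvec R p)) : \bar R :=
  ((2^-1)%:E * (mu C + mu [set (conjM z : Cvec R p) | z in C]))%E.

(* dx (x) mu(dz) on R x C^p *)
Definition dx_prod (R : realType) (p : nat) (mu : set (Cvec R p) -> \bar R) :
    set (xzspace R p) -> \bar R :=
  product_measure1 (@lebesgue_measure R) mu.

Section poisson_random_measure.
Context {R : realType} {d d' : measure_display}.
Context {Omega : measurableType d} {S : measurableType d'}.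
Variables (P : probability Omega R) (nu : set S -> \bar R).
Variable (N : Omega -> {measure set S -> \bar R}).

Record poisson_random_measure : Prop := {
  prm_measurable : forall B, measurable B ->
    measurable_fun [set: Omega] (N^~ B) ;
  prm_poisson : forall B (k : nat), measurable B -> (nu B < +oo)%E ->
    P [set w | N w B = k%:R%:E]
      = (expR (- fine (nu B)) * fine (nu B) ^+ k / k`!%:R)%:E ;
  prm_pinfty : forall B, measurable B -> nu B = +oo%E ->
    P [set w | N w B = +oo%E] = 1%E ;
  prm_independent : forall (n : nat) (B : 'I_n -> set S)
      (E : 'I_n -> set (\bar R)),
    (forall j, measurable (B j)) -> trivIset setT B ->
    (forall j, measurable (E j)) ->
    P [set w | forall j, E j (N w (B j))]
      = (\prod_(j < n) P [set w | E j (N w (B j))])%E }.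

Record elementary := Elementary {
  el_size : nat ;
  el_coef : 'I_el_size -> R ;
  el_set : 'I_el_size -> set S ;
  el_measurable : forall j, measurable (el_set j) ;
  el_finite : forall j, (nu (el_set j) < +oo)%E }.
Arguments el_coef : clear implicits.
Arguments el_set : clear implicits.

Definition elementary_fun (e : elementary) (s : S) : R :=
  \sum_j el_coef e j * \1_(el_set e j) s.

(* Each N(B_j) is almost surely finite, so fine is harmless. *)
Definition elementary_integral (e : elementary) (w : Omega) : R :=
  \sum_j el_coef e j * (fine (N w (el_set e j)) - fine (nu (el_set e j))).

(* Y is (a version of) the integral of f against the compensated measure. *)
Definition is_compensated_integral (f : S -> R) (Y : Omega -> R) : Prop :=
  [/\ measurable_fun setT f, (\int[nu]_s ((f s) ^+ 2)%:E < +oo)%E,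
      measurable_fun setT Y &
      exists e : nat -> elementary,
        ((\int[nu]_s ((f s - elementary_fun (e n) s) ^+ 2)%:E)%E
           @[n --> \oo] --> 0%E) /\
        ((\int[P]_w ((Y w - elementary_integral (e n) w) ^+ 2)%:E)%E
           @[n --> \oo] --> 0%E)].

End poisson_random_measure.

(* Equality in the sense of finite-dimensional distributions of R^p-valued
   processes; column j of the matrix is the process at time t_j. *)
Definition fdd_eq (R : realType) (d : measure_display)
    (Omega : measurableType d) (P : probability Omega R) (p : nat)
    (X Y : R -> Omega -> 'cV[R]_p) : Prop :=
  forall (n : nat) (t : 'I_n -> R) (B : set (borelMx R p n)), measurable B ->
    P [set w | B (\matrix_(i, j) X (t j) w i 0)]
    = P [set w | B (\matrix_(i, j) Y (t j) w i 0)].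

Definition time_reversible (R : realType) (d : measure_display)
    (Omega : measurableType d) (P : probability Omega R) (p : nat)
    (X : R -> Omega -> 'cV[R]_p) : Prop :=
  fdd_eq P (fun t => X (- t)) X.

Record rhofLm (R : realType) (p : nat) (d : measure_display)
    (Omega : measurableType d) (P : probability Omega R)
    (H : 'M[R]_p) (A : 'M[R[i]]_p)
    (mu : {measure set (Cvec R p) -> \bar R})
    (N : Omega -> {measure set (xzspace R p) -> \bar R})
    (X : R -> Omega -> 'cV[R]_p) : Prop := {
  rhofLm_levy : levy_measure2 mu ;
  rhofLm_prm : poisson_random_measure P (dx_prod mu) N ;
  rhofLm_integral : forall (t : R) (i : 'I_p),
    is_compensated_integral P (dx_prod mu) N
      (fun xz => 2 * complex.Re (gtilde_z H A t xz i 0)) (fun w => X t w i 0) ;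
  rhofLm_proper : forall t : R, t != 0 ->
    forall V : {vspace 'cV[R]_p}, V != fullv ->
      P [set w | X t w \in V] != 1%E }.

Record minimal_family (R : realType) (p : nat) (d : measure_display)
    (S : measurableType d) (kappa : set S -> \bar R) (T : Type)
    (f : T -> S -> Cvec R p) : Prop := {
  minimal_sigma : forall C : set S, measurable C ->
    exists C' : set S,
      <<s \bigcup_t preimage_set_system setT (f t) measurable >> C' /\
      kappa (C `+` C') = 0%E ;
  minimal_support : ~ exists C : set S,
    [/\ measurable C, (0 < kappa C)%E &
        forall t, kappa.-negligible (C `&` [set s | f t s <> 0])] }.

(* Main.v *)
Require Import Defs.
From HB Require Import structures.
From mathcomp Require Import all_boot all_order all_algebra.
From mathcomp Require Import complex.
From mathcomp Require Import all_classical all_reals all_analysis.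
From mathcomp Require Import measurable_realfun.
From mathcomp Require Import ring lra.
Set Implicit Arguments.
Unset Strict Implicit.
Unset Printing Implicit Defensive.
Import Order.TTheory GRing.Theory Num.Theory.
Import numFieldNormedType.Exports.
Local Open Scope classical_set_scope.
Local Open Scope ring_scope.

(* The kernel at (-x, conj z) equals the kernel at (x, z), and for x > 0 the
   kernel at time -t and point (x, z) is the kernel at time t and point (x, U z),
   U z = conj (- conj(A)^-1 A z).  Hence reversing time amounts to moving the
   intensity dx mu(dz) by U after folding it onto x > 0, where it becomes
   2 dx mutilde(dz); this gives the "if" part.

   For the converse, E cos(Y + r) for a linear combination Y of the process,
   with integrand f, is exp(int (cos f - 1)) cos(int (sin f - f) + r), so
   reversibility says that these exponents agree, for every f in the linear
   span of the kernels, for the intensity and for its reversed image.  Second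
   differences of the exponents are the integrals of cos(f + r) (1 - cos g), so
   by a Stone-Weierstrass argument (with explicit polynomials approximating
   indicators of sublevel sets) both measures agree on the sigma-algebra
   generated by the kernels, away from their common zeros.  Finally the folded
   point (|x|, z) is a measurable function of the kernels: O_t = g_t - g_(-t) and
   E_t = g_t + g_(-t) are multiples of sin(t |x|) and cos(t |x|) - 1, from which
   |x| and then z are recovered as limits along t = 1/n.  Comparing the two
   measures on ]1, 2] x C gives mutilde(U^-1 C) = mutilde(C). *)

(** * Elementary trigonometric estimates and the Poisson series *)

(** Everything stays real: the free phase [r] in [cos (Y + r)] carries the information of a complex
    characteristic function. The sign in U arises because reversing t turns
    [(e^(i t x) - 1) / (i x)] into minus its conjugate; the conjugation in U arises because that
    conjugate is removed by conjugating the whole vector inside the real part, which exchanges A and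
    its conjugate. Folding cannot be avoided: the kernels take the same value at (x, z) and (-x,
    conj z), so the law sees only mu(C) + mu(conj C), and the criterion bears on the symmetrised
    measure. Three obstacles shape the converse. The characteristic function gives the imaginary
    exponent only modulo a full turn. The intensity has infinite mass, so a uniqueness theorem for
    finite measures does not apply to it directly; the weights [1 - cos g], dominated by the
    integrable g^2, bring it back to finite measures. Finally the kernels vanish at x = 0 and at z =
    0, so the two measures can be compared only away from these points; mu({0}) = 0 fills the
    gap. *)

Section trigonometric_inequalities.
Context {R : realType}.
Implicit Types a b x y c : R.

Lemma mvt_everywhere (f df : R -> R) a b : a <= b ->
  (forall x, is_derive x (1 : R) f (df x)) ->
  exists2 c, a <= c <= b & f b - f a = df c * (b - a).
Proof.
move=> ab Hf; have [c] := @MVT_segment R f df a b ab (fun x _ => Hf x)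
  (derivable_within_continuous (fun x _ => @ex_derive _ _ _ _ _ _ _ (Hf x))).
by rewrite in_itv/= => cab e; exists c.
Qed.

Lemma nondecreasing_derive (f df : R -> R) a b : a <= b ->
  (forall x, is_derive x (1 : R) f (df x)) -> (forall x, a <= x <= b -> 0 <= df x) ->
  f a <= f b.
Proof.
move=> ab Hf df0; have [c cab e] := mvt_everywhere ab Hf.
by rewrite -subr_ge0 e mulr_ge0 ?subr_ge0 ?df0.
Qed.

Lemma norm_sin_le x : `|sin x| <= `|x|.
Proof.
wlog x0 : x / 0 <= x => [H|].
  have [/H//|/ltW x0] := lerP 0 x.
  by rewrite -normrN -sinN -(normrN x) H// oppr_ge0.
have [c cab] := mvt_everywhere x0 (@is_derive_sin R).
rewrite sin0 !subr0 => ->; rewrite normrM ler_piMl//.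
by rewrite ler_norml cos_geN1 cos_le1.
Qed.

Lemma cosB_cos a b : cos a - cos b = - 2 * (sin ((a + b) / 2) * sin ((a - b) / 2)).
Proof.
set u := (a + b) / 2; set v := (a - b) / 2.
have ea : a = u + v by rewrite /u /v; field.
have eb : b = u - v by rewrite /u /v; field.
by rewrite [X in cos X - _]ea [X in _ - cos X]eb cosD cosB; ring.
Qed.

Lemma sinB_sin a b : sin a - sin b = 2 * (cos ((a + b) / 2) * sin ((a - b) / 2)).
Proof.
set u := (a + b) / 2; set v := (a - b) / 2.
have ea : a = u + v by rewrite /u /v; field.
have eb : b = u - v by rewrite /u /v; field.
by rewrite [X in sin X - _]ea [X in _ - sin X]eb sinD sinB; ring.
Qed.

Let half x : `|x / 2| = `|x| / 2.
Proof. by rewrite normrM [`|2^-1|]ger0_norm. Qed.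

Lemma norm_cosB_le a b : `|cos a - cos b| <= `|a - b|.
Proof.
rewrite cosB_cos !normrM normrN [`|2|]ger0_norm//.
have := norm_sin_le ((a - b) / 2); rewrite half.
have : `|sin ((a + b) / 2)| <= 1 by rewrite ler_norml sin_geN1 sin_le1.
by have := normr_ge0 (sin ((a + b) / 2)); have := normr_ge0 (sin ((a - b) / 2)); nra.
Qed.

(** Both sines of the product formula are bounded by their arguments. The second factor [|a| + |b|]
    is what makes the exponents continuous in L^2 when the measure is infinite. *)
Lemma norm_cosB_le2 a b : `|cos a - cos b| <= `|a - b| * (`|a| + `|b|).
Proof.
rewrite cosB_cos !normrM normrN [`|2|]ger0_norm//.
have := norm_sin_le ((a - b) / 2); have := norm_sin_le ((a + b) / 2); rewrite !half.
have := ler_normD a b; have := normr_ge0 (sin ((a + b) / 2)).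
have := normr_ge0 (sin ((a - b) / 2)); have := normr_ge0 (a - b).
have := normr_ge0 (a + b).
set u := `|sin _|; set v := `|sin _|; set n := `|a - b|; set m := `|a + b|.
move=> m0 n0 v0 u0 mab um vn.
apply: (@le_trans _ _ (2 * ((m / 2) * (n / 2)))).
  by rewrite ler_pM2l//; apply: ler_pM.
apply: (@le_trans _ _ (n * m)); first by nra.
by rewrite ler_wpM2l.
Qed.

(** A quadratic bound, not the cubic one, because the integrands are only square-integrable. *)
Lemma norm_sin_sub_le x : `|sin x - x| <= x ^+ 2.
Proof.
wlog x0 : x / 0 <= x => [H|].
  have [/H//|/ltW x0] := lerP 0 x.
  have -> : sin x - x = - (sin (- x) - (- x)) by rewrite sinN; ring.
  rewrite normrN -(sqrrN x).
  by rewrite H// oppr_ge0.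
have Hd y : is_derive y (1 : R) (fun z => sin z - z) (cos y - 1).
  by apply: is_deriveB.
have [c /andP[c0 cx]] := mvt_everywhere x0 Hd.
rewrite sin0 !subr0 => ->; rewrite normrM expr2 [`|x|]ger0_norm//.
apply: ler_wpM2r => //; rewrite -(cos0 R).
by apply: le_trans (norm_cosB_le _ _) _; rewrite subr0 ger0_norm.
Qed.

(** With midpoint [m] and half-difference [h], the difference is
    [2 (cos m - 1) sin h + 2 (sin h - h)], and each term is a product of two small quantities. *)
Lemma norm_sin_subB_le a b :
  `|(sin a - a) - (sin b - b)| <= `|a - b| * (`|a| + `|b|).
Proof.
pose m := (a + b) / 2; pose h := (a - b) / 2.
have -> : (sin a - a) - (sin b - b) = 2 * ((cos m - 1) * sin h) + 2 * (sin h - h).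
  have := sinB_sin a b; rewrite -/m -/h => e.
  have -> : sin a - a - (sin b - b) = (sin a - sin b) - (a - b) by ring.
  by rewrite e /h; field.
apply: le_trans (ler_normD _ _) _; rewrite !normrM [`|2|]ger0_norm//.
have h1 : `|cos m - 1| <= `|m| by rewrite -(cos0 R) -{2}(subr0 m) norm_cosB_le.
have h2 := norm_sin_le h; have h3 := norm_sin_sub_le h.
have hh : h ^+ 2 = `|h| * `|h| by rewrite -expr2 real_normK// num_real.
have hab : `|h| = `|a - b| / 2 by rewrite half.
have mab : `|m| <= (`|a| + `|b|) / 2.
  by rewrite half ler_pM2r ?invr_gt0// ler_normD.
have hab2 : `|h| <= (`|a| + `|b|) / 2.
  by rewrite hab ler_pM2r ?invr_gt0// ler_normB.
have -> : `|a - b| = 2 * `|h| by rewrite hab; field.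
have n0 := normr_ge0 h; have s0 := normr_ge0 (sin h); have c0 := normr_ge0 (cos m - 1).
apply: (@le_trans _ _ (2 * (`|m| * `|h|) + 2 * (`|h| * `|h|))).
  by apply: lerD; rewrite ler_pM2l//; [apply: ler_pM|rewrite -hh].
by nra.
Qed.

(** Recovers an unbounded kernel as a limit of bounded trigonometric functions of its multiples. *)
Lemma cvg_nsin y : n.+1%:R * sin (y / n.+1%:R) @[n --> \oo] --> y.
Proof.
apply: (@squeeze_cvgr _ _ _ _ (fun n => y - y ^+ 2 * n.+1%:R^-1)
  (fun n => y + y ^+ 2 * n.+1%:R^-1)).
- apply: nearW => n.
  have : (0 : R) < n.+1%:R by rewrite ltr0n.
  move: (n.+1%:R : R) => N N0; have Nneq0 : N != 0 by rewrite gt_eqF.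
  rewrite -ler_distl.
  have -> : N * sin (y / N) - y = N * (sin (y / N) - y / N) by field.
  rewrite normrM gtr0_norm//.
  apply: (@le_trans _ _ (N * (y / N) ^+ 2)); last first.
    by rewrite le_eqVlt; apply/orP; left; apply/eqP; field.
  by rewrite ler_pM2l// norm_sin_sub_le.
- rewrite -[X in _ --> X]subr0; apply: cvgB; first exact: cvg_cst.
  rewrite -[X in _ --> X](mulr0 (y ^+ 2)); apply: cvgM; first exact: cvg_cst.
  exact: cvg_harmonic.
- rewrite -[X in _ --> X]addr0; apply: cvgD; first exact: cvg_cst.
  rewrite -[X in _ --> X](mulr0 (y ^+ 2)); apply: cvgM; first exact: cvg_cst.
  exact: cvg_harmonic.
Qed.

(** * Cosine of a Poisson variable, as a series with an arbitrary phase *)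

Section poisson_series.
Variables c p : R.

(** The real part of [e^(i p)] times the j-th derivative of [exp (l e^(i c))] in [l]; [T n j] below
    is its Taylor polynomial at 0 with [n] terms. *)
Let G (j : nat) (l : R) : R := expR (l * cos c) * cos (l * sin c + j%:R * c + p).

Let dG j l : is_derive l (1 : R) (G j) (G j.+1 l).
Proof.
have -> : G j.+1 l = (expR (l * cos c) * - sin (l * sin c + j%:R * c + p) * sin c)
    + expR (l * cos c) * cos c * cos (l * sin c + j%:R * c + p).
  rewrite /G -natr1.
  have -> : l * sin c + (j%:R + 1) * c + p = (l * sin c + j%:R * c + p) + c by ring.
  by rewrite cosD; ring.
rewrite /G.
apply: is_derive_eq.
by rewrite !scaler1 /GRing.scale/=; ring.
Qed.

Let T (n j : nat) (l : R) : R := \sum_(k < n) l ^+ k / k`!%:R * cos ((j + k)%:R * c + p).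

Let dX n (l : R) : is_derive l (1 : R) (fun x => x ^+ n.+1) (n.+1%:R * l ^+ n).
Proof.
have := is_deriveX n.+1 (is_derive_id l (1 : R)).
rewrite /GRing.scale/= mulr1; congr (is_derive _ _ _ _).
by apply/funext => x; elim: n => [|n IH]; rewrite ?expr1// exprS [RHS]exprS -IH.
Qed.

Let dT n j l : is_derive l (1 : R) (T n.+1 j) (T n j.+1 l).
Proof.
elim: n => [|n IH].
  rewrite (_ : T 1 j = cst (cos (j%:R * c + p))); last first.
    by apply/funext => x; rewrite /T big_ord1 expr0 fact0 addn0 divr1 mul1r.
  by rewrite /T big_ord0; exact: is_derive_cst.
rewrite (_ : T n.+2 j = T n.+1 j \+
    (fun x => x ^+ n.+1 / n.+1`!%:R * cos ((j + n.+1)%:R * c + p))); last first.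
  by apply/funext => x; rewrite /T big_ord_recr.
rewrite (_ : T n.+1 j.+1 l = T n j.+1 l +
    l ^+ n / n`!%:R * cos ((j + n.+1)%:R * c + p)); last first.
  by rewrite /T big_ord_recr/= addSnnS.
apply: is_deriveD.
have n0 : (n`!%:R : R) != 0 by rewrite pnatr_eq0 -lt0n fact_gt0.
have n1 : (n.+1%:R : R) != 0 by rewrite pnatr_eq0.
have dXn := dX n l; apply: is_derive_eq.
rewrite /GRing.scale/= factS natrM.
move: (n.+1%:R : R) n1 (n`!%:R : R) n0 => N N0 F F0.
by field; rewrite F0.
Qed.

(* Since [G j] and [T n.+1 j] have derivatives [G j.+1] and [T n j.+1], the error for [n.+1] is
   an integral of the error for [n]. *)
Let GT_bound L n j l : 0 <= l <= L ->
  `|G j l - T n j l| <= expR L * (l ^+ n / n`!%:R).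
Proof.
elim: n j l => [|n IH] j l /andP[l0 lL].
  rewrite /T big_ord0 subr0 fact0 expr0 divr1 mulr1 /G normrM [`|expR _|]ger0_norm ?expR_ge0//.
  apply: (@le_trans _ _ (expR (l * cos c) * 1)).
    by rewrite ler_wpM2l ?expR_ge0// ler_norml cos_geN1 cos_le1.
  rewrite mulr1 ler_expR (le_trans _ lL)// ler_piMr// cos_le1//.
have T0 : T n.+1 j 0 = G j 0.
  rewrite /T /G !mul0r expR0 add0r mul1r big_ord_recl/= expr0 fact0 addn0 big1 => [|i _].
    by rewrite addr0; field.
  by rewrite /bump/= add1n exprS !mul0r.
pose e x := expR L * (x ^+ n.+1 / n.+1`!%:R).
have de x : is_derive x (1 : R) e (expR L * (x ^+ n / n`!%:R)).
  have n0 : (n`!%:R : R) != 0 by rewrite pnatr_eq0 -lt0n fact_gt0.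
  have n1 : (n.+1%:R : R) != 0 by rewrite pnatr_eq0.
  have dXn := dX n x; rewrite /e; apply: is_derive_eq.
  rewrite /GRing.scale/= factS natrM.
  move: (n.+1%:R : R) n1 (n`!%:R : R) n0 => N N0 F F0.
  by field; rewrite F0.
have dGT x := is_deriveB (dG j x) (dT n j x).
have e0 : e 0 = 0 by rewrite /e exprS !mul0r mulr0.
rewrite ler_norml -/(e l); apply/andP; split.
  have := @nondecreasing_derive (fun x => e x + (G j x - T n.+1 j x)) _ 0 l l0
    (fun x => is_deriveD (de x) (dGT x)).
  rewrite e0 T0 subrr addr0 => h.
  rewrite -subr_ge0 opprK addrC; apply: h => x /andP[x0 xl].
  have := IH j.+1 x; rewrite x0 (le_trans xl lL) => /(_ isT).
  by rewrite ler_norml => /andP[+ _]; lra.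
have := @nondecreasing_derive (fun x => e x - (G j x - T n.+1 j x)) _ 0 l l0
  (fun x => is_deriveB (de x) (dGT x)).
rewrite e0 T0 subrr subr0 => h.
rewrite -subr_ge0; apply: h => x /andP[x0 xl].
have := IH j.+1 x; rewrite x0 (le_trans xl lL) => /(_ isT).
by rewrite ler_norml => /andP[_]; lra.
Qed.

(** Multiplied by [expR (- l)], this is the expectation of [cos (k c + p)] for a Poisson variable k
    of mean [l]. *)
Lemma cvg_poisson_series l : 0 <= l ->
  \sum_(k < n) (l ^+ k / k`!%:R * cos (k%:R * c + p)) @[n --> \oo] -->
  expR (l * cos c) * cos (l * sin c + p).
Proof.
move=> l0.
pose e n := expR l * (l ^+ n / n`!%:R).
have e0 : e n @[n --> \oo] --> 0.
  rewrite -(mulr0 (expR l)); apply: cvgM; first exact: cvg_cst.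
  exact: cvg_exp_coeff.
have GTe n : `|T n 0 l - G 0 l| <= e n.
  by rewrite distrC; apply: GT_bound; rewrite l0 lexx.
have -> : expR (l * cos c) * cos (l * sin c + p) = G 0 l.
  by rewrite /G mul0r addr0.
apply: (@squeeze_cvgr _ _ _ _ (fun n => G 0 l - e n) (fun n => G 0 l + e n)).
- by apply: nearW => n; rewrite -ler_distl; exact: GTe.
- by rewrite -[X in _ --> X]subr0; apply: cvgB => //; exact: cvg_cst.
- by rewrite -[X in _ --> X]addr0; apply: cvgD => //; exact: cvg_cst.
Qed.

End poisson_series.

End trigonometric_inequalities.

(** * Measures determined by trigonometric polynomials *)

Section step_polynomial.
Context {R : realType}.

(* The Brosowski-Deutsch polynomial: the exponents make it tend to 1 for x < 1/2 and to 0, at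
   rate 1/n, for x >= 1/2. *)
Definition step_poly (n : nat) (x : R) : R := (1 - x ^+ (2 * n)) ^+ (n * 4 ^ n).

Lemma bernoulli_ge (x : R) n : -1 <= x -> 1 + n%:R * x <= (1 + x) ^+ n.
Proof.
move=> x1; elim: n => [|n IH]; first by rewrite mul0r addr0 expr0.
rewrite exprS; apply: le_trans (_ : (1 + x) * (1 + n%:R * x) <= _).
  rewrite -natr1; have : 0 <= n%:R * (x * x) by rewrite mulr_ge0// -expr2 sqr_ge0.
  lra.
by rewrite ler_wpM2l//; lra.
Qed.

Lemma step_poly_itv n (x : R) : 0 <= x <= 1 -> 0 <= step_poly n x <= 1.
Proof.
move=> /andP[x0 x1].
have h : 0 <= x ^+ (2 * n) <= 1 by rewrite exprn_ge0 ?exprn_ile1.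
by rewrite /step_poly exprn_ge0 ?exprn_ile1//; lra.
Qed.

(** With t = x^(2n) and N = n 4^n, Bernoulli's inequality gives (1 + t)^N >= 1 + N t >= 1 + n, since
    N t = n (4 x^2)^n; and (1 - t)^N (1 + t)^N <= 1. *)
Lemma step_poly_small n (x : R) : 1 / 2 <= x <= 1 -> step_poly n x <= n.+1%:R^-1.
Proof.
move=> /andP[x0 x1]; rewrite /step_poly.
set t := x ^+ (2 * n).
have ht : 0 <= t <= 1 by rewrite exprn_ge0 ?exprn_ile1//; lra.
set N := (n * 4 ^ n)%N.
have nNt : n%:R <= N%:R * t.
  rewrite /N natrM -mulrA ler_peMr// natrX /t exprM -exprMn.
  by rewrite exprn_ege1//; nra.
have h1 : (1 - t) ^+ N * (1 + t) ^+ N <= 1.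
  by rewrite -exprMn exprn_ile1//; nra.
have h2 : n.+1%:R <= (1 + t) ^+ N.
  by apply: le_trans (bernoulli_ge _ _); rewrite -?natr1; lra.
have h3 : 0 <= (1 - t) ^+ N by rewrite exprn_ge0//; lra.
rewrite -[leRHS]mul1r ler_pdivlMr ?ltr0n//.
by apply: le_trans h1; rewrite ler_wpM2l.
Qed.

(** For 0 < x < 1/2 and z = 2x, Bernoulli's inequality bounds the defect by n z^(2n). Writing z = 1
    / (1 + a), the same inequality gives n z^n <= 1 / a, so the defect is at most z^n / a. *)
Lemma step_poly_cvg (x : R) : 0 <= x <= 1 ->
  step_poly n x @[n --> \oo] --> ((x < 1 / 2)%R%:R : R).
Proof.
move=> x01; have [xlt|xge] := ltrP x (1 / 2); last first.
  apply: (@squeeze_cvgr _ _ _ _ (cst 0) (fun n => n.+1%:R^-1 : R)).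
  - apply: nearW => n; have /andP[-> _] /= := step_poly_itv n x01.
    by apply: step_poly_small; lra.
  - exact: cvg_cst.
  - exact: cvg_harmonic.
have [->|xneq0] := eqVneq x 0.
  apply: cvg_near_cst; near=> n; rewrite /step_poly expr0n.
  have -> : (2 * n == 0)%N = false.
    by apply/negbTE; rewrite -lt0n muln_gt0/=; near: n; exact: nbhs_infty_gt.
  by rewrite subr0 expr1n.
have xgt : 0 < x by lra.
pose z : R := 2 * x.
have z01 : 0 < z < 1 by rewrite /z; lra.
pose a : R := z^-1 - 1.
have a0 : 0 < a by rewrite /a subr_gt0 invf_gt1; lra.
have za : z * (1 + a) = 1 by rewrite /a; field; lra.
have nz n : n%:R * z ^+ n <= a^-1.
  have h : 1 + n%:R * a <= (1 + a) ^+ n by apply: bernoulli_ge; lra.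
  have zn0 : 0 < z ^+ n by rewrite exprn_gt0; lra.
  have : z ^+ n * (1 + a) ^+ n = 1 by rewrite -exprMn za expr1n.
  move=> e; rewrite -[leRHS]mul1r ler_pdivlMr//.
  by have := ler_wpM2l (ltW zn0) h; rewrite e; nra.
apply: (@squeeze_cvgr _ _ _ _ (fun n => 1 - a^-1 * z ^+ n) (cst 1)).
- apply: nearW => n; have /andP[_ ->] /= := step_poly_itv n x01; rewrite andbT.
  rewrite /step_poly.
  have ht : 0 <= x ^+ (2 * n) <= 1 by rewrite exprn_ge0 ?exprn_ile1//; lra.
  apply: le_trans (bernoulli_ge _ _); last lra.
  rewrite mulrN lerD2l lerN2 natrM natrX -mulrA.
  rewrite exprM -exprMn (_ : 4 * x ^+ 2 = z * z); last by rewrite /z; ring.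
  by rewrite exprMn mulrA ler_wpM2r ?nz// exprn_ge0; lra.
- rewrite -[X in _ --> X]subr0; apply: cvgB; first exact: cvg_cst.
  rewrite -[X in _ --> X](mulr0 a^-1); apply: cvgM; first exact: cvg_cst.
  by apply: cvg_expr; rewrite ger0_norm; lra.
- exact: cvg_cst.
Unshelve. all: by end_near. Qed.

End step_polynomial.

(** * Uniqueness of a measure from its weighted integrals over an algebra of functions *)

Section subalgebra_uniqueness.
Context {d : measure_display} {S : measurableType d} {R : realType}.
Variables (m1 m2 : {measure set S -> \bar R}) (AA : set (S -> R)) (w : S -> R).
Hypothesis AAm : forall h, AA h -> measurable_fun setT h.
Hypothesis AAc : forall c, AA (cst c).
Hypothesis AAD : forall g h, AA g -> AA h -> AA (g \+ h).
Hypothesis AAM : forall g h, AA g -> AA h -> AA (g \* h).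
Hypothesis AAw : AA w.
Hypothesis w01 : forall x, 0 <= w x <= 1.
Hypothesis iw1 : m1.-integrable setT (EFin \o w).
Hypothesis iw2 : m2.-integrable setT (EFin \o w).
Hypothesis AA_eq : forall h, AA h -> (exists K : R, forall x, `|h x| <= K) ->
  (\int[m1]_x (h x * w x)%:E = \int[m2]_x (h x * w x)%:E)%E.

(** The level 1/2 and the range [0, 1] are those of [step_poly], which turns [q] into a sequence of
    members of [AA] tending to the indicator. *)
Definition sublevel_sets : set (set S) :=
  [set [set x | q x < 1 / 2] | q in [set q | AA q /\ forall x, 0 <= q x <= 1]].

Let AAX h n : AA h -> AA (fun x => h x ^+ n).
Proof.
move=> Ah; elim: n => [|n IH].
  by rewrite (_ : (fun _ => _) = cst 1)//; apply/funext => x; rewrite expr0.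
rewrite (_ : (fun _ => _) = h \* (fun x => h x ^+ n)); first exact: AAM.
by apply/funext => x; rewrite exprS.
Qed.

Let AAB h : AA h -> AA (fun x => 1 - h x).
Proof.
move=> Ah; rewrite (_ : (fun _ => _) = cst 1 \+ cst (-1) \* h).
  by apply: AAD => //; exact: AAM.
by apply/funext => x /=; rewrite mulN1r.
Qed.

Let AAstep h n : AA h -> AA (fun x => step_poly n (h x)).
Proof. by move=> Ah; apply/AAX/AAB/AAX. Qed.

Let AAsum n : AA (fun x => \sum_(k < n) (1 - w x) ^+ k).
Proof.
elim: n => [|n IH].
  by rewrite (_ : (fun _ => _) = cst 0)//; apply/funext => x; rewrite big_ord0.
rewrite (_ : (fun _ => _) =
  (fun x => \sum_(k < n) (1 - w x) ^+ k) \+ (fun x => (1 - w x) ^+ n)).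
  by apply: AAD => //; exact/AAX/AAB.
by apply/funext => x; rewrite big_ord_recr.
Qed.

Let sumw n x : (\sum_(k < n) (1 - w x) ^+ k) * w x = 1 - (1 - w x) ^+ n.
Proof.
elim: n => [|n IH]; first by rewrite big_ord0 mul0r expr0 subrr.
by rewrite big_ord_recr/= mulrDl IH exprS; ring.
Qed.

(** A pi-system containing the sublevel sets: unlike sublevel sets, pointwise limits are visibly
    stable under intersection, by taking products. *)
Let limit_sets : set (set S) := [set A | exists h : nat -> S -> R,
  (forall n, AA (h n) /\ forall x, 0 <= h n x <= 1) /\
  forall x, h n x @[n --> \oo] --> (\1_A x : R)].

Let limit_setsI : setI_closed limit_sets.
Proof.
move=> A B [g [g1 g2]] [h [h1 h2]]; exists (fun n => g n \* h n); split.
  move=> n; have [Ag g01] := g1 n; have [Ah h01] := h1 n.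
  split; first exact: AAM.
  by move=> x /=; have := g01 x; have := h01 x; nra.
by move=> x; rewrite indicI/=; apply: cvgM.
Qed.

Let limit_setsT : limit_sets setT.
Proof.
exists (fun n => cst 1); split.
  by move=> n; split => // x /=; lra.
by move=> x; rewrite indicT; exact: cvg_cst.
Qed.

Let sublevel_limit : sublevel_sets `<=` limit_sets.
Proof.
move=> _ [q [Aq q01] <-]; exists (fun n x => step_poly n (q x)); split.
  by move=> n; split; [exact: AAstep|move=> x; exact: step_poly_itv].
move=> x; have := step_poly_cvg (q01 x).
by rewrite indicE; congr (_ --> _); rewrite mem_setE.
Qed.

Let limit_measurable : limit_sets `<=` measurable.
Proof.
move=> A [h [h1 h2]].
have mA : measurable_fun setT (\1_A : S -> R).
  by apply: (measurable_fun_cvg (h := h)) => [n|x _]; [apply: AAm; case: (h1 n)|exact: h2].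
have -> : A = setT `&` (\1_A : S -> R) @^-1` [set 1].
  rewrite setTI; apply/seteqP; split=> x /=; rewrite indicE.
    by move=> Ax; rewrite mem_set.
  have [/set_mem//|_ /eqP] := boolP (x \in A).
  by rewrite eq_sym oner_eq0.
exact: mA.
Qed.

Variable dl : R.
Hypothesis dl01 : 0 < dl < 1.
Let K := [set x | dl < w x].

Let mK : measurable K.
Proof.
rewrite (_ : K = setT `&` w @^-1` `]dl, +oo[%classic).
  by apply: AAm.
by rewrite setTI; apply/seteqP; split=> x /=; rewrite in_itv/= andbT.
Qed.

(** Takes values in [0, 1], with [q0 x < 1 / 2] exactly when [dl < w x]. *)
Let q0 x := (1 + dl - w x) / 2.

Let q001 x : 0 <= q0 x <= 1.
Proof. by have := dl01; have := w01 x; rewrite /q0; lra. Qed.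

Let Aq0 : AA q0.
Proof.
rewrite (_ : q0 = cst ((1 + dl) / 2) \+ cst (- 2^-1) \* w).
  by apply: AAD => //; exact: AAM.
by apply/funext => x; rewrite /q0 /=; field.
Qed.

(* The geometric sum inverts the weight [w] on the set where [w] is positive. *)
Let approx (h : nat -> S -> R) n x :=
  h n x * (step_poly n (q0 x) * (\sum_(k < n) (1 - w x) ^+ k)).

(** Where [dl < w x] the bound exceeds 1. Elsewhere the step polynomial is at most 1/(n + 1) while
    [1 - (1 - w)^n <= n w], so that its rate of decay compensates the growth of the geometric
    sum. *)
Let approx_bound h n x : (forall n x, 0 <= h n x <= 1) ->
  0 <= approx h n x * w x <= w x / dl.
Proof.
move=> h01; rewrite /approx -!mulrA sumw.
have /andP[h0 h1] := h01 n x; have /andP[w0 w1] := w01 x.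
have /andP[dl0 dl1] := dl01.
have s01 := step_poly_itv n (q001 x).
have a0 : 0 <= (1 - w x) ^+ n <= 1 by rewrite exprn_ge0 ?exprn_ile1//; lra.
set a := (1 - w x) ^+ n in a0 *.
apply/andP; split; first by rewrite !mulr_ge0//; lra.
apply: (@le_trans _ _ (step_poly n (q0 x) * (1 - a))).
  by rewrite ler_piMl// mulr_ge0//; lra.
have [dw|wd] := ltrP dl (w x).
  apply: (@le_trans _ _ 1); first by rewrite mulr_ile1//; lra.
  by rewrite ler_pdivlMr; lra.
have aw : 1 - a <= n%:R * w x.
  have := @bernoulli_ge R (- w x) n; rewrite mulrN.
  by rewrite -/a; lra.
have : step_poly n (q0 x) <= n.+1%:R^-1.
  by apply: step_poly_small; have := q001 x; rewrite /q0; lra.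
move=> sn; apply: (@le_trans _ _ (n.+1%:R^-1 * (n%:R * w x))).
  by apply: ler_pM => //; lra.
apply: (@le_trans _ _ (w x)).
  rewrite mulrA ler_piMl// mulrC ler_pdivrMr ?ltr0n// mul1r.
  by rewrite ler_nat.
by rewrite ler_pdivlMr ?ler_piMr//; lra.
Qed.

Let approx_cvg h A x : h n x @[n --> \oo] --> (\1_A x : R) ->
  approx h n x * w x @[n --> \oo] --> (\1_(A `&` K) x : R).
Proof.
move=> hA; rewrite /approx; have /andP[dl0 dl1] := dl01.
under eq_fun do rewrite -!mulrA sumw.
rewrite indicI/=; apply: cvgM => //.
have [w0|w0] := eqVneq (w x) 0.
  have -> : \1_K x = 0 :> R.
    by rewrite indicE memNset// /K/= w0; lra.
  apply: cvg_near_cst; apply: nearW => n.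
  by rewrite w0 subr0 expr1n subrr mulr0.
have -> : \1_K x = (q0 x < 1 / 2)%R%:R * (1 - 0) :> R.
  have -> : (q0 x < 1 / 2) = (dl < w x) by rewrite /q0; apply/idP/idP; lra.
  rewrite subr0 mulr1 indicE; congr (nat_of_bool _)%:R.
  by apply/idP/idP => [/set_mem//|/mem_set].
apply: cvgM; first exact: step_poly_cvg.
apply: cvgB; first exact: cvg_cst.
have /andP[w1 w2] := w01 x.
have wp : 0 < w x by rewrite lt_def w0.
by apply: cvg_expr; rewrite ger0_norm; lra.
Qed.

(** Dominated convergence with the integrable bound [w / dl], which also dominates the indicator of
    [K] and makes its measure finite. *)
Let approx_lim (m : {measure set S -> \bar R}) h A :
  m.-integrable setT (EFin \o w) ->
  (forall n, AA (h n) /\ forall x, 0 <= h n x <= 1) ->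
  (forall x, h n x @[n --> \oo] --> (\1_A x : R)) ->
  (\int[m]_x (approx h n x * w x)%:E @[n --> \oo] --> m (A `&` K))%E /\
  (m K < +oo)%E.
Proof.
move=> iw h1 h2.
have mA : measurable A by apply: limit_measurable; exists h.
have /andP[dl0 dl1] := dl01.
have h01 n x : 0 <= h n x <= 1 by case: (h1 n).
have Aap n : AA (approx h n).
  by apply: AAM; [case: (h1 n)|apply: AAM; [exact: AAstep|exact: AAsum]].
have iwd : m.-integrable setT (EFin \o (fun x => w x / dl)).
  rewrite (_ : _ \o _ = (fun x => (dl^-1)%:E * (EFin \o w) x)%E).
    exact: integrableZl.
  by apply/funext => x /=; rewrite -EFinM mulrC.
split.
  have mAK := measurableI _ _ mA mK.
  have <- : (\int[m]_x (\1_(A `&` K) x)%:E = m (A `&` K))%E.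
    by rewrite integral_indic ?setIT.
  apply: (@dominated_cvg _ _ _ _ _ measurableT _ _ (EFin \o (fun x => w x / dl))).
  - move=> n; apply/measurable_EFinP; apply: measurable_funM; apply: AAm => //.
  - by move=> x _; apply: cvg_EFin; [exact: nearW|exact: approx_cvg].
  - by [].
  - exact: iwd.
  - move=> n x _ /=; rewrite lee_fin.
    by have /andP[a0 a1] := approx_bound n x h01; rewrite ger0_norm.
apply: (@le_lt_trans _ _ (\int[m]_x (w x / dl)%:E)%E); last first.
  exact: integrable_lty iwd.
have <- : (\int[m]_x (\1_K x)%:E = m K)%E by rewrite integral_indic ?setIT.
apply: ge0_le_integral => //.
- exact/measurable_EFinP/measurable_indic.
- exact: measurable_int iwd.
- move=> x _; have w1 := w01 x; rewrite lee_fin indicE.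
  have [/set_mem|_] := boolP (x \in K); last by apply: divr_ge0; lra.
  by rewrite /K /= ler_pdivlMr//= mul1r => /ltW.
Qed.

(** The restrictions to [K] are finite measures that agree on the pi-system [limit_sets], being
    limits of integrals to which [AA_eq] applies. *)
Lemma eq_measure_subalgebra B : <<s sublevel_sets >> B ->
  m1 (B `&` K) = m2 (B `&` K).
Proof.
move=> sB.
have lim_eq A : limit_sets A -> m1 (A `&` K) = m2 (A `&` K).
  move=> [h [h1 h2]].
  have [c1 _] := approx_lim iw1 h1 h2.
  have [c2 _] := approx_lim iw2 h1 h2.
  have E : (fun n => \int[m1]_x (approx h n x * w x)%:E)%E =
           (fun n => \int[m2]_x (approx h n x * w x)%:E)%E.
    apply/funext => n; apply: AA_eq.
      by apply: AAM; [case: (h1 n)|apply: AAM; [exact: AAstep|exact: AAsum]].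
    exists n%:R => x; rewrite /approx.
    have h01 : 0 <= h n x <= 1 by case: (h1 n).
    have s01 := step_poly_itv n (q001 x).
    have r0 : 0 <= \sum_(k < n) (1 - w x) ^+ k <= n%:R.
      have w1 := w01 x.
      apply/andP; split; first by apply: sumr_ge0 => k _; apply: exprn_ge0; lra.
      rewrite -[leRHS]mulr1 -[X in X%:R * _](card_ord n) mulr_natl -sumr_const.
      by apply: ler_sum => k _; apply: exprn_ile1; lra.
    rewrite ger0_norm; last by rewrite !mulr_ge0//; lra.
    rewrite mulrA; apply: (@le_trans _ _ (1 * n%:R)); last by rewrite mul1r.
    by apply: ler_pM; rewrite ?mulr_ge0 ?mulr_ile1//; lra.
  by rewrite E in c1; exact: (cvg_unique _ c1 c2).
pose m1K : {measure set S -> \bar R} := mrestr m1 mK.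
pose m2K : {measure set S -> \bar R} := mrestr m2 mK.
apply: (@g_sigma_algebra_measure_unique _ _ _ limit_sets _ (fun=> setT) _ _ m1K m2K) => //.
- by rewrite bigcup_const//; exists 0%N.
- move=> _; rewrite /m1K /= /mrestr setTI.
  by have [h [h1 h2]] := limit_setsT; have [] := approx_lim iw1 h1 h2.
- by apply: sub_sigma_algebra2 sB; exact: sublevel_limit.
Qed.

End subalgebra_uniqueness.

(** * Trigonometric polynomials in a linear space of functions *)

Section trigonometric_polynomials.
Context {d : measure_display} {S : measurableType d} {R : realType}.
Implicit Types (L : set (S -> R)) (f g h w : S -> R).

(** The phase [r] covers sines, and constants are the case [f = 0]. *)
Inductive trig_poly L : set (S -> R) :=
| trig_cos c r f : L f -> trig_poly L (fun x => c * cos (f x + r))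
| trig_add g h : trig_poly L g -> trig_poly L h -> trig_poly L (g \+ h).

Definition sub_space L := [/\ L (cst 0), (forall f g, L f -> L g -> L (f \+ g)) &
  (forall (c : R) f, L f -> L (fun x => c * f x))].

Variable L : set (S -> R).
Hypothesis Lsub : sub_space L.
Hypothesis Lm : forall f, L f -> measurable_fun setT f.

Let LD f g : L f -> L g -> L (fun x => f x + g x).
Proof. by case: Lsub => _ + _; exact. Qed.

Let LB f g : L f -> L g -> L (fun x => f x - g x).
Proof.
case: Lsub => _ _ LZ Lf Lg; apply: LD => //.
rewrite (_ : (fun x => - g x) = (fun x => -1 * g x)); first exact: LZ.
by apply/funext => x; rewrite mulN1r.
Qed.

Lemma trig_cst c : trig_poly L (cst c).
Proof.
have [L0 _ _] := Lsub.
rewrite (_ : cst c = (fun x => c * cos (cst 0 x + 0))); first exact: trig_cos.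
by apply/funext => x; rewrite /= addr0 cos0 mulr1.
Qed.

Lemma trig_poly_measurable h : trig_poly L h -> measurable_fun setT h.
Proof.
elim=> {h} [c r f Lf|g h _ mg _ mh]; last exact: measurable_funD.
apply: measurable_funM; first exact: measurable_cst.
apply: (measurableT_comp (continuous_measurable_fun (@continuous_cos R))).
by apply: measurable_funD; [exact: Lm|exact: measurable_cst].
Qed.

Lemma trig_polyM g h : trig_poly L g -> trig_poly L h -> trig_poly L (g \* h).
Proof.
move=> Ag Ah; elim: Ag => {g} [c r f Lf|g1 g2 _ A1 _ A2]; last first.
  rewrite (_ : _ \* _ = g1 \* h \+ g2 \* h); first exact: trig_add.
  by apply/funext => x /=; rewrite mulrDl.
elim: Ah => {h} [b s g Lg|h1 h2 _ A1 _ A2]; last first.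
  rewrite (_ : _ \* _ = (fun x => c * cos (f x + r)) \* h1 \+
                        (fun x => c * cos (f x + r)) \* h2); first exact: trig_add.
  by apply/funext => x /=; rewrite mulrDr.
rewrite (_ : _ \* _ = (fun x => (c * b / 2) * cos (f x - g x + (r - s))) \+
                      (fun x => (c * b / 2) * cos (f x + g x + (r + s)))).
  by apply: trig_add; apply: trig_cos; [exact: LB|exact: LD].
apply/funext => x /=.
have -> : f x - g x + (r - s) = (f x + r) - (g x + s) by ring.
have -> : f x + g x + (r + s) = (f x + r) + (g x + s) by ring.
by rewrite (cosD (f x + r) (g x + s)) (cosB (f x + r)); field.
Qed.

Lemma trig_poly_bounded h : trig_poly L h -> exists K : R, forall x, `|h x| <= K.
Proof.
elim=> {h} [c r f _|g h _ [K gK] _ [K' hK]].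
  exists `|c| => x; rewrite normrM ler_piMr//.
  by rewrite ler_norml cos_geN1 cos_le1.
by exists (K + K') => x /=; rewrite (le_trans (ler_normD _ _))// lerD.
Qed.

(** Large enough for every member of [L] to be measurable, as [trig_sigma_fun] shows. *)
Definition trig_sigma := <<s sublevel_sets (trig_poly L) >>.

Lemma trig_sigma_measurable B : trig_sigma B -> measurable B.
Proof.
apply: smallest_sub; first exact: sigma_algebra_measurable.
move=> _ [q [Aq _] <-].
rewrite (_ : [set x | _] = setT `&` q @^-1` `]-oo, (1 / 2)[%classic).
  exact: trig_poly_measurable.
by rewrite setTI; apply/seteqP; split=> x /=; rewrite in_itv.
Qed.

(** The space [S] with [trig_sigma] as its measurable sets, so that membership in [trig_sigma] is
    proved by the usual measurability lemmas. *)
Let SG := g_sigma_algebraType (sublevel_sets (trig_poly L)).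

(** [f] is the limit of [n sin (f / n)], and strict sublevel sets of a sine are, up to an affine
    change, among the generators. *)
Lemma trig_sigma_fun f : L f -> measurable_fun setT (f : SG -> R).
Proof.
move=> Lf; have [_ _ LZ] := Lsub.
apply: (measurable_fun_cvg (h := fun n (x : SG) => n.+1%:R * sin (f x / n.+1%:R))).
  move=> n; apply: measurable_funM; first exact: measurable_cst.
  set g := fun x : S => f x / n.+1%:R.
  have Lg : L g.
    rewrite (_ : g = fun x => n.+1%:R^-1 * f x); first exact: LZ.
    by apply/funext => x; rewrite mulrC.
  move=> mT; apply: (measurability _ (RGenInftyO.measurableE R)) => // _ [_ [c ->] <-].
  rewrite setTI.
  have [cl|cl] := ltrP c (-1).
    rewrite (_ : _ @^-1` _ = set0)//; apply/seteqP; split => x //=.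
    rewrite in_itv/= => h; have := sin_geN1 (g x); rewrite /g.
    by move: h cl; lra.
  have [cr|cr] := ltrP 1 c.
    rewrite (_ : _ @^-1` _ = setT)//; apply/seteqP; split => x //=.
    by rewrite in_itv/= => _; apply: le_lt_trans cr; exact: sin_le1.
  apply: sub_sigma_algebra.
  (* The affine map sends the level [c] to 1/2 and, as -1 <= c <= 1 here, the range [-1, 1] of the
     sine into [0, 1]. *)
  exists ((fun x => 4^-1 * sin (g x)) \+ cst (1 / 2 - c / 4)); last first.
    by apply/seteqP; split=> x /=; rewrite in_itv/=; lra.
  split.
    apply: trig_add; last exact: trig_cst.
    rewrite (_ : (fun _ => _) = (fun x => 4^-1 * cos (g x + (- (pi / 2))))).
      exact: trig_cos.
    by apply/funext => x; rewrite cosBpihalf.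
  by move=> x /=; have := sin_geN1 (g x); have := sin_le1 (g x); lra.
by move=> x _; exact: cvg_nsin.
Qed.

Variables m1 m2 : {measure set S -> \bar R}.

(** The equality for cosines extends to all trigonometric polynomials by linearity; they are bounded
    and [w] is integrable, so the integrals can be added. *)
Lemma eq_measure_trig_weight w dl B : trig_poly L w -> (forall x, 0 <= w x <= 1) ->
  m1.-integrable setT (EFin \o w) -> m2.-integrable setT (EFin \o w) ->
  (forall f r, L f -> (\int[m1]_x (cos (f x + r) * w x)%:E =
                       \int[m2]_x (cos (f x + r) * w x)%:E)%E) ->
  0 < dl < 1 -> trig_sigma B ->
  m1 (B `&` [set x | dl < w x]) = m2 (B `&` [set x | dl < w x]).
Proof.
move=> Aw w01 iw1 iw2 cosE dl01 sB.
apply: (@eq_measure_subalgebra _ _ _ m1 m2 (trig_poly L)) => //.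
- exact: trig_poly_measurable.
- exact: trig_cst.
- exact: trig_add.
- exact: trig_polyM.
have wint (m : {measure set S -> \bar R}) h : m.-integrable setT (EFin \o w) ->
    trig_poly L h -> m.-integrable setT (fun x => (h x * w x)%:E).
  move=> iw Ah; have [K hK] := trig_poly_bounded Ah.
  apply: (@le_integrable _ _ _ _ _ measurableT _ (fun x => K%:E * (EFin \o w) x)%E).
  - apply/measurable_EFinP/measurable_funM; exact: trig_poly_measurable.
  - move=> x _ /=; rewrite lee_fin !normrM ler_wpM2r//.
    by rewrite (le_trans (hK x))// ler_norm.
  - exact: integrableZl.
move=> h Ah _; elim: Ah => {h} [c r f Lf|g h Ag IHg Ah IHh].
  under eq_integral do rewrite -mulrA EFinM.
  under [in RHS]eq_integral do rewrite -mulrA EFinM.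
  have Lc : trig_poly L (fun x => 1 * cos (f x + r)) by exact: trig_cos.
  rewrite integralZl//; last first.
    by apply: eq_integrable (wint _ _ iw1 Lc) => // x _; rewrite mul1r.
  rewrite integralZl//; last first.
    by apply: eq_integrable (wint _ _ iw2 Lc) => // x _; rewrite mul1r.
  by rewrite cosE.
under eq_integral do rewrite mulrDl EFinD.
under [in RHS]eq_integral do rewrite mulrDl EFinD.
by rewrite !integralD ?IHg ?IHh//; exact: wint.
Qed.

(** [seqDU] makes the cover disjoint without leaving [trig_sigma]; countable additivity then glues
    the local equalities. *)
Lemma eq_measure_trig_cover (K : nat -> set S) B :
  (forall k, trig_sigma (K k)) -> B `<=` \bigcup_k K k -> trig_sigma B ->
  (forall C k, trig_sigma C -> m1 (C `&` K k) = m2 (C `&` K k)) ->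
  m1 B = m2 B.
Proof.
move=> sK BK sB H.
have sD k : trig_sigma (seqDU K k).
  rewrite /seqDU; apply: (@measurableD _ SG); first exact: sK.
  by apply: (@bigsetU_measurable _ SG) => i _; exact: sK.
have BE : B = \bigcup_k (B `&` seqDU K k).
  by rewrite -setI_bigcupr -seqDU_bigcup_eq setIidl.
have sBD k : trig_sigma (B `&` seqDU K k) by apply: (@measurableI _ SG); [exact: sB|exact: sD].
have tB : trivIset setT (fun k => B `&` seqDU K k).
  by apply: trivIset_setIl; exact: trivIset_seqDU.
rewrite BE !measure_bigcup//; try by move=> k _; exact: trig_sigma_measurable.
apply: eq_eseriesr => k _.
have DK : B `&` seqDU K k = (B `&` seqDU K k) `&` K k.
  by rewrite -setIA; congr (_ `&` _); rewrite setIidl// /seqDU => x [].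
by rewrite DK; exact: H.
Qed.

(** The weight is the constant 1: this is the uniqueness theorem for characteristic functions. *)
Lemma eq_finite_measure_trig B : (m1 setT < +oo)%E -> (m2 setT < +oo)%E ->
  (forall f r, L f -> (\int[m1]_x (cos (f x + r))%:E =
                       \int[m2]_x (cos (f x + r))%:E)%E) ->
  trig_sigma B -> m1 B = m2 B.
Proof.
move=> f1 f2 cosE sB.
have e : [set x | 1 / 2 < (cst 1 : S -> R) x] = setT.
  by apply/seteqP; split => x //= _; lra.
rewrite -[B]setIT -e; apply: eq_measure_trig_weight => //.
- exact: trig_cst.
- by move=> x /=; lra.
- by apply: measurable_bounded_integrable => //; exact: bounded_cst.
- by apply: measurable_bounded_integrable => //; exact: bounded_cst.
- move=> f r Lf.
  under eq_integral do rewrite mulr1.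
  under [in RHS]eq_integral do rewrite mulr1.
  exact: cosE.
- by lra.
Qed.

(** [B] is covered by the sets where some weight [(1 - cos (g k)) / 2] is positive, and each of
    these by the sets where that weight exceeds a fixed threshold, on which both measures are
    finite. *)
Lemma eq_measure_levy (B : set S) :
  (forall g, L g -> m1.-integrable setT (EFin \o (fun x => 1 - cos (g x)))) ->
  (forall g, L g -> m2.-integrable setT (EFin \o (fun x => 1 - cos (g x)))) ->
  (forall f g r, L f -> L g ->
     (\int[m1]_x (cos (f x + r) * (1 - cos (g x)))%:E =
      \int[m2]_x (cos (f x + r) * (1 - cos (g x)))%:E)%E) ->
  trig_sigma B ->
  (exists2 g : nat -> S -> R, (forall k, L (g k)) &
     forall x, B x -> exists k, cos (g k x) != 1) ->
  m1 B = m2 B.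
Proof.
move=> i1 i2 cosE sB [g Lg gB].
have [_ _ LZ] := Lsub.
pose w k x := (1 - cos (g k x)) / 2.
have Aw k : trig_poly L (w k).
  rewrite (_ : w k = (fun x => - 2^-1 * cos (g k x + 0)) \+ cst 2^-1); last first.
    by apply/funext => x; rewrite /w /= addr0; field.
  by apply: trig_add; [exact: trig_cos|exact: trig_cst].
have w01 k x : 0 <= w k x <= 1.
  by rewrite /w; have := cos_geN1 (g k x); have := cos_le1 (g k x); lra.
have iw (m : {measure set S -> \bar R}) k :
    (forall g, L g -> m.-integrable setT (EFin \o (fun x => 1 - cos (g x)))) ->
    m.-integrable setT (EFin \o w k).
  move=> i; have := integrableZl measurableT (2^-1) (i _ (Lg k)).
  apply: eq_integrable => // x _ /=.
  by rewrite -EFinM mulrC.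
have sw k : measurable_fun setT (w k : SG -> R).
  apply: measurable_funM; last exact: measurable_cst.
  apply: measurable_funB; first exact: measurable_cst.
  apply: (measurableT_comp (continuous_measurable_fun (@continuous_cos R))).
  exact: trig_sigma_fun.
have swd k dl : trig_sigma [set x | dl < w k x].
  have := sw k measurableT _ (measurable_itv `]dl, +oo[).
  by congr (_ _); rewrite setTI; apply/seteqP; split => x /=; rewrite in_itv/= andbT.
apply: (@eq_measure_trig_cover (fun k => [set x | 0 < w k x])) => //.
  move=> x /gB[k gk]; exists k => //=.
  by rewrite /w; have := cos_le1 (g k x); rewrite le_eqVlt (negbTE gk)/=; lra.
move=> C k sC.
(* [n.+2] keeps every threshold strictly below 1, as [eq_measure_trig_weight] demands. *)
apply: (@eq_measure_trig_cover (fun n => [set x | n.+2%:R^-1 < w k x])) => //.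
- move=> x [_ /= w0].
  have [n] := ltr_add_invr w0; rewrite add0r => nw.
  exists n => //=; apply: lt_trans nw.
  by rewrite ltf_pV2 ?posrE// ltr_nat.
- by apply: (@measurableI _ SG); [exact: sC|exact: swd].
- move=> E n sE; apply: eq_measure_trig_weight => //.
  + exact: iw.
  + exact: iw.
  + move=> f r Lf.
    have Ac : trig_poly L (fun x => 1 * cos (f x + r)) by exact: trig_cos.
    have ig (m : {measure set S -> \bar R}) :
      (forall g, L g -> m.-integrable setT (EFin \o (fun x => 1 - cos (g x)))) ->
      m.-integrable setT (fun x => (cos (f x + r) * (1 - cos (g k x)))%:E).
      move=> i; apply: (@le_integrable _ _ _ _ _ measurableT _
        (EFin \o (fun x => 1 - cos (g k x)))).
      * apply/measurable_EFinP/measurable_funM.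
          have := trig_poly_measurable Ac.
          by apply: eq_measurable_fun => x _; rewrite mul1r.
        have := measurable_int _ (i _ (Lg k)).
        by move/measurable_EFinP.
      * move=> x _ /=; rewrite lee_fin normrM ler_piMl//.
        by rewrite ler_norml cos_geN1 cos_le1.
      * exact: i.
    rewrite /w.
    under eq_integral do rewrite mulrA mulrC EFinM.
    under [in RHS]eq_integral do rewrite mulrA mulrC EFinM.
    by rewrite !integralZl ?cosE//; exact: ig.
  + by rewrite invf_lt1 ?ltr1n// invr_gt0 ltr0n.
Qed.

End trigonometric_polynomials.

(** * Bounded random variables *)

Section real_integrals.
Context {d : measure_display} {T : measurableType d} {R : realType}.
Variable m : {measure set T -> \bar R}.

Definition Rintegrable (f : T -> R) := m.-integrable setT (EFin \o f).

Lemma RintegrableD f g : Rintegrable f -> Rintegrable g -> Rintegrable (fun x => f x + g x).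
Proof. by move=> If Ig; have := integrableD measurableT If Ig; exact: eq_integrable. Qed.

Lemma RintegrableB f g : Rintegrable f -> Rintegrable g -> Rintegrable (fun x => f x - g x).
Proof. by move=> If Ig; have := integrableB measurableT If Ig; exact: eq_integrable. Qed.

Lemma RintegrableZ c f : Rintegrable f -> Rintegrable (fun x => c * f x).
Proof. by move=> If; have := integrableZl measurableT c If; exact: eq_integrable. Qed.

Lemma Rintegrable_le (f g : T -> R) : measurable_fun setT f -> (forall x, `|f x| <= g x) ->
  Rintegrable g -> Rintegrable f.
Proof.
move=> mf fg; apply: le_integrable => //; first exact/measurable_EFinP.
by move=> x _ /=; rewrite lee_fin (le_trans (fg x))// ler_norm.
Qed.

Lemma Rintegrable0 : Rintegrable (cst 0).
Proof. exact: integrable0. Qed.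

Lemma Rintegrable_sum (I : Type) (s : seq I) (f : I -> T -> R) :
  (forall i, Rintegrable (f i)) -> Rintegrable (fun x => \sum_(i <- s) f i x).
Proof.
move=> If; elim: s => [|i s IH].
  by apply: eq_integrable Rintegrable0 => // x _ /=; rewrite big_nil.
by apply: eq_integrable (RintegrableD (If i) IH) => // x _ /=; rewrite big_cons.
Qed.

Lemma Rintegral_sum (I : Type) (s : seq I) (f : I -> T -> R) :
  (forall i, Rintegrable (f i)) ->
  \int[m]_x (\sum_(i <- s) f i x) = \sum_(i <- s) \int[m]_x f i x.
Proof.
move=> If; elim: s => [|i s IH].
  under eq_Rintegral do rewrite big_nil.
  by rewrite big_nil Rintegral_cst// mul0r.
under eq_Rintegral do rewrite big_cons.
by rewrite big_cons RintegralD ?IH//; [exact: If|exact: Rintegrable_sum].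
Qed.

Lemma Rintegrable_indic (A : set T) : measurable A -> (m A < +oo)%E ->
  Rintegrable \1_A.
Proof.
move=> mA Aoo; apply/integrableP; split; first exact/measurable_EFinP/measurable_indic.
rewrite (eq_integral (fun x => (\1_A x)%:E)); last first.
  by move=> t _; rewrite gee0_abs// lee_fin.
by rewrite integral_indic// setIT.
Qed.

Lemma Rintegral_indic (A : set T) : measurable A -> \int[m]_x \1_A x = fine (m A).
Proof. by move=> mA; rewrite /Rintegral integral_indic ?setIT. Qed.

Lemma EFin_Rintegral f : Rintegrable f -> (\int[m]_x f x)%:E = (\int[m]_x (f x)%:E)%E.
Proof. by move=> If; rewrite fineK//; exact: integrable_fin_num. Qed.

Lemma RintegralB_norm_le (f g h : T -> R) : Rintegrable f -> Rintegrable g -> Rintegrable h ->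
  (forall x, `|f x - g x| <= h x) ->
  `|\int[m]_x f x - \int[m]_x g x| <= \int[m]_x h x.
Proof.
move=> If Ig Ih fgh; rewrite -RintegralB//.
have Ifg := RintegrableB If Ig.
apply: le_trans (le_normr_Rintegral measurableT Ifg) _.
by apply: le_Rintegral => //; exact: integrable_norm.
Qed.

End real_integrals.

Section bounded_random_variables.
Context {R : realType} {d : measure_display} {Omega : measurableType d}.
Variable P : probability Omega R.

Definition bounded_measurable (f : Omega -> R) :=
  measurable_fun setT f /\ exists K : R, forall w, `|f w| <= K.

Lemma bounded_measurable_integrable f : bounded_measurable f -> Rintegrable P f.
Proof.
move=> [mf [K fK]].
apply: (@Rintegrable_le _ _ _ _ _ (cst K)) => //.
apply: measurable_bounded_integrable => //.
  by apply: (@le_lt_trans _ _ 1%E); [exact: probability_le1|exact: ltry].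
exact: bounded_cst.
Qed.

Lemma expectation_cst (c : R) : \int[P]_w c = c.
Proof.
rewrite Rintegral_cst//.
have /= -> := @probability_setT _ _ _ P.
by rewrite /= mulr1.
Qed.

Lemma expectation_indic (A : set Omega) : measurable A ->
  \int[P]_w \1_A w = fine (P A).
Proof. exact: Rintegral_indic. Qed.

Lemma bounded_measurableM f g : bounded_measurable f -> bounded_measurable g ->
  bounded_measurable (fun w => f w * g w).
Proof.
move=> [mf [K fK]] [mg [K' gK]]; split; first exact: measurable_funM.
by exists (K * K') => w; rewrite normrM ler_pM.
Qed.

Lemma bounded_measurable_indic (A : set Omega) : measurable A ->
  bounded_measurable \1_A.
Proof.
move=> mA; split; first exact: measurable_indic.
by exists 1 => w; rewrite indicE ger0_norm// lern1 leq_b1.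
Qed.

Lemma bounded_measurable_cos (f : Omega -> R) r : measurable_fun setT f ->
  bounded_measurable (fun w => cos (f w + r)).
Proof.
move=> mf; split.
  apply: (measurableT_comp (continuous_measurable_fun (@continuous_cos R))).
  by apply: measurable_funD => //; exact: measurable_cst.
by exists 1 => w; rewrite ler_norml cos_geN1 cos_le1.
Qed.

Definition lattice (Y : Omega -> \bar R) (k : nat) := [set w | Y w = k%:R%:E].

Lemma measurable_lattice Y k : measurable_fun setT Y -> measurable (lattice Y k).
Proof.
move=> mY; rewrite (_ : lattice Y k = setT `&` Y @^-1` [set k%:R%:E]); last first.
  by rewrite setTI.
by apply: mY => //; exact: emeasurable_set1.
Qed.

Let sum_lattice Y n w : 0 <= \sum_(k < n) (\1_(lattice Y k) w : R) <= 1.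
Proof.
rewrite sumr_ge0//=.
have [[k Yk]|noY] := pselect (exists k : 'I_n, lattice Y k w); last first.
  rewrite big1// => k _; rewrite indicE memNset// => Yk.
  by apply: noY; exists k.
rewrite (bigD1 k)//= big1 ?addr0 => [|j jk]; first by rewrite indicE lern1 leq_b1.
rewrite indicE memNset// => Yj; move: jk; rewrite -val_eqE/=.
suff -> : j = k :> nat by rewrite eqxx.
by apply/eqP; rewrite -(eqr_nat R); apply/eqP/EFin_inj; rewrite -Yj -Yk.
Qed.

(** The masses sum to 1, so [Y] is almost surely a natural number; the error of a partial sum is at
    most [K] times the mass still missing. *)
Lemma expectation_lattice Y (pk : nat -> R) f : measurable_fun setT Y ->
  (forall k, P (lattice Y k) = (pk k)%:E) ->
  \sum_(k < n) pk k @[n --> \oo] --> (1 : R) ->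
  bounded_measurable f ->
  \sum_(k < n) \int[P]_w (f w * \1_(lattice Y k) w) @[n --> \oo] -->
  \int[P]_w f w.
Proof.
move=> mY Pk p1 bf; have [mf [K fK]] := bf.
have mA k := measurable_lattice k mY.
have bA k : bounded_measurable \1_(lattice Y k) by exact: bounded_measurable_indic.
have bfA k := bounded_measurable_integrable (bounded_measurableM bf (bA k)).
have H n : `|\sum_(k < n) \int[P]_w (f w * \1_(lattice Y k) w) - \int[P]_w f w| <=
    K * (1 - \sum_(k < n) pk k).
  rewrite -Rintegral_sum//.
  have IA : Rintegrable P (fun w => \sum_(k < n) \1_(lattice Y k) w).
    by apply: Rintegrable_sum => k; exact: bounded_measurable_integrable.
  have I1 : Rintegrable P (cst 1).
    apply: bounded_measurable_integrable; split => //.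
    by exists 1 => w; rewrite /= normr1.
  have -> : K * (1 - \sum_(k < n) pk k) =
      \int[P]_w (K * (1 - \sum_(k < n) \1_(lattice Y k) w)).
    rewrite RintegralZl//; last exact: RintegrableB.
    rewrite RintegralB//= expectation_cst.
    rewrite Rintegral_sum; last by move=> k; exact: bounded_measurable_integrable.
    congr (_ * (_ - _)); apply: eq_bigr => k _.
    by rewrite expectation_indic// Pk.
  apply: RintegralB_norm_le.
  - exact: Rintegrable_sum.
  - exact: bounded_measurable_integrable.
  - by apply: RintegrableZ; exact: RintegrableB.
  - move=> w; rewrite -mulr_sumr -{2}[f w]mulr1 -mulrBr normrM.
    have := sum_lattice Y n w => h.
    by rewrite ler_pM// distrC ger0_norm; lra.
have KP : K * (1 - \sum_(k < n) pk k) @[n --> \oo] --> (0 : R).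
  rewrite [X in _ --> X](_ : 0 = K * (1 - 1)); last by rewrite subrr mulr0.
  apply: cvgM; first exact: cvg_cst.
  by apply: cvgB => //; exact: cvg_cst.
apply: (@squeeze_cvgr _ _ _ _
  (fun n => \int[P]_w f w - K * (1 - \sum_(k < n) pk k))
  (fun n => \int[P]_w f w + K * (1 - \sum_(k < n) pk k))).
- by apply: nearW => n; rewrite -ler_distl; exact: H.
- by rewrite -[X in _ --> X]subr0; apply: cvgB => //; exact: cvg_cst.
- by rewrite -[X in _ --> X]addr0; apply: cvgD => //; exact: cvg_cst.
Qed.

End bounded_random_variables.

(** * Poisson random measures *)

Lemma Rcvg_unique (R : realType) (u : nat -> R) (a b : R) :
  u n @[n --> \oo] --> a -> u n @[n --> \oo] --> b -> a = b.
Proof. exact: (cvg_unique (@Rhausdorff R)). Qed.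

Section poisson_characteristic_function.
Context {R : realType} {d d' : measure_display}.
Context {Omega : measurableType d} {S : measurableType d'}.
Variables (P : probability Omega R) (nu : {measure set S -> \bar R}).
Variable (N : Omega -> {measure set S -> \bar R}).
Hypothesis HN : poisson_random_measure P nu N.

Lemma measurable_fine_prm B : measurable B ->
  measurable_fun setT (fun w => fine (N w B)).
Proof.
by move=> mB; apply: measurableT_comp => //; exact: (prm_measurable HN).
Qed.

Lemma cvg_poisson_mass (l : R) : 0 <= l ->
  \sum_(k < n) (expR (- l) * l ^+ k / k`!%:R) @[n --> \oo] --> (1 : R).
Proof.
move=> l0; have := @cvg_poisson_series R 0 0 l l0.
rewrite cos0 sin0 mulr1 mulr0 addr0 cos0 mulr1 => h.
have -> : (fun n : nat => \sum_(k < n) (expR (- l) * l ^+ k / k`!%:R)) =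
    (fun n => expR (- l) * \sum_(k < n) (l ^+ k / k`!%:R * cos (k%:R * 0 + 0))).
  apply/funext => n; rewrite mulr_sumr; apply: eq_bigr => k _.
  by rewrite mulr0 addr0 cos0 mulr1 mulrA.
rewrite -[X in _ --> X](_ : expR (- l) * expR l = 1); last first.
  by rewrite -expRD addNr expR0.
by apply: cvgM => //; exact: cvg_cst.
Qed.

Lemma prm_lattice B k : measurable B -> (nu B < +oo)%E ->
  P (lattice (N^~ B) k) = (expR (- fine (nu B)) * fine (nu B) ^+ k / k`!%:R)%:E.
Proof. exact: (prm_poisson HN). Qed.

Lemma prm_expectation_lattice B f : measurable B -> (nu B < +oo)%E ->
  bounded_measurable f ->
  \sum_(k < n) \int[P]_w (f w * \1_(lattice (N^~ B) k) w) @[n --> \oo] -->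
  \int[P]_w f w.
Proof.
move=> mB Boo bf.
apply: (expectation_lattice (prm_measurable HN mB) (fun k => prm_lattice k mB Boo) _ bf).
exact/cvg_poisson_mass/fine_ge0.
Qed.

(** The expectation of the indicator of [N B = +oo] is the sum of its restrictions to the events
    [N B = k], all of which are 0. *)
Lemma prm_finite B : measurable B -> (nu B < +oo)%E ->
  {ae P, forall w, (N w B < +oo)%E}.
Proof.
move=> mB Boo.
pose A := [set w | N w B = +oo%E].
have mA : measurable A.
  rewrite (_ : A = setT `&` N^~ B @^-1` [set +oo%E]); last by rewrite setTI.
  by apply: (prm_measurable HN) => //; exact: emeasurable_set1.
have bA := bounded_measurable_indic (R := R) mA.
have := prm_expectation_lattice mB Boo bA.
have -> : (fun n : nat => \sum_(k < n) \int[P]_w (\1_A w * \1_(lattice (N^~ B) k) w))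
    = cst (0 : R).
  apply/funext => n; rewrite /= big1// => k _.
  under eq_Rintegral.
    move=> w _; have -> : \1_A w * \1_(lattice (N^~ B) k) w = 0 :> R.
      rewrite !indicE; have [/set_mem Aw|_] := boolP (w \in A); last by rewrite mul0r.
      by rewrite memNset ?mulr0// /lattice/= Aw.
    over.
  by rewrite expectation_cst.
move=> h; have : \int[P]_w \1_A w = 0 by apply: (Rcvg_unique h); exact: cvg_cst.
rewrite expectation_indic// => PA0.
exists A; split => //.
  by rewrite -[LHS]fineK ?PA0//; exact: fin_num_measure.
move=> w /= /negP; rewrite -leNgt leye_eq => /eqP; exact.
Qed.

(* The events [E i] on the remaining counts are carried along so that, in the induction on [j],
   the value of the next count can be fixed by such an event; it then only shifts [r]. *)
Lemma prm_cos_partial m (B : 'I_m -> set S) (c : 'I_m -> R) :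
  (forall i, measurable (B i)) -> (forall i, (nu (B i) < +oo)%E) ->
  trivIset setT B -> forall j, (j <= m)%N -> forall r (E : 'I_m -> set (\bar R)),
  (forall i, measurable (E i)) ->
  \int[P]_w (cos (\sum_(i < m | (i < j)%N) c i * fine (N w (B i)) + r) *
     \1_[set w | forall i : 'I_m, (j <= i)%N -> E i (N w (B i))] w) =
  expR (\sum_(i < m | (i < j)%N) fine (nu (B i)) * (cos (c i) - 1)) *
  cos (\sum_(i < m | (i < j)%N) fine (nu (B i)) * sin (c i) + r) *
  \prod_(i < m | (j <= i)%N) fine (P [set w | E i (N w (B i))]).
Proof.
move=> mB Boo tB.
have mE j (E : 'I_m -> set (\bar R)) : (forall i, measurable (E i)) ->
    measurable [set w | forall i : 'I_m, (j <= i)%N -> E i (N w (B i))].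
  move=> mE; rewrite (_ : mkset _ =
    \bigcap_(i in [set i : 'I_m | (j <= i)%N]) ((fun w => N w (B i)) @^-1` E i)).
    apply: fin_bigcap_measurable => // i _.
    by rewrite -[X in measurable X]setTI; apply: (prm_measurable HN).
  by apply/seteqP; split=> w h i; exact: h.
elim=> [_|j IH jm] r E Em.
  rewrite [X in expR X]big_pred0// [X in cos (X + r)]big_pred0// add0r expR0 mul1r.
  under eq_Rintegral do rewrite big_pred0// add0r.
  rewrite RintegralZl//; last exact/bounded_measurable_integrable/bounded_measurable_indic/mE.
  rewrite expectation_indic; last exact: mE.
  congr (_ * _).
  have -> : [set w | forall i : 'I_m, (0 <= i)%N -> E i (N w (B i))] =
            [set w | forall i, E i (N w (B i))].
    by apply/seteqP; split=> w h i; [exact: h|move=> _; exact: h].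
  rewrite (prm_independent HN)//.
  rewrite (eq_bigr (fun i => (fine (P [set w | E i (N w (B i))]))%:E)).
    by rewrite -(big_morph EFin (@EFinM R) erefl).
  move=> i _; rewrite fineK//; apply: fin_num_measure.
  by rewrite -[X in measurable X]setTI; apply: (prm_measurable HN).
pose jo := Ordinal jm.
have split_j (V : Type) (idx : V) (op : Monoid.com_law idx) (F : 'I_m -> V) :
    \big[op/idx]_(i < m | (i < j.+1)%N) F i =
    op (F jo) (\big[op/idx]_(i < m | (i < j)%N) F i).
  rewrite (bigD1 jo)//=; congr (op _ _); apply: eq_bigl => i.
  by rewrite -val_eqE/= ltnS [(i < j)%N]ltn_neqAle andbC.
have split_j' (F : 'I_m -> R) :
    \prod_(i < m | (j <= i)%N) F i = F jo * \prod_(i < m | (j < i)%N) F i.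
  rewrite (bigD1 jo)//=; congr (_ * _); apply: eq_bigl => i.
  by rewrite -val_eqE/= [(j < i)%N]ltn_neqAle andbC eq_sym.
set f := fun w => _.
have bf : bounded_measurable f.
  apply: bounded_measurableM; last exact/bounded_measurable_indic/mE.
  apply: bounded_measurable_cos.
  rewrite (_ : (fun _ => _) =
      (fun w => \sum_(i < m) (if (i < j.+1)%N then c i * fine (N w (B i)) else 0))); last first.
    by apply/funext => w; rewrite big_mkcond.
  apply: measurable_sum => i; case: (ltnP i j.+1) => _ //.
  by apply: measurable_funM => //; exact: measurable_fine_prm.
(* The expectation is split along the values of [N (B jo)]; the induction hypothesis turns the
   pieces into the terms of the Poisson series with phase [Sj + r]. *)
apply: (Rcvg_unique (prm_expectation_lattice (mB jo) (Boo jo) bf)).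
set l := fine (nu (B jo)); have l0 : 0 <= l by exact: fine_ge0.
set C := \sum_(i < m | (i < j)%N) fine (nu (B i)) * (cos (c i) - 1).
set Sj := \sum_(i < m | (i < j)%N) fine (nu (B i)) * sin (c i).
set Q := \prod_(i < m | (j < i)%N) fine (P [set w | E i (N w (B i))]).
have -> : (fun n : nat => \sum_(k < n) \int[P]_w (f w * \1_(lattice (N^~ (B jo)) k) w)) =
   (fun n => expR C * Q * expR (- l) *
     \sum_(k < n) (l ^+ k / k`!%:R * cos (k%:R * c jo + (Sj + r)))).
  apply/funext => n; rewrite mulr_sumr; apply: eq_bigr => k _.
  pose E' i := if i == jo then [set k%:R%:E] else E i.
  have mE' i : measurable (E' i).
    by rewrite /E'; case: ifP => _ //; exact: emeasurable_set1.
  have := IH (ltnW jm) (k%:R * c jo + r) E' mE'.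
  rewrite split_j' /E' eqxx.
  have -> : fine (P [set w | [set k%:R%:E] (N w (B jo))]) =
      expR (- l) * l ^+ k / k`!%:R.
    by have /= -> := prm_lattice k (mB jo) (Boo jo).
  have -> : \prod_(i < m | (j < i)%N)
      fine (P [set w | (if i == jo then [set k%:R%:E] else E i) (N w (B i))]) = Q.
    apply: eq_bigr => i ji; case: eqP => // ij.
    by move: ji; rewrite ij ltnn.
  rewrite -/C -/Sj => h.
  transitivity (expR C * cos (Sj + (k%:R * c jo + r)) * (expR (- l) * l ^+ k / k`!%:R * Q)).
    rewrite -h; apply: eq_Rintegral => w _.
    have indM (U V : set Omega) : \1_U w * \1_V w = \1_(U `&` V) w :> R.
      by rewrite indicI.
    rewrite /f split_j /= -mulrA indM.
    have [Yk|Yk] := eqVneq (N w (B jo)) k%:R%:E.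
      rewrite Yk /= [_ * k%:R]mulrC; congr (cos _ * _); first by ring.
      rewrite !indicE; congr (nat_of_bool _)%:R.
      apply/idP/idP => /set_mem/= h'; apply/mem_set => /=.
        move=> i ji; case: eqP => [->//|/eqP ij]; apply: (h'.1).
        by rewrite ltn_neqAle ji andbT eq_sym; move: ij; rewrite -val_eqE.
      split; last exact: Yk.
      move=> i ji; have := h' i (ltnW ji); case: eqP => // ij.
      by move: ji; rewrite ij ltnn.
    rewrite [X in _ * X = _]indicE [X in _ = _ * X]indicE !memNset ?mulr0//=.
      by move=> /(_ jo (leqnn _)); rewrite eqxx; apply/eqP.
    by move=> [_]; apply/eqP.
  rewrite (_ : k%:R * c jo + (Sj + r) = Sj + (k%:R * c jo + r)); last by ring.
  by ring.
rewrite (split_j R 0 +%R) (split_j R 0 +%R) -/l -/C -/Sj expRD.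
have -> : l * (cos (c jo) - 1) = l * cos (c jo) - l by ring.
rewrite expRD.
have -> : expR (l * cos (c jo)) * expR (- l) * expR C * cos (l * sin (c jo) + Sj + r) * Q =
   expR C * Q * expR (- l) * (expR (l * cos (c jo)) * cos (l * sin (c jo) + (Sj + r))).
  by rewrite addrA; ring.
by apply: cvgM; [exact: cvg_cst|exact: cvg_poisson_series].
Qed.

Lemma prm_cos_disjoint m (B : 'I_m -> set S) (c : 'I_m -> R) r :
  (forall i, measurable (B i)) -> (forall i, (nu (B i) < +oo)%E) ->
  trivIset setT B ->
  \int[P]_w cos (\sum_(i < m) c i * (fine (N w (B i)) - fine (nu (B i))) + r) =
  expR (\sum_(i < m) fine (nu (B i)) * (cos (c i) - 1)) *
  cos (\sum_(i < m) fine (nu (B i)) * (sin (c i) - c i) + r).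
Proof.
move=> mB Boo tB.
(* At [j = m] no event is left, and the compensator is absorbed by the phase. *)
have := prm_cos_partial c mB Boo tB (leqnn m)
  (r - \sum_(i < m) c i * fine (nu (B i))) (fun i => measurableT).
rewrite [X in _ * X](_ : _ = 1) ?mulr1; last first.
  by rewrite big_pred0// => i; rewrite leqNgt ltn_ord.
have allS (F : 'I_m -> R) : \sum_(i < m | (i < m)%N) F i = \sum_(i < m) F i.
  by apply: eq_bigl => i; rewrite ltn_ord.
rewrite !allS => h; transitivity (expR (\sum_(i < m) fine (nu (B i)) * (cos (c i) - 1)) *
    cos (\sum_(i < m) fine (nu (B i)) * sin (c i) + (r - \sum_(i < m) c i * fine (nu (B i))))).
  rewrite -h; apply: eq_Rintegral => w _.
  rewrite allS indicE mem_set ?mulr1//; congr cos.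
  under eq_bigr do rewrite mulrBr.
  by rewrite sumrB; ring.
congr (_ * cos _).
under [in RHS]eq_bigr do rewrite mulrBr.
rewrite sumrB.
under [X in _ = _ - X + _]eq_bigr do rewrite mulrC.
by ring.
Qed.

End poisson_characteristic_function.

(** * Characteristic function of an elementary integral *)

Section elementary_characteristic_function.
Context {R : realType} {d d' : measure_display}.
Context {Omega : measurableType d} {S : measurableType d'}.
Variables (P : probability Omega R) (nu : {measure set S -> \bar R}).
Variable (N : Omega -> {measure set S -> \bar R}).
Hypothesis HN : poisson_random_measure P nu N.
Variable e : elementary nu.

Let n := el_size e.
Let c (j : 'I_n) : R := el_coef j.
Let B (j : 'I_n) : set S := el_set j.

(** The sets of an elementary function may overlap, while independence concerns disjoint sets; hence
    the atoms of the algebra they generate. The empty type is discarded, since the complement of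
    their union may have infinite measure. *)
Let atom (a : {set 'I_n}) : set S :=
  [set s | a != finset.set0 /\ forall j, (j \in a) <-> B j s].

Let M := #|{: {set 'I_n}}|.
Let typ (i : 'I_M) : {set 'I_n} := enum_val i.
Let Bi (i : 'I_M) : set S := atom (typ i).

Let mB j : measurable (B j). Proof. exact: el_measurable. Qed.
Let Boo j : (nu (B j) < +oo)%E. Proof. exact: el_finite. Qed.

Let mBi i : measurable (Bi i).
Proof.
rewrite /Bi; have [->|a0] := eqVneq (typ i) finset.set0.
  by rewrite (_ : atom _ = set0)//; apply/seteqP; split => s // [] /eqP.
rewrite (_ : atom _ = \bigcap_(j in [set: 'I_n])
    (if j \in typ i then B j else ~` B j)).
  apply: fin_bigcap_measurable => // j _.
  by case: (j \in _) => //; exact: measurableC.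
apply/seteqP; split => s.
  move=> [_ h] j _; case: ifPn => [/h//|ja /h].
  by rewrite (negbTE ja).
move=> h; split => // j; have := h j I; case: ifPn => ja //=.
Qed.

Let atom_uniq a b s : atom a s -> atom b s -> a = b.
Proof.
move=> [_ ha] [_ hb]; apply/setP => j; apply/idP/idP => ja.
  exact/hb/ha.
exact/ha/hb.
Qed.

Let tBi : trivIset setT Bi.
Proof.
move=> i j _ _ [s [si sj]]; apply: enum_val_inj.
exact: atom_uniq si sj.
Qed.

Let sub_Bi i j : j \in typ i -> Bi i `<=` B j.
Proof. by move=> ji s [_ h]; apply/h. Qed.

Let Bi_oo i : (nu (Bi i) < +oo)%E.
Proof.
have [i0|[j ji]] := set_0Vmem (typ i).
  rewrite (_ : Bi i = set0) ?measure0 ?ltry//.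
  by apply/seteqP; split => s // [] /eqP.
apply: le_lt_trans (Boo j); apply: le_measure; rewrite ?inE//.
exact: sub_Bi.
Qed.

Let type_of (s : S) : {set 'I_n} := finset.finset (fun j => `[< B j s >]).

Let atom_type s j : B j s -> atom (type_of s) s.
Proof.
move=> Bs; split.
  by apply/finset.set0Pn; exists j; rewrite inE; apply/asboolP.
by move=> k; rewrite inE; split => /asboolP.
Qed.

Let BE j : B j = \big[setU/set0]_(i < M | j \in typ i) Bi i.
Proof.
rewrite -bigcup_seq_cond; apply/seteqP; split => s.
  move=> Bs; exists (enum_rank (type_of s)).
    by rewrite /= mem_index_enum/= /typ enum_rankK inE; apply/asboolP.
  by rewrite /Bi /typ enum_rankK; exact: atom_type Bs.
by move=> [i /= /andP[_ ji]]; exact: sub_Bi.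
Qed.

Let measure_B (m : {measure set S -> \bar R}) j : (m (B j) < +oo)%E ->
  fine (m (B j)) = \sum_(i < M | j \in typ i) fine (m (Bi i)).
Proof.
move=> mBoo; rewrite {1}BE measure_bigsetU_ord//.
rewrite (eq_bigr (fun i => (fine (m (Bi i)))%:E)) ?sumEFin// => i ji.
rewrite fineK// ge0_fin_numE//; apply: le_lt_trans mBoo.
by apply: le_measure; rewrite ?inE//; exact: sub_Bi.
Qed.

Let cc (i : 'I_M) : R := \sum_(j in typ i) c j.

(** An elementary function is constant on each atom; [phi 0 = 0] takes care of the points outside
    all atoms. *)
Let elementary_fun_comp (phi : R -> R) s : phi 0 = 0 ->
  phi (elementary_fun e s) = \sum_(i < M) phi (cc i) * \1_(Bi i) s.
Proof.
move=> phi0.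
have eE : elementary_fun e s = \sum_(j in type_of s) c j.
  rewrite /elementary_fun [RHS]big_mkcond/=; apply: eq_bigr => j _.
  rewrite inE indicE; have [Bs|Bs] := pselect (B j s).
    by rewrite asboolT// mem_set// mulr1.
  by rewrite asboolF// memNset// mulr0.
have [s0|[j]] := set_0Vmem (type_of s).
  rewrite eE s0 finset.big_set0 phi0 big1// => i _.
  rewrite indicE memNset ?mulr0// => -[i0 h].
  have [j ji] := finset.set0Pn _ i0.
  have : j \in type_of s by rewrite inE; apply/asboolP/h.
  by rewrite s0 inE.
rewrite inE => /asboolP Bs.
rewrite (bigD1 (enum_rank (type_of s)))//= big1 ?addr0 => [|i /eqP it].
  rewrite indicE mem_set ?mulr1; last first.
    by rewrite /Bi /typ enum_rankK; exact: atom_type Bs.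
  by rewrite eE /cc /typ enum_rankK.
rewrite indicE memNset ?mulr0// => Bis; apply: it.
by rewrite -(atom_uniq Bis (atom_type Bs)) enum_valK.
Qed.

(** The counts are assumed finite because [fine] is additive on finite values; [prm_finite] provides
    this almost surely. *)
Let elementary_integral_comp w : (forall j, (N w (B j) < +oo)%E) ->
  elementary_integral N e w =
  \sum_(i < M) cc i * (fine (N w (Bi i)) - fine (nu (Bi i))).
Proof.
move=> Noo; rewrite /elementary_integral.
transitivity (\sum_(j < n) \sum_(i < M | j \in typ i)
    c j * (fine (N w (Bi i)) - fine (nu (Bi i)))).
  apply: eq_bigr => j _; rewrite -mulr_sumr sumrB; congr (_ * _).
  by rewrite -measure_B// -measure_B.
rewrite (exchange_big_dep xpredT)//=; apply: eq_bigr => i _.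
by rewrite /cc mulr_suml.
Qed.

Lemma measurable_elementary_fun : measurable_fun setT (elementary_fun e).
Proof.
by apply: measurable_sum => j; apply: measurable_funM.
Qed.

Lemma measurable_elementary_integral :
  measurable_fun setT (elementary_integral N e).
Proof.
apply: measurable_sum => j; apply: measurable_funM => //.
apply: measurable_funB => //.
exact: (measurable_fine_prm HN).
Qed.

Let Rintegral_comp (phi : R -> R) : phi 0 = 0 ->
  \int[nu]_s phi (elementary_fun e s) = \sum_(i < M) fine (nu (Bi i)) * phi (cc i).
Proof.
move=> phi0; have IB i := Rintegrable_indic (mBi i) (Bi_oo i).
under eq_Rintegral do rewrite elementary_fun_comp//.
rewrite Rintegral_sum; last by move=> i; exact: RintegrableZ.
apply: eq_bigr => i _; rewrite RintegralZl//; last exact: IB.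
by rewrite Rintegral_indic// mulrC.
Qed.

Lemma elementary_integral_cos r :
  \int[P]_w cos (elementary_integral N e w + r) =
  expR (\int[nu]_s (cos (elementary_fun e s) - 1)) *
  cos (\int[nu]_s (sin (elementary_fun e s) - elementary_fun e s) + r).
Proof.
rewrite (Rintegral_comp (phi := fun x => cos x - 1)) ?cos0 ?subrr//.
rewrite (Rintegral_comp (phi := fun x => sin x - x)) ?sin0 ?subrr//.
rewrite -(prm_cos_disjoint HN)//.
have Nfin : {ae P, forall w, forall j, (N w (B j) < +oo)%E}.
  have H j := prm_finite HN (mB j) (Boo j).
  exact: filter_forall.
congr fine; apply: ae_eq_integral => //.
- apply/measurable_EFinP.
  apply: (measurableT_comp (continuous_measurable_fun (@continuous_cos R))).
  by apply: measurable_funD => //; exact: measurable_elementary_integral.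
- apply/measurable_EFinP.
  apply: (measurableT_comp (continuous_measurable_fun (@continuous_cos R))).
  apply: measurable_funD => //.
  apply: measurable_sum => i; apply: measurable_funM => //.
  apply: measurable_funB => //.
  exact: (measurable_fine_prm HN).
- apply: filterS Nfin => w h _ /=.
  by rewrite elementary_integral_comp.
Qed.

End elementary_characteristic_function.

(** * Compensated integrals *)

Section square_integrable.
Context {d : measure_display} {T : measurableType d} {R : realType}.
Variable m : {measure set T -> \bar R}.
Implicit Types f g : T -> R.

Definition square_integrable f :=
  measurable_fun setT f /\ Rintegrable m (fun x => f x ^+ 2).

Lemma square_integrableP f : measurable_fun setT f ->
  (\int[m]_x (f x ^+ 2)%:E < +oo)%E -> square_integrable f.
Proof.
move=> mf foo; split => //; apply/integrableP; split.
  exact/measurable_EFinP/measurable_funX.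
under eq_integral do rewrite /= ger0_norm ?sqr_ge0//.
exact: foo.
Qed.

Lemma square_integrableZ c f : square_integrable f -> square_integrable (fun x => c * f x).
Proof.
move=> [mf f2]; split; first exact: measurable_funM.
by under [X in Rintegrable m X]eq_fun do rewrite exprMn; exact: RintegrableZ.
Qed.

Lemma square_integrableB f g : square_integrable f -> square_integrable g ->
  square_integrable (fun x => f x - g x).
Proof.
move=> [mf f2] [mg g2]; split; first exact: measurable_funB.
apply: (@Rintegrable_le _ _ _ _ _ (fun x => 2 * f x ^+ 2 + 2 * g x ^+ 2)).
- exact/measurable_funX/measurable_funB.
- by move=> x; rewrite ger0_norm ?sqr_ge0//; have := sqr_ge0 (f x + g x); nra.
- by apply: RintegrableD; exact: RintegrableZ.
Qed.

Lemma square_integrableD f g : square_integrable f -> square_integrable g ->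
  square_integrable (fun x => f x + g x).
Proof.
move=> sf sg; have := square_integrableB sf (square_integrableZ (-1) sg).
by under [X in square_integrable X -> _]eq_fun do rewrite mulN1r opprK.
Qed.

(** Real part of the Levy-Khintchine exponent, the integral of [e^(i f) - 1 - i f]; [sin_exponent]
    is its imaginary part. *)
Definition cos_exponent f := \int[m]_x (cos (f x) - 1).
Definition sin_exponent f := \int[m]_x (sin (f x) - f x).

Lemma cos_integrable f : square_integrable f -> Rintegrable m (fun x => cos (f x) - 1).
Proof.
move=> [mf f2]; apply: (@Rintegrable_le _ _ _ _ _ (fun x => f x ^+ 2)) => //.
  apply: measurable_funB => //.
  exact: (measurableT_comp (continuous_measurable_fun (@continuous_cos R))).
move=> x; have := norm_cosB_le2 (f x) 0.
by rewrite cos0 subr0 normr0 addr0 -expr2 real_normK// num_real.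
Qed.

Lemma sin_integrable f : square_integrable f -> Rintegrable m (fun x => sin (f x) - f x).
Proof.
move=> [mf f2]; apply: (@Rintegrable_le _ _ _ _ _ (fun x => f x ^+ 2)) => //.
  apply: measurable_funB => //.
  exact: (measurableT_comp (continuous_measurable_fun (@continuous_sin R))).
by move=> x; exact: norm_sin_sub_le.
Qed.

(* AM-GM: [2 |a| |a - b| <= e a^2 + (a - b)^2 / e]. *)
Let amgm (a b e : R) : 0 < e ->
  `|a - b| * (`|a| + `|b|) <= (1 + e^-1) * (a - b) ^+ 2 + e * a ^+ 2.
Proof.
move=> e0; have ab : `|b| <= `|a| + `|a - b|.
  by rewrite -{1}(subKr a b) (le_trans (ler_normB _ _)).
rewrite -(real_normK (num_real a)) -(real_normK (num_real (a - b))).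
move: ab (normr_ge0 a) (normr_ge0 (a - b)).
move: `|a| `|b| `|a - b| => x y z yxz x0 z0.
have : 0 <= e^-1 * (e * x - z) ^+ 2.
  by rewrite mulr_ge0 ?sqr_ge0// invr_ge0 ltW.
have -> : e^-1 * (e * x - z) ^+ 2 = e * x ^+ 2 - 2 * (x * z) + e^-1 * z ^+ 2.
  by field; rewrite gt_eqF.
by nra.
Qed.

Section exponent_continuity.
Variables (f g : T -> R) (e : R).
Hypotheses (sf : square_integrable f) (sg : square_integrable g).
Hypotheses (e0 : 0 < e) (e1 : e <= 1).
Hypothesis fg : \int[m]_x ((f x - g x) ^+ 2) <= e ^+ 2.

(** The parameter [e] of the AM-GM bound is taken to be the L^2 distance bound itself: both terms
    are then of order [e], using [e <= 1]. *)
Let bound_int : \int[m]_x ((1 + e^-1) * (f x - g x) ^+ 2 + e * f x ^+ 2) <=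
  e * (2 + \int[m]_x (f x ^+ 2)).
Proof.
have [_ fg2] := square_integrableB sf sg; have [_ f2] := sf.
rewrite RintegralD//; [|exact: RintegrableZ..].
rewrite !RintegralZl//.
rewrite mulrDr lerD2r.
apply: (@le_trans _ _ ((1 + e^-1) * e ^+ 2)).
  by rewrite ler_wpM2l// addr_ge0// invr_ge0 ltW.
have -> : (1 + e^-1) * e ^+ 2 = e * (e + 1) by field; rewrite gt_eqF.
by apply: ler_wpM2l; [exact: ltW|move: e1; lra].
Qed.

Let bound_integrable :
  Rintegrable m (fun x => (1 + e^-1) * (f x - g x) ^+ 2 + e * f x ^+ 2).
Proof.
have [_ fg2] := square_integrableB sf sg; have [_ f2] := sf.
by apply: RintegrableD; exact: RintegrableZ.
Qed.

Lemma cos_exponent_dist :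
  `|cos_exponent f - cos_exponent g| <= e * (2 + \int[m]_x (f x ^+ 2)).
Proof.
apply: le_trans bound_int.
apply: RintegralB_norm_le => //; [exact: cos_integrable..|].
move=> x; have -> : cos (f x) - 1 - (cos (g x) - 1) = cos (f x) - cos (g x) by ring.
exact: le_trans (norm_cosB_le2 _ _) (amgm _ _ e0).
Qed.

Lemma sin_exponent_dist :
  `|sin_exponent f - sin_exponent g| <= e * (2 + \int[m]_x (f x ^+ 2)).
Proof.
apply: le_trans bound_int.
apply: RintegralB_norm_le => //; [exact: sin_integrable..|].
by move=> x; exact: le_trans (norm_sin_subB_le _ _) (amgm _ _ e0).
Qed.

End exponent_continuity.

End square_integrable.

Lemma cvg_of_bounds (R : realType) (u : nat -> R) (l K : R) (del : nat -> \bar R) :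
  0 <= K -> del n @[n --> \oo] --> 0%E ->
  (forall n e, 0 < e -> e <= 1 -> (del n <= (e ^+ 2)%:E)%E -> `|l - u n| <= e * K) ->
  u n @[n --> \oo] --> l.
Proof.
move=> K0 del0 H; apply/cvgrPdist_le => e e0.
(* The minimum with 1 meets the condition [e <= 1], and [K + 1] avoids a division by 0. *)
pose e' := Num.min 1 (e / (K + 1)).
have K1 : 0 < K + 1 by lra.
have e'0 : 0 < e' by rewrite lt_min ltr01 divr_gt0.
have e'1 : e' <= 1 by rewrite ge_min lexx.
have e'K : e' * K <= e.
  apply: (@le_trans _ _ (e / (K + 1) * K)).
    by rewrite ler_wpM2r// ge_min lexx orbT.
  by rewrite mulrAC ler_pdivrMr// ler_wpM2l//; lra.
have : \forall n \near \oo, (del n < (e' ^+ 2)%:E)%E.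
  have /del0 : nbhs (0%E : \bar R) [set y | (y < (e' ^+ 2)%:E)%E].
    by apply: open_ereal_lt'; rewrite lte_fin exprn_gt0.
  exact.
apply: filterS => n dn.
by apply: le_trans e'K; apply: H => //; exact: ltW.
Qed.

(** * Characteristic function of a compensated integral *)

Section compensated_integrals.
Context {R : realType} {d d' : measure_display}.
Context {Omega : measurableType d} {S : measurableType d'}.
Variables (P : probability Omega R) (nu : {measure set S -> \bar R}).
Variable (N : Omega -> {measure set S -> \bar R}).
Hypothesis HN : poisson_random_measure P nu N.

Let Rint_le (dd : measure_display) (U : measurableType dd)
    (m : {measure set U -> \bar R}) (f : U -> R) (e : R) :
  measurable_fun setT f -> (\int[m]_x (f x ^+ 2)%:E <= e%:E)%E ->
  Rintegrable m (fun x => f x ^+ 2) /\ \int[m]_x (f x ^+ 2) <= e.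
Proof.
move=> mf fe; have [_ f2] : square_integrable m f.
  by apply: square_integrableP => //; rewrite (le_lt_trans fe) ?ltry.
by split => //; rewrite -lee_fin EFin_Rintegral.
Qed.

Lemma compensated_integral_square_integrable f Y :
  is_compensated_integral P nu N f Y -> square_integrable nu f.
Proof. by case=> mf f2 _ _; exact: square_integrableP. Qed.

(** Both sides pass to the limit along the elementary approximations: the left one by L^2
    convergence under [P], the right one by L^2 continuity of the exponents. *)
Lemma compensated_integral_cos f Y r : is_compensated_integral P nu N f Y ->
  \int[P]_w cos (Y w + r) =
  expR (cos_exponent nu f) * cos (sin_exponent nu f + r).
Proof.
move=> HfY; have sf := compensated_integral_square_integrable HfY.
case: HfY => mf f2 mY [e [fe Ye]].
have me n : measurable_fun setT (elementary_fun (e n)) by exact: measurable_elementary_fun.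
have mI n : measurable_fun setT (elementary_integral N (e n)).
  exact: (measurable_elementary_integral HN).
have K0 : 0 <= 2 + \int[nu]_x (f x ^+ 2).
  by rewrite addr_ge0// Rintegral_ge0// => x _; exact: sqr_ge0.
have se n a : (\int[nu]_s ((f s - elementary_fun (e n) s) ^+ 2)%:E <= (a ^+ 2)%:E)%E ->
    square_integrable nu (elementary_fun (e n)) /\
    \int[nu]_s ((f s - elementary_fun (e n) s) ^+ 2) <= a ^+ 2.
  move=> h; have [i1 i2] := Rint_le (measurable_funB mf (me n)) h; split=> //.
  have : square_integrable nu (fun s => f s - elementary_fun (e n) s).
    by split => //; exact: measurable_funB.
  move=> /(square_integrableB sf).
  by under [X in square_integrable nu X]eq_fun do rewrite subKr.
have Ccvg : cos_exponent nu (elementary_fun (e n)) @[n --> \oo] --> cos_exponent nu f.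
  apply: (cvg_of_bounds K0 fe) => n a a0 a1 /se[s1 s2].
  exact: cos_exponent_dist.
have Scvg : sin_exponent nu (elementary_fun (e n)) @[n --> \oo] --> sin_exponent nu f.
  apply: (cvg_of_bounds K0 fe) => n a a0 a1 /se[s1 s2].
  exact: sin_exponent_dist.
apply: (@Rcvg_unique R (fun n => \int[P]_w cos (elementary_integral N (e n) w + r))).
  apply: (cvg_of_bounds (K := 2) _ Ye) => // n a a0 a1 h.
  have [i1 i2] := Rint_le (measurable_funB mY (mI n)) h.
  (* The inequality [|x| <= a + x^2 / a] turns closeness in L^2 into closeness of the expectations
     of the cosines. *)
  have ia : Rintegrable P (fun w => a + a^-1 * (Y w - elementary_integral N (e n) w) ^+ 2).
    apply: RintegrableD; last exact: RintegrableZ.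
    apply: bounded_measurable_integrable; split => //.
    by exists `|a|.
  apply: (@le_trans _ _ (\int[P]_w (a + a^-1 * (Y w - elementary_integral N (e n) w) ^+ 2))).
    apply: RintegralB_norm_le => //.
    + exact/bounded_measurable_integrable/bounded_measurable_cos.
    + exact/bounded_measurable_integrable/bounded_measurable_cos.
    move=> w; apply: le_trans (norm_cosB_le _ _) _.
    have -> : Y w + r - (elementary_integral N (e n) w + r) =
      Y w - elementary_integral N (e n) w by ring.
    set x := Y w - _; rewrite -(real_normK (num_real x)).
    have := normr_ge0 x; move: `|x| => y y0.
    have [ya|ya] := lerP y a.
      by rewrite -[leLHS]addr0 lerD// mulr_ge0 ?sqr_ge0// invr_ge0 ltW.
    have yy : y <= a^-1 * y ^+ 2.
      by rewrite mulrC ler_pdivlMr// expr2 ler_wpM2l// ltW.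
    by apply: le_trans yy _; rewrite lerDr ltW.
  rewrite RintegralD//; last first.
  - exact: RintegrableZ.
  - apply: bounded_measurable_integrable; split => //.
    by exists `|a|.
  rewrite expectation_cst RintegralZl// mulrC.
  have : a^-1 * \int[P]_x ((Y x - elementary_integral N (e n) x) ^+ 2) <= a.
    by rewrite mulrC ler_pdivrMr// -expr2.
  by lra.
under eq_fun do rewrite (elementary_integral_cos HN).
apply: cvgM.
  exact: (cvg_comp _ _ Ccvg (@continuous_expR R _)).
have Sr : sin_exponent nu (elementary_fun (e n)) + r @[n --> \oo] -->
    sin_exponent nu f + r by apply: cvgD => //; exact: cvg_cst.
exact: (cvg_comp _ _ Sr (@continuous_cos R _)).
Qed.

End compensated_integrals.

(** * Linearity of the compensated integral *)

Section linear_combinations.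
Context {R : realType} {d d' : measure_display}.
Context {Omega : measurableType d} {S : measurableType d'}.
Variables (P : probability Omega R) (nu : {measure set S -> \bar R}).
Variable (N : Omega -> {measure set S -> \bar R}).
Hypothesis HN : poisson_random_measure P nu N.

Let elementaryZ (a : R) (e : elementary nu) : elementary nu :=
  @Elementary R d' S nu (el_size e) (fun j => a * el_coef j) (fun j => el_set j)
    (@el_measurable _ _ _ _ e) (@el_finite _ _ _ _ e).

Let elementaryZ_fun a e s : elementary_fun (elementaryZ a e) s = a * elementary_fun e s.
Proof.
rewrite /elementary_fun mulr_sumr; apply: eq_bigr => j _.
by rewrite /= mulrA.
Qed.

Let elementaryZ_integral a e w :
  elementary_integral N (elementaryZ a e) w = a * elementary_integral N e w.
Proof.
rewrite /elementary_integral mulr_sumr; apply: eq_bigr => j _.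
by rewrite /= mulrA.
Qed.

Let add_set (e1 e2 : elementary nu) (j : 'I_(el_size e1 + el_size e2)) : set S :=
  match fintype.split j with inl i => el_set i | inr i => el_set i end.

Let add_measurable e1 e2 j : measurable (@add_set e1 e2 j).
Proof. by rewrite /add_set; case: fintype.split => i; exact: el_measurable. Qed.

Let add_finite e1 e2 j : (nu (@add_set e1 e2 j) < +oo)%E.
Proof. by rewrite /add_set; case: fintype.split => i; exact: el_finite. Qed.

Let elementaryD (e1 e2 : elementary nu) : elementary nu :=
  @Elementary R d' S nu (el_size e1 + el_size e2)
    (fun j => match fintype.split j with inl i => el_coef i | inr i => el_coef i end)
    (@add_set e1 e2) (@add_measurable e1 e2) (@add_finite e1 e2).

Let split_lshift m n (i : 'I_m) : fintype.split (lshift n i) = inl i.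
Proof. exact: (unsplitK (inl i)). Qed.

Let split_rshift m n (i : 'I_n) : fintype.split (rshift m i) = inr i.
Proof. exact: (unsplitK (inr i)). Qed.

Let elementaryD_fun e1 e2 s :
  elementary_fun (elementaryD e1 e2) s = elementary_fun e1 s + elementary_fun e2 s.
Proof.
rewrite /elementary_fun /= big_split_ord/=.
by congr (_ + _); apply: eq_bigr => j _; rewrite /add_set ?split_lshift ?split_rshift.
Qed.

Let elementaryD_integral e1 e2 w :
  elementary_integral N (elementaryD e1 e2) w =
  elementary_integral N e1 w + elementary_integral N e2 w.
Proof.
rewrite /elementary_integral /= big_split_ord/=.
by congr (_ + _); apply: eq_bigr => j _; rewrite /add_set ?split_lshift ?split_rshift.
Qed.

Let sqrZ_cvg0 (dd : measure_display) (U : measurableType dd)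
    (m : {measure set U -> \bar R}) (f : U -> R) (g : nat -> U -> R) a :
  measurable_fun setT f -> (forall n, measurable_fun setT (g n)) ->
  (\int[m]_x ((f x - g n x) ^+ 2)%:E)%E @[n --> \oo] --> 0%E ->
  (\int[m]_x ((a * f x - a * g n x) ^+ 2)%:E)%E @[n --> \oo] --> 0%E.
Proof.
move=> mf mg h.
have -> : (fun n => \int[m]_x ((a * f x - a * g n x) ^+ 2)%:E)%E =
    (fun n => (a ^+ 2)%:E * \int[m]_x ((f x - g n x) ^+ 2)%:E)%E.
  apply/funext => n; rewrite -ge0_integralZl_EFin ?sqr_ge0//.
  - by apply: eq_integral => x _; rewrite -EFinM -exprMn mulrBr.
  - by move=> x _; rewrite lee_fin sqr_ge0.
  - exact/measurable_EFinP/measurable_funX/measurable_funB.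
by rewrite -(mule0 (a ^+ 2)%:E); exact: cvgeZl.
Qed.

Let sqrD_cvg0 (dd : measure_display) (U : measurableType dd)
    (m : {measure set U -> \bar R}) (f f' : U -> R) (g g' : nat -> U -> R) :
  measurable_fun setT f -> (forall n, measurable_fun setT (g n)) ->
  measurable_fun setT f' -> (forall n, measurable_fun setT (g' n)) ->
  (\int[m]_x ((f x - g n x) ^+ 2)%:E)%E @[n --> \oo] --> 0%E ->
  (\int[m]_x ((f' x - g' n x) ^+ 2)%:E)%E @[n --> \oo] --> 0%E ->
  (\int[m]_x ((f x + f' x - (g n x + g' n x)) ^+ 2)%:E)%E @[n --> \oo] --> 0%E.
Proof.
move=> mf mg mf' mg' h h'.
apply: (@squeeze_cvge _ _ _ _ (cst 0%E) _ (fun n =>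
  2%:E * \int[m]_x ((f x - g n x) ^+ 2)%:E + 2%:E * \int[m]_x ((f' x - g' n x) ^+ 2)%:E)%E).
- apply: nearW => n; apply/andP; split.
    by apply: integral_ge0 => x _; rewrite lee_fin sqr_ge0.
  have m1 : measurable_fun setT (fun x => ((f x - g n x) ^+ 2)%:E).
    exact/measurable_EFinP/measurable_funX/measurable_funB.
  have m2 : measurable_fun setT (fun x => ((f' x - g' n x) ^+ 2)%:E).
    exact/measurable_EFinP/measurable_funX/measurable_funB.
  rewrite -!ge0_integralZl_EFin//; try by move=> x _; rewrite lee_fin sqr_ge0.
  rewrite -ge0_integralD//; try by move=> x _; rewrite mule_ge0// lee_fin sqr_ge0.
  + apply: ge0_le_integral => //.
    * by move=> x _; rewrite lee_fin sqr_ge0.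
    * apply/measurable_EFinP/measurable_funX/measurable_funB.
        exact: measurable_funD.
      exact: measurable_funD.
    * by apply: emeasurable_funD; exact: measurable_funeM.
    * move=> x _; rewrite -!EFinM -EFinD lee_fin.
      have := sqr_ge0 ((f x - g n x) - (f' x - g' n x)); nra.
  + exact: measurable_funeM.
  + exact: measurable_funeM.
- exact: cvg_cst.
- rewrite [X in _ --> X](_ : 0 = 2%:E * 0 + 2%:E * 0)%E; last by rewrite mule0 adde0.
  apply: cvgeD; first by rewrite mule0.
    exact: cvgeZl.
  exact: cvgeZl.
Qed.

Lemma compensated_integralZ a f Y : is_compensated_integral P nu N f Y ->
  is_compensated_integral P nu N (fun s => a * f s) (fun w => a * Y w).
Proof.
move=> HfY; have sf := compensated_integral_square_integrable HfY.
case: HfY => mf f2 mY [e [fe Ye]]; split.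
- exact: measurable_funM.
- by have [_ /integrable_lty] := square_integrableZ a sf; exact.
- exact: measurable_funM.
- exists (fun n => elementaryZ a (e n)); split.
    under eq_fun do under eq_integral do rewrite elementaryZ_fun.
    by apply: sqrZ_cvg0 => // n; exact: measurable_elementary_fun.
  under eq_fun do under eq_integral do rewrite elementaryZ_integral.
  by apply: sqrZ_cvg0 => // n; exact: (measurable_elementary_integral HN).
Qed.

Lemma compensated_integralD f g Y Z : is_compensated_integral P nu N f Y ->
  is_compensated_integral P nu N g Z ->
  is_compensated_integral P nu N (fun s => f s + g s) (fun w => Y w + Z w).
Proof.
move=> HfY HgZ.
have sf := compensated_integral_square_integrable HfY.
have sg := compensated_integral_square_integrable HgZ.
case: HfY => mf f2 mY [e [fe Ye]]; case: HgZ => mg g2 mZ [e' [ge Ze]]; split.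
- exact: measurable_funD.
- by have [_ /integrable_lty] := square_integrableD sf sg; exact.
- exact: measurable_funD.
- exists (fun n => elementaryD (e n) (e' n)); split.
    under eq_fun do under eq_integral do rewrite elementaryD_fun.
    by apply: sqrD_cvg0 => // n; exact: measurable_elementary_fun.
  under eq_fun do under eq_integral do rewrite elementaryD_integral.
  by apply: sqrD_cvg0 => // n; exact: (measurable_elementary_integral HN).
Qed.

Lemma compensated_integral0 : is_compensated_integral P nu N (cst 0) (cst 0).
Proof.
have e0 : elementary nu.
  by apply: (@Elementary R d' S nu 0 (fun=> 0) (fun=> set0)) => // j; rewrite measure0 ltry.
split=> //.
  by rewrite integral0_eq ?ltry// => x _; rewrite expr0n.
exists (fun=> elementaryZ 0 e0); split.
  under eq_fun do under eq_integral do rewrite elementaryZ_fun mul0r subrr expr0n.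
  by under eq_fun do rewrite integral0; exact: cvg_cst.
under eq_fun do under eq_integral do rewrite elementaryZ_integral mul0r subrr expr0n.
by under eq_fun do rewrite integral0; exact: cvg_cst.
Qed.

Lemma compensated_integral_sum (I : Type) (s : seq I) (u : I -> R) f Y :
  (forall i, is_compensated_integral P nu N (f i) (Y i)) ->
  is_compensated_integral P nu N
    (fun x => \sum_(i <- s) u i * f i x) (fun w => \sum_(i <- s) u i * Y i w).
Proof.
move=> H; elim: s => [|i s IH].
  under [X in is_compensated_integral _ _ _ X _]eq_fun do rewrite big_nil.
  under [X in is_compensated_integral _ _ _ _ X]eq_fun do rewrite big_nil.
  exact: compensated_integral0.
under [X in is_compensated_integral _ _ _ X _]eq_fun do rewrite big_cons.
under [X in is_compensated_integral _ _ _ _ X]eq_fun do rewrite big_cons.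
exact/compensated_integralD/IH/compensated_integralZ.
Qed.

End linear_combinations.

(** * Reading the exponents off the characteristic function *)

Section exponent_identification.
Context {R : realType}.

(** [cos x = 1] forces [sin x = 0], and then [|sin x - x| <= x^2] reads [|x| <= x^2], impossible for
    0 < |x| < 1. *)
Lemma cos_eq1_small (x : R) : `|x| < 1 -> cos x = 1 -> x = 0.
Proof.
move=> x1 cx; apply/eqP; rewrite -normr_eq0; apply/eqP.
have sx : sin x = 0.
  by apply/eqP; rewrite -sqrf_eq0 sin2cos2 cx expr1n subrr.
have := norm_sin_sub_le x; rewrite sx sub0r normrN -(real_normK (num_real x)).
move: (normr_ge0 x) x1; move: `|x| => y y0 y1.
rewrite expr2 => yy; apply/eqP; rewrite eq_le y0 andbT.
rewrite leNgt; apply/negP => yp.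
have : y * y < y * 1 by rewrite ltr_pM2l.
by rewrite mulr1 => /(le_lt_trans yy); rewrite ltxx.
Qed.

(** The phases [- S1] and [- S2] each make one of the cosines equal to 1, which gives the two
    inequalities between the moduli. *)
Lemma polar_eq (C1 C2 S1 S2 : R) :
  (forall r, expR C1 * cos (S1 + r) = expR C2 * cos (S2 + r)) ->
  C1 = C2 /\ cos (S1 - S2) = 1.
Proof.
move=> H; have := H (- S1); have := H (- S2).
rewrite !subrr cos0 !mulr1 -(cosN (S2 - S1)) opprB => e2 e1.
have c1 := cos_le1 (S1 - S2).
have le12 : expR C1 <= expR C2 by rewrite e1 ler_piMr// expR_ge0.
have le21 : expR C2 <= expR C1 by rewrite -e2 ler_piMr// expR_ge0.
have E : C1 = C2 by apply/expR_inj/eqP; rewrite eq_le le12 le21.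
split => //; move: e2; rewrite E => e2.
by apply: (mulfI (lt0r_neq0 (expR_gt0 C2))); rewrite e2 mulr1.
Qed.

Context {d d' : measure_display} {T : measurableType d} {T' : measurableType d'}.

Let sin_exponent_lipschitz (dd : measure_display) (U : measurableType dd)
    (m : {measure set U -> \bar R}) (f : U -> R) (a b : R) : square_integrable m f ->
  0 <= a <= 1 -> 0 <= b <= 1 ->
  `|sin_exponent m (fun x => a * f x) - sin_exponent m (fun x => b * f x)| <=
  `|a - b| * (2 * \int[m]_x (f x ^+ 2)).
Proof.
move=> sf a01 b01; have [_ f2] := sf.
rewrite mulrA -RintegralZl//.
apply: RintegralB_norm_le; [exact/sin_integrable/square_integrableZ..| |].
  exact: RintegrableZ.
move=> x; apply: le_trans (norm_sin_subB_le _ _) _.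
rewrite -mulrBl !normrM -(real_normK (num_real (f x))).
rewrite [`|a|]ger0_norm; last by case/andP: a01.
rewrite [`|b|]ger0_norm; last by case/andP: b01.
have ab0 := normr_ge0 (a - b); have f0 := normr_ge0 (f x).
rewrite [leLHS](_ : _ = `|a - b| * ((a + b) * `|f x| ^+ 2)); last by ring.
by rewrite -mulrA ler_wpM2l// ler_wpM2r ?sqr_ge0//; lra.
Qed.

(* The characteristic function determines the imaginary exponent only modulo 2 pi; following it
   along the segment [a f], 0 <= a <= 1, by steps of length less than 1 removes the ambiguity. *)
Lemma exponent_eq (m : {measure set T -> \bar R}) (m' : {measure set T' -> \bar R}) f g :
  square_integrable m f -> square_integrable m' g ->
  (forall a r, expR (cos_exponent m (fun x => a * f x)) *
                 cos (sin_exponent m (fun x => a * f x) + r) =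
               expR (cos_exponent m' (fun x => a * g x)) *
                 cos (sin_exponent m' (fun x => a * g x) + r)) ->
  cos_exponent m f = cos_exponent m' g /\ sin_exponent m f = sin_exponent m' g.
Proof.
move=> sf sg H.
have f1 : f = fun x => 1 * f x by apply/funext => x; rewrite mul1r.
have g1 : g = fun x => 1 * g x by apply/funext => x; rewrite mul1r.
split; first by have [] := polar_eq (H 1); rewrite -f1 -g1.
pose D a := sin_exponent m (fun x => a * f x) - sin_exponent m' (fun x => a * g x).
have D1 a : cos (D a) = 1 by have [] := polar_eq (H a).
pose L := 2 * \int[m]_x (f x ^+ 2) + 2 * \int[m']_x (g x ^+ 2).
have L0 : 0 <= L.
  by rewrite addr_ge0// mulr_ge0// Rintegral_ge0// => x _; exact: sqr_ge0.
have DL a b : 0 <= a <= 1 -> 0 <= b <= 1 -> `|D a - D b| <= `|a - b| * L.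
  move=> a01 b01; rewrite /D /L mulrDr.
  have h1 := sin_exponent_lipschitz sf a01 b01.
  have h2 := sin_exponent_lipschitz sg a01 b01.
  move: h1 h2.
  set u := sin_exponent _ _; set v := sin_exponent _ _.
  set u' := sin_exponent _ _; set v' := sin_exponent _ _ => h1 h2.
  have -> : u - u' - (v - v') = (u - v) - (u' - v') by ring.
  by apply: le_trans (ler_normB _ _) _; exact: lerD.
(* With [n] steps [D] moves by at most [L / n < 1] at a time, within the reach of
   [cos_eq1_small]. *)
pose n := (Num.truncn L).+1.
have Ln : L < n%:R by exact: truncnS_gt.
have n0 : 0 < n%:R :> R by rewrite ltr0n.
have step k : (k <= n)%N -> D (k%:R / n%:R) = 0.
  elim: k => [_|k IH kn].
    rewrite mul0r /D.
    have -> : (fun x => 0 * f x) = cst 0 by apply/funext => x; rewrite mul0r.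
    have -> : (fun x => 0 * g x) = cst 0 by apply/funext => x; rewrite mul0r.
    have E0 (dd : measure_display) (U : measurableType dd) (mm : {measure set U -> \bar R}) :
        sin_exponent mm (cst (0 : R)) = 0.
      rewrite /sin_exponent; under eq_Rintegral do rewrite /= sin0 subrr.
      by rewrite Rintegral_cst// mul0r.
    by rewrite !E0 subrr.
  apply: cos_eq1_small => //.
  have := DL (k.+1%:R / n%:R) (k%:R / n%:R).
  rewrite (IH (ltnW kn)) subr0.
  have i01 j : (j <= n)%N -> 0 <= (j%:R / n%:R : R) <= 1.
    by move=> jn; rewrite divr_ge0//= ler_pdivrMr// mul1r ler_nat.
  move=> /(_ (i01 _ kn) (i01 _ (ltnW kn))) /le_lt_trans; apply.
  rewrite -mulrBl -natr1 addrAC subrr add0r mul1r ger0_norm ?invr_ge0 ?ltW//.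
  by rewrite mulrC ltr_pdivrMr// mul1r.
have := step n (leqnn n); rewrite divff ?gt_eqF// /D -f1 -g1.
by move/eqP; rewrite subr_eq0 => /eqP.
Qed.

End exponent_identification.

(** * Borel sets of matrices *)

Section borel_matrices.
Variables (T : ptopologicalType) (m n : nat).
Variable V : nat -> set T.
Hypothesis V_basis : forall x (U : set T), nbhs x U -> exists k, V k x /\ V k `<=` U.

(** The boxes are indexed by matrices of natural numbers, a countable type, so the union is
    countable and measurability can be tested entry by entry. *)
Lemma open_mx_bigcup_box (O : set 'M[T]_(m, n)) : open O ->
  exists D : set 'M[nat]_(m, n), O = \bigcup_(k in D) [set M | forall i j, V (k i j) (M i j)].
Proof.
move=> oO.
exists [set k | [set M : 'M[T]_(m, n) | forall i j, V (k i j) (M i j)] `<=` O].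
apply/seteqP; split => M; last by move=> [k kO] /kO.
move=> OM; have [Q MQ QO] : nbhs M O by exact: open_nbhs_nbhs.
have /choice[k kP] : forall ij : 'I_m * 'I_n, exists k,
    V k (M ij.1 ij.2) /\ V k `<=` Q ij.1 ij.2.
  by move=> [i j]; exact/V_basis/MQ.
exists (\matrix_(i, j) k (i, j)) => /=.
  by move=> M' M'k; apply: QO => i j; apply: (kP (i, j)).2; have := M'k i j; rewrite mxE.
by move=> i j; rewrite mxE; exact: (kP (i, j)).1.
Qed.

Lemma measurable_borelMx (d : measure_display) (S : measurableType d)
    (f : S -> borelMx T m n) :
  (forall i j k, measurable [set s | V k ((f s : 'M[T]_(m, n)) i j)]) ->
  measurable_fun setT f.
Proof.
move=> mf.
apply: (@measurability _ _ S (borelMx T m n) setT f (@open 'M[T]_(m, n))) => // _ [W oW <-].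
rewrite setTI; have [D ->] := open_mx_bigcup_box oW.
rewrite preimage_bigcup -[D]setIid.
have -> : \bigcup_(k in D `&` D) f @^-1` [set M | forall i j, V (k i j) (M i j)] =
    \bigcup_q (if unpickle q is Some k then
      if `[< D k >] then f @^-1` [set M | forall i j, V (k i j) (M i j)] else set0
      else set0).
  apply/seteqP; split => s.
    move=> [k [Dk _] fk]; exists (pickle k) => //.
    by rewrite pickleK asboolT.
  move=> [q _]; case: (unpickle q) => // k; case: asboolP => // Dk fk.
  by exists k.
apply: bigcup_measurable => q _; case: (unpickle q) => [k|]; last exact: measurable0.
case: asboolP => _; last exact: measurable0.
rewrite (_ : _ @^-1` _ = \bigcap_(ij in [set: 'I_m * 'I_n])
    [set s | V (k ij.1 ij.2) ((f s : 'M[T]_(m, n)) ij.1 ij.2)]).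
  by apply: fin_bigcap_measurable => // ij _; exact: mf.
apply/seteqP; split => s; first by move=> h ij _; exact: h.
by move=> h i j; exact: (h (i, j)).
Qed.

End borel_matrices.

Lemma continuous_borelMx_measurable (R : realType) (T : ptopologicalType) m n
    (f : 'M[T]_(m, n) -> R) : continuous f ->
  measurable_fun setT (f : borelMx T m n -> R).
Proof.
move=> cf mT; apply: (measurability _ (RGenOpens.measurableE R)) => // _ [_ [a [b ->]] <-].
rewrite setTI; apply: sub_sigma_algebra.
apply: open_comp => // ? _; exact: cf.
Qed.

Lemma continuous_mx_coef (T : topologicalType) m n i j :
  continuous (fun M : 'M[T]_(m, n) => M i j).
Proof.
move=> M A MA.
exists (fun i' j' => if (i' == i) && (j' == j) then A else setT).
  by move=> i' j'; case: ifP => [/andP[/eqP-> /eqP->]//|_]; exact: filterT.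
by move=> N /(_ i j); rewrite !eqxx.
Qed.

Section real_and_complex_matrices.
Variable R : realType.

(** Intervals with rational endpoints, coded by a single natural number; a number that codes no pair
    gives the empty set. *)
Let rat_box (k : nat) : set R :=
  if unpickle k is Some (a, b) then [set x | ratr a < x < ratr b] else set0.

Let rat_box_basis (x : R) (U : set R) : nbhs x U ->
  exists k, rat_box k x /\ rat_box k `<=` U.
Proof.
move=> /nbhs_ballP[e /= e0 xU].
have xe : x - e < x by rewrite gtrBl.
have [a] := rat_in_itvoo xe.
rewrite in_itv/= => /andP[a1 a2].
have ex : x < x + e by rewrite ltrDl.
have [b] := rat_in_itvoo ex.
rewrite in_itv/= => /andP[b1 b2].
exists (pickle (a, b)); rewrite /rat_box pickleK; split => /=; first by rewrite a2.
move=> y /= /andP[ay yb]; apply: xU; rewrite /ball/= ltr_distlC.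
by rewrite (lt_trans a1)//= (lt_trans yb).
Qed.

Lemma measurable_real_mx (d : measure_display) (S : measurableType d) m n
    (f : S -> borelMx R m n) :
  (forall i j, measurable_fun setT (fun s => (f s : 'M[R]_(m, n)) i j)) ->
  measurable_fun setT f.
Proof.
move=> mf; apply: (measurable_borelMx (V := rat_box)); first exact: rat_box_basis.
move=> i j k; rewrite /rat_box; case: (unpickle k) => [[a b]|]; last exact: measurable0.
have := mf i j measurableT _ (measurable_itv `](ratr a : R), ratr b[).
by congr measurable; rewrite setTI; apply/seteqP; split => s /=; rewrite in_itv.
Qed.

Lemma measurable_real_mx_coef m n i j :
  measurable_fun setT (fun M : borelMx R m n => (M : 'M[R]_(m, n)) i j).
Proof.
apply: (@continuous_borelMx_measurable R R m n); exact: continuous_mx_coef.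
Qed.

Let rat_cbox (k : nat) : set R[i]^o :=
  if unpickle k is Some (a, b) then
    [set z | rat_box a (complex.Re z) /\ rat_box b (complex.Im z)] else set0.

Lemma normc_ge_Im (z : R[i]) : (`|complex.Im z|)%:C%C <= `|z|.
Proof.
rewrite normc_def lecR -sqrtr_sqr ler_wsqrtr// lerDr sqr_ge0//.
Qed.

Lemma normc_le_ReIm (z : R[i]) : `|z| <= (`|complex.Re z| + `|complex.Im z|)%:C%C.
Proof.
rewrite normc_def lecR.
have h : 0 <= `|complex.Re z| + `|complex.Im z| by rewrite addr_ge0.
rewrite -[leRHS](ger0_norm h) -sqrtr_sqr ler_wsqrtr// sqrrD !real_normK ?num_real//.
by rewrite addrAC lerDl mulrn_wge0// mulr_ge0.
Qed.

Let rat_cbox_basis (z : R[i]^o) (U : set R[i]^o) : nbhs z U ->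
  exists k, rat_cbox k z /\ rat_cbox k `<=` U.
Proof.
move=> /nbhs_ballP[e /= e0 zU].
pose r := complex.Re e.
have er : e = r%:C%C.
  by apply/eqP; rewrite eq_complex /=; move: e0; rewrite ltcE/= => /andP[/eqP-> _]; rewrite !eqxx.
have r0 : 0 < r by move: e0; rewrite er ltcR.
have nb (x : R) : nbhs x (ball x (r / 2)) by apply: nbhsx_ballx; rewrite divr_gt0.
have [a [a1 a2]] := rat_box_basis (nb (complex.Re z)).
have [b [b1 b2]] := rat_box_basis (nb (complex.Im z)).
exists (pickle (a, b)); rewrite /rat_cbox pickleK; split => //= w /= [wa wb].
apply: zU; rewrite -ball_normE /=.
apply: le_lt_trans (normc_le_ReIm _) _; rewrite er ltcR.
have := a2 _ wa; have := b2 _ wb; rewrite /ball/=.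
by rewrite !raddfB/=; lra.
Qed.

Lemma measurable_Cvec (d : measure_display) (S : measurableType d) p
    (f : S -> Cvec R p) :
  (forall i, measurable_fun setT (fun s => complex.Re ((f s : 'cV[R[i]]_p) i 0))) ->
  (forall i, measurable_fun setT (fun s => complex.Im ((f s : 'cV[R[i]]_p) i 0))) ->
  measurable_fun setT f.
Proof.
move=> mRe mIm; apply: (measurable_borelMx (V := rat_cbox)); first exact: rat_cbox_basis.
move=> i j k; rewrite ord1 /rat_cbox.
case: (unpickle k) => [[a b]|]; last exact: measurable0.
have mbox (g : S -> R) c : measurable_fun setT g -> measurable [set s | rat_box c (g s)].
  move=> mg; rewrite /rat_box; case: (unpickle c) => [[u v]|]; last exact: measurable0.
  have := mg measurableT _ (measurable_itv `](ratr u : R), ratr v[).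
  by congr measurable; rewrite setTI; apply/seteqP; split => s /=; rewrite in_itv.
exact: measurableI (mbox _ _ (mRe i)) (mbox _ _ (mIm i)).
Qed.

Lemma continuous_Re : continuous (@complex.Re R : R[i]^o -> R).
Proof.
move=> z A /nbhs_ballP[e /= e0 zA]; apply/nbhs_ballP.
exists (e%:C%C : R[i]) => /=; first by rewrite ltcR.
move=> w; rewrite -ball_normE /= => zw; apply: zA.
by rewrite /ball/= -raddfB -ltcR; exact: le_lt_trans (normc_ge_Re _) zw.
Qed.

Lemma continuous_Im : continuous (@complex.Im R : R[i]^o -> R).
Proof.
move=> z A /nbhs_ballP[e /= e0 zA]; apply/nbhs_ballP.
exists (e%:C%C : R[i]) => /=; first by rewrite ltcR.
move=> w; rewrite -ball_normE /= => zw; apply: zA.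
by rewrite /ball/= -raddfB -ltcR; exact: le_lt_trans (normc_ge_Im _) zw.
Qed.

Lemma measurable_Cvec_Re p i :
  measurable_fun setT (fun z : Cvec R p => complex.Re ((z : 'cV[R[i]]_p) i 0)).
Proof.
apply: (@continuous_borelMx_measurable R R[i]^o p 1) => z.
exact: (@continuous_comp _ _ _ (fun M : 'M[R[i]^o]_(p, 1) => M i 0) (@complex.Re R) z
  (@continuous_mx_coef _ _ _ _ _ z) (@continuous_Re _)).
Qed.

Lemma measurable_Cvec_Im p i :
  measurable_fun setT (fun z : Cvec R p => complex.Im ((z : 'cV[R[i]]_p) i 0)).
Proof.
apply: (@continuous_borelMx_measurable R R[i]^o p 1) => z.
exact: (@continuous_comp _ _ _ (fun M : 'M[R[i]^o]_(p, 1) => M i 0) (@complex.Im R) z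
  (@continuous_mx_coef _ _ _ _ _ z) (@continuous_Im _)).
Qed.

End real_and_complex_matrices.

(** * The matrix exponential *)

Lemma Rcvg_sum (R : realType) (I : Type) (s : seq I) (u : I -> nat -> R) (l : I -> R) :
  (forall i, u i n @[n --> \oo] --> l i) ->
  \sum_(i <- s) u i n @[n --> \oo] --> \sum_(i <- s) l i.
Proof.
move=> ul; elim: s => [|i s IH].
  by rewrite big_nil; under eq_fun do rewrite big_nil; exact: cvg_cst.
by rewrite big_cons; under eq_fun do rewrite big_cons; exact: cvgD.
Qed.

Section matrix_exponential.
Variables (R : realType) (p : nat).
Implicit Types M Y : 'M[R]_p.

Definition exp_sum M (n : nat) : 'M[R]_p := \sum_(k < n) (k`!%:R^-1 : R) *: M ^+ k.

Definition entry_sum M : R := \sum_i \sum_j `|M i j|.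

Lemma entry_sumN M : entry_sum (- M) = entry_sum M.
Proof. by apply: eq_bigr => i _; apply: eq_bigr => j _; rewrite mxE normrN. Qed.

Lemma entry_sum_ge0 M : 0 <= entry_sum M.
Proof. by rewrite sumr_ge0// => i _; rewrite sumr_ge0. Qed.

Lemma norm_mulX_le M Y (y : R) k i j : (forall i j, `|Y i j| <= y) ->
  `|(M ^+ k * Y) i j| <= entry_sum M ^+ k * y.
Proof.
move=> Yy; elim: k i j => [|k IH] i j; first by rewrite !expr0 !mul1r.
rewrite !exprS -!mulrA -[_ * _ in leLHS]/(M *m (M ^+ k * Y)) mxE.
apply: le_trans (ler_norm_sum _ _ _) _.
apply: (@le_trans _ _ (\sum_l `|M i l| * (entry_sum M ^+ k * y))).
  by apply: ler_sum => l _; rewrite normrM ler_wpM2l.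
rewrite -mulr_suml ler_wpM2r//.
  by apply: le_trans (IH i j).
rewrite /entry_sum [leRHS](bigD1 i)//= lerDl sumr_ge0// => k' _.
by rewrite sumr_ge0.
Qed.

Lemma norm_expmx_le M k i j : `|(M ^+ k) i j| <= entry_sum M ^+ k.
Proof.
rewrite -[M ^+ k]mulr1 -[leRHS]mulr1; apply: norm_mulX_le => {i j} i j.
by rewrite -[1 in leLHS]/(1%:M) mxE; case: eqP; rewrite ?normr1// normr0.
Qed.

Lemma exp_sumE M n i j :
  exp_sum M n i j = \sum_(k < n) (M ^+ k) i j / k`!%:R.
Proof. by rewrite summxE; apply: eq_bigr => k _; rewrite mxE mulrC. Qed.

Lemma is_cvg_exp_sum M i j : cvgn (fun n => exp_sum M n i j).
Proof.
have -> : (fun n => exp_sum M n i j) = series (fun k => (M ^+ k) i j / k`!%:R).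
  by apply/funext => n; rewrite exp_sumE /series/= big_mkord.
apply: normed_cvg.
apply: (series_le_cvg _ _ _ (is_cvg_series_exp_coeff (entry_sum M))).
- by move=> k; exact: normr_ge0.
- by move=> k; rewrite divr_ge0// exprn_ge0// entry_sum_ge0.
- move=> k; rewrite /= normrM [X in _ * X]ger0_norm ?invr_ge0//.
  by rewrite /exp_coeff/= ler_wpM2r// ?invr_ge0// norm_expmx_le.
Qed.

Lemma cvg_mx_coef (u : nat -> 'M[R]_p) (L : 'M[R]_p) :
  (forall i j, (fun n => u n i j) @ \oo --> L i j) -> u @ \oo --> L.
Proof.
move=> h A [Q LQ QA].
have : \forall n \near \oo, forall i j, Q i j (u n i j).
  by apply: filter_forall => i; apply: filter_forall => j; apply: h; exact: LQ.
by apply: filterS => n Qn; apply: QA.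
Qed.

(** [expmx] is a limit of matrices and would be an arbitrary value without convergence; the entries
    converge absolutely, so the limit exists and may be read entrywise. *)
Lemma cvg_expmx M i j : exp_sum M n i j @[n --> \oo] --> expmx M i j.
Proof.
pose L : 'M[R]_p := \matrix_(i, j) limn (fun n => exp_sum M n i j).
have uL : exp_sum M @ \oo --> L.
  by apply: cvg_mx_coef => i' j'; rewrite mxE; exact: is_cvg_exp_sum.
have ue : exp_sum M @ \oo --> expmx M by apply: (cvgP L).
exact: (cvg_comp _ _ ue (@continuous_mx_coef R p p i j (expmx M))).
Qed.

(** A Cauchy product, split into the triangle [j + k < n] and a remainder. It serves both for the
    matrix series and for its scalar majorant. *)
Lemma triangle_sum (V : zmodType) (F : nat -> nat -> V) n :
  \sum_(k < n) \sum_(j < n) F j k =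
  \sum_(m < n) \sum_(k < m.+1) F (m - k)%N k +
  \sum_(k < n) \sum_(j < n | (n - k <= j)%N) F j k.
Proof.
have -> : \sum_(m < n) \sum_(k < m.+1) F (m - k)%N k =
    \sum_(k < n) \sum_(j < n - k) F j k.
  elim: n => [|n IH]; first by rewrite !big_ord0.
  rewrite big_ord_recr/= IH.
  transitivity (\sum_(k < n.+1) (\sum_(j < n - k) F j k + F (n - k)%N k)).
    by rewrite big_split/=; congr (_ + _); rewrite big_ord_recr/= subnn big_ord0 addr0.
  apply: eq_bigr => k _; rewrite subSn; last by rewrite -ltnS.
  by rewrite big_ord_recr.
rewrite -big_split/=; apply: eq_bigr => k _.
rewrite (bigID (fun j : 'I_n => (j < n - k)%N))/=; congr (_ + _).
  rewrite (big_ord_widen n (fun j => F j k)) ?leq_subr//.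
by apply: eq_bigl => j; rewrite -leqNgt.
Qed.

Lemma fact_binomial (m k : nat) : (k <= m)%N ->
  ((m - k)`!%:R^-1 * k`!%:R^-1 : R) = m`!%:R^-1 * 'C(m, k)%:R.
Proof.
move=> km; have := bin_fact km => /(congr1 (fun x : nat => x%:R : R)).
rewrite !natrM => <-.
have [a0 b0 c0] : [/\ (k`!%:R : R) != 0, ((m - k)`!%:R : R) != 0 & ('C(m, k)%:R : R) != 0].
  by rewrite !pnatr_eq0 -!lt0n !fact_gt0 bin_gt0.
by field; rewrite a0 b0 c0.
Qed.

(** By the binomial formula the triangle sums powers of [M - M], hence is 1. The remainder is
    dominated termwise by that of the scalar series with [entry_sum M], where the triangle sums
    powers of twice this number. *)
Lemma exp_sum_opp M n i l : (0 < n)%N ->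
  `|(exp_sum M n * exp_sum (- M) n - 1) i l| <=
  (\sum_(k < n) entry_sum M ^+ k / k`!%:R) ^+ 2 -
  \sum_(m < n) (2 * entry_sum M) ^+ m / m`!%:R.
Proof.
move=> n0; set b := entry_sum M.
pose F j k : 'M[R]_p := (j`!%:R^-1 * k`!%:R^-1) *: (M ^+ j * (- M) ^+ k).
pose G j k : R := (j`!%:R^-1 * k`!%:R^-1) * (b ^+ j * b ^+ k).
have EF : exp_sum M n * exp_sum (- M) n = \sum_(k < n) \sum_(j < n) F j k.
  rewrite /exp_sum mulr_sumr; apply: eq_bigr => k _.
  rewrite mulr_suml; apply: eq_bigr => j _.
  by rewrite /F -!mulmxE -scalemxAl -scalemxAr scalerA.
have EG : (\sum_(k < n) b ^+ k / k`!%:R) ^+ 2 = \sum_(k < n) \sum_(j < n) G j k.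
  rewrite expr2 mulr_sumr; apply: eq_bigr => k _.
  rewrite mulr_suml; apply: eq_bigr => j _.
  by rewrite /G; ring.
have TF : \sum_(m < n) \sum_(k < m.+1) F (m - k)%N k = 1.
  transitivity (\sum_(m < n) (m`!%:R^-1 : R) *: (M + - M) ^+ m).
    apply: eq_bigr => m _.
    have cM : GRing.comm M (- M) by apply/commrN.
    rewrite (exprDn_comm _ cM) scaler_sumr; apply: eq_bigr => k _.
    have km : (k <= m)%N by rewrite -ltnS.
    rewrite /F (fact_binomial km) -scalerA; congr (_ *: _).
    by rewrite scaler_nat.
  case: n n0 {EF EG} => // n _.
  rewrite big_ord_recl/= fact0 invr1 scale1r expr0 big1 ?addr0// => m _.
  by rewrite subrr expr0n/= scaler0.
have TG : \sum_(m < n) \sum_(k < m.+1) G (m - k)%N k = \sum_(m < n) (2 * b) ^+ m / m`!%:R.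
  apply: eq_bigr => m _.
  rewrite (_ : 2 * b = b + b); last by ring.
  rewrite exprDn mulr_suml; apply: eq_bigr => k _.
  have km : (k <= m)%N by rewrite -ltnS.
  by rewrite /G (fact_binomial km) -mulr_natr; ring.
rewrite EF EG !triangle_sum TF TG addrAC subrr add0r [leRHS]addrAC subrr add0r.
rewrite summxE; apply: le_trans (ler_norm_sum _ _ _) _; apply: ler_sum => k _.
rewrite summxE; apply: le_trans (ler_norm_sum _ _ _) _; apply: ler_sum => j _.
have c0 : 0 <= j`!%:R^-1 * k`!%:R^-1 :> R by rewrite mulr_ge0// invr_ge0.
rewrite /F /G mxE normrM ger0_norm// ler_wpM2l//.
by apply: norm_mulX_le => i' l'; rewrite /b -entry_sumN norm_expmx_le.
Qed.

(** With [b = entry_sum M] the error bound tends to [e^b e^b - e^(2 b) = 0]. This makes the factor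
    x^(-D) of the kernel invertible, which is needed to recover z. *)
Lemma expmx_opp M : expmx M *m expmx (- M) = 1%:M.
Proof.
apply/matrixP => i l.
have c1 : (exp_sum M n * exp_sum (- M) n) i l @[n --> \oo] --> (expmx M *m expmx (- M)) i l.
  rewrite mxE.
  have -> : (fun n => (exp_sum M n * exp_sum (- M) n) i l) =
     (fun n => \sum_j exp_sum M n i j * exp_sum (- M) n j l).
    by apply/funext => n; rewrite -mulmxE mxE.
  by apply: Rcvg_sum => j; apply: cvgM; exact: cvg_expmx.
apply: (Rcvg_unique c1).
set b := entry_sum M.
pose e n : R := (\sum_(k < n) b ^+ k / k`!%:R) ^+ 2 - \sum_(m < n) (2 * b) ^+ m / m`!%:R.
have e0 : e n @[n --> \oo] --> (0 : R).
  have cexp (x : R) : \sum_(k < n) x ^+ k / k`!%:R @[n --> \oo] --> expR x.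
    have -> : (fun n : nat => \sum_(k < n) x ^+ k / k`!%:R) = series (exp_coeff x).
      by apply/funext => n; rewrite /series/= big_mkord.
    exact: is_cvg_series_exp_coeff.
  rewrite (_ : 0 = expR b * expR b - expR (2 * b)).
    by apply: cvgB => //; apply: cvgM.
  by rewrite -expRD (_ : b + b = 2 * b) ?subrr//; ring.
set t := (1%:M : 'M[R]_p) i l.
apply: (@squeeze_cvgr _ _ _ _ (fun n => t - e n) (fun n => t + e n)).
- exists 1%N => // n /= n1; rewrite -ler_distl.
  have := exp_sum_opp M i l n1; rewrite -/b -/(e n).
  by rewrite [X in `|X|]mxE [X in _ + X]mxE.
- by rewrite -[X in _ --> X]subr0; apply: cvgB => //; exact: cvg_cst.
- by rewrite -[X in _ --> X]addr0; apply: cvgD => //; exact: cvg_cst.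
Qed.

Lemma measurable_powmx M i j : measurable_fun setT (fun x : R => powmx x M i j).
Proof.
apply: (measurable_fun_cvg (h := fun n x => exp_sum (ln x *: M) n i j)); last first.
  by move=> x _; exact: cvg_expmx.
move=> n.
have -> : (fun x => exp_sum (ln x *: M) n i j) =
    (fun x => \sum_(k < n) ln x ^+ k * (M ^+ k) i j / k`!%:R).
  apply/funext => x; rewrite exp_sumE; apply: eq_bigr => k _; congr (_ / _).
  have -> : (ln x *: M) ^+ k = ln x ^+ k *: M ^+ k.
    elim: (k : nat) => [|k' IH]; first by rewrite !expr0 scale1r.
    by rewrite !exprS IH -!mulmxE -scalemxAl -scalemxAr scalerA.
  by rewrite mxE.
apply: measurable_sum => k; apply: measurable_funM => //; apply: measurable_funM => //.
apply: measurable_funX; exact: measurable_ln.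
Qed.

Lemma powmx_opp (x : R) M : powmx x M *m powmx x (- M) = 1%:M.
Proof. by rewrite /powmx scalerN expmx_opp. Qed.

End matrix_exponential.

(** * Symmetries of the kernel *)

Section kernel_symmetries.
Context {R : realType} {p : nat}.
Variables (H : 'M[R]_p) (A : 'M[R[i]]_p).

Let D : 'M[R]_p := H - (2^-1)%:M.

Lemma conjMM (m n q : nat) (M : 'M[R[i]]_(m, n)) (M' : 'M[R[i]]_(n, q)) :
  conjM (M *m M') = conjM M *m conjM M'.
Proof. exact: map_mxM. Qed.

Lemma toC_mulmx (m n q : nat) (M : 'M[R]_(m, n)) (M' : 'M[R]_(n, q)) :
  toC (M *m M') = toC M *m toC M'.
Proof. exact: map_mxM. Qed.

Lemma conjMK (m n : nat) : involutive (@conjM R m n).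
Proof. by move=> M; apply/matrixP => i j; rewrite !mxE conjcK. Qed.

Lemma conjM_toC (m n : nat) (M : 'M[R]_(m, n)) : conjM (toC M) = toC M.
Proof. by apply/matrixP => i j; rewrite !mxE conjc_real. Qed.

Lemma Re_conjM (m n : nat) (M : 'M[R[i]]_(m, n)) i j :
  complex.Re (conjM M i j) = complex.Re (M i j).
Proof. by rewrite mxE; case: (M i j). Qed.

Definition harmonic_factor (t x : R) : R[i] :=
  (((cos (t * x) +i* sin (t * x)) - 1) / (0 +i* x))%C.

Lemma harmonic_factorE t x : x != 0 ->
  harmonic_factor t x = ((sin (t * x) / x) +i* ((1 - cos (t * x)) / x))%C.
Proof.
move=> x0; rewrite /harmonic_factor.
have ix0 : (0 +i* x)%C != 0 :> R[i] by rewrite eq_complex /= (negbTE x0) andbF.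
apply: (mulIf ix0); rewrite divfK//.
apply/eqP; rewrite eq_complex /=; apply/andP; split; apply/eqP.
  by field.
by field.
Qed.

Lemma harmonic_factorN t x : x != 0 ->
  harmonic_factor t (- x) = (harmonic_factor t x)^*%C.
Proof.
move=> x0; rewrite !harmonic_factorE ?oppr_eq0//.
apply/eqP; rewrite eq_complex /= mulrN sinN cosN; apply/andP; split; apply/eqP.
  by field.
by field.
Qed.

Lemma harmonic_factor_opp t x : x != 0 ->
  harmonic_factor (- t) x = - (harmonic_factor t x)^*%C.
Proof.
move=> x0; rewrite !harmonic_factorE//.
apply/eqP; rewrite eq_complex /= mulNr sinN cosN; apply/andP; split; apply/eqP.
  by field.
by field.
Qed.

Lemma gtilde_pos t x : 0 < x ->
  gtilde H A t x = harmonic_factor t x *: (toC (powmx x (- D)) *m A).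
Proof.
move=> x0; rewrite /gtilde /xplus /xminus x0 ltNge (ltW x0)/=.
by rewrite [toC 0](_ : _ = 0) ?mul0mx ?addr0// /toC map_mx0.
Qed.

Lemma gtilde0 t : gtilde H A t 0 = 0.
Proof.
rewrite /gtilde /xplus /xminus ltxx [toC 0](_ : _ = 0); last by rewrite /toC map_mx0.
by rewrite !mul0mx addr0 scaler0.
Qed.

Lemma gtildeN t x : gtilde H A t (- x) = conjM (gtilde H A t x).
Proof.
have [->|x0] := eqVneq x 0.
  by rewrite oppr0 gtilde0 /conjM map_mx0.
rewrite /gtilde -/(harmonic_factor t x) -/(harmonic_factor t (- x)).
rewrite harmonic_factorN// /conjM map_mxZ map_mxD -!/(conjM _) !conjMM !conjM_toC conjMK.
have -> : xplus H (- x) = xminus H x.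
  by rewrite /xplus /xminus oppr_gt0; case: ltP => // x1; rewrite ltr0_norm.
have -> : xminus H (- x) = xplus H x.
  by rewrite /xplus /xminus oppr_lt0; case: ltP => // x1; rewrite normrN gtr0_norm.
by rewrite addrC.
Qed.

Definition real_kernel (t : R) (i : 'I_p) (s : xzspace R p) : R :=
  2 * complex.Re (gtilde_z H A t s i 0).

(** The points with x = 0 are reflected too; they form a null set on which every kernel vanishes. *)
Definition fold_point (s : xzspace R p) : xzspace R p :=
  if 0 < s.1 then s else (- s.1, conjM s.2).

Definition reversal (z : Cvec R p) : Cvec R p :=
  conjM (- (invmx (conjM A) *m A) *m (z : 'cV[R[i]]_p)).

Definition reverse_point (s : xzspace R p) : xzspace R p := (s.1, reversal s.2).

Lemma real_kernel_fold t i s : real_kernel t i (fold_point s) = real_kernel t i s.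
Proof.
rewrite /fold_point; case: ifP => // _.
rewrite /real_kernel /gtilde_z /= gtildeN -[in RHS](Re_conjM (gtilde H A t s.1 *m _)).
by rewrite conjMM.
Qed.

Lemma real_kernel0 t i s : s.1 = 0 -> real_kernel t i s = 0.
Proof. by move=> s0; rewrite /real_kernel /gtilde_z s0 gtilde0 mul0mx mxE mulr0. Qed.

Hypothesis Abar_unit : conjM A \in unitmx.

(** The harmonic factor at [- t] is minus the conjugate of the one at [t]. Conjugating inside the
    real part replaces [A] by [conjM A], which cancels the inverse contained in [reversal]. *)
Let real_kernel_reverse_pos t i s : 0 < s.1 ->
  real_kernel (- t) i s = real_kernel t i (reverse_point s).
Proof.
move=> s0; have s1 : s.1 != 0 by rewrite gt_eqF.
rewrite /real_kernel /reverse_point /gtilde_z /= !gtilde_pos//.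
rewrite -[in RHS](Re_conjM (_ *: _ *m _)) conjMM /reversal conjMK.
congr (_ * complex.Re (fun_of_matrix _ _ _)).
rewrite harmonic_factor_opp// /conjM map_mxZ -!/(conjM _) conjMM conjM_toC.
rewrite mulNmx mulmxN scaleNr mulNmx; congr (- _).
rewrite -!scalemxAl; congr (_ *: _).
rewrite -!mulmxA; congr (_ *m _).
by rewrite [conjM A *m _]mulmxA mulmxV// mul1mx.
Qed.

Lemma real_kernel_reverse t i s :
  real_kernel (- t) i s = real_kernel t i (reverse_point (fold_point s)).
Proof.
rewrite -(real_kernel_fold (- t)).
have [s0|s0] := eqVneq s.1 0.
  rewrite /fold_point s0 ltxx oppr0 !real_kernel0//.
apply: real_kernel_reverse_pos; rewrite /fold_point; case: ifPn => //=.
by rewrite -leNgt le_eqVlt (negbTE s0)/= oppr_gt0.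
Qed.

(** The part of the folded kernel that does not depend on t; [real_kernelE] separates it from the
    oscillation in [t |x|]. *)
Definition amplitude (s : xzspace R p) : 'cV[R[i]]_p :=
  toC (powmx `|s.1| (- D)) *m A *m ((fold_point s).2 : 'cV[R[i]]_p).

Lemma fold_point1 s : (fold_point s).1 = `|s.1|.
Proof.
rewrite /fold_point; case: ifPn => [s0|]; first by rewrite gtr0_norm.
by rewrite -leNgt => s0; rewrite ler0_norm.
Qed.

Lemma real_kernelE t i s : s.1 != 0 ->
  real_kernel t i s = 2 / `|s.1| *
    (complex.Re (amplitude s i 0) * sin (t * `|s.1|) +
     complex.Im (amplitude s i 0) * (cos (t * `|s.1|) - 1)).
Proof.
move=> s0; rewrite -real_kernel_fold /real_kernel /gtilde_z fold_point1.
have y0 : 0 < `|s.1| by rewrite normr_gt0.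
rewrite gtilde_pos// -scalemxAl mxE -/(amplitude s) harmonic_factorE ?gt_eqF//.
case: (amplitude s i 0) => a b /=; field.
by rewrite gt_eqF.
Qed.

End kernel_symmetries.

(** * The intensity and its reversal *)

Lemma measurable_preimage (d d' : measure_display) (S : measurableType d)
    (S' : measurableType d') (f : S -> S') (B : set S') :
  measurable_fun setT f -> measurable B -> measurable (f @^-1` B).
Proof. by move=> mf mB; rewrite -[X in measurable X]setTI; exact: mf. Qed.

Section measurable_complex_maps.
Context {R : realType} {p : nat}.
Context {d : measure_display} {S : measurableType d}.

Definition measurable_coords (f : S -> Cvec R p) :=
  (forall i, measurable_fun setT (fun s => complex.Re ((f s : 'cV[R[i]]_p) i 0))) /\
  (forall i, measurable_fun setT (fun s => complex.Im ((f s : 'cV[R[i]]_p) i 0))).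

Lemma measurable_coordsP f : measurable_coords f -> measurable_fun setT f.
Proof. by case=> *; exact: measurable_Cvec. Qed.

Lemma measurable_coords_fun f : measurable_fun setT f -> measurable_coords f.
Proof.
move=> mf; split=> i.
  exact: (measurableT_comp (measurable_Cvec_Re i) mf).
exact: (measurableT_comp (measurable_Cvec_Im i) mf).
Qed.

Lemma measurable_coords_mulmx (M : S -> 'M[R[i]]_p) f :
  (forall i j, measurable_fun setT (fun s => complex.Re (M s i j))) ->
  (forall i j, measurable_fun setT (fun s => complex.Im (M s i j))) ->
  measurable_coords f -> measurable_coords (fun s => M s *m (f s : 'cV[R[i]]_p)).
Proof.
move=> mRe mIm [fRe fIm]; split=> i.
  have -> : (fun s => complex.Re ((M s *m (f s : 'cV[R[i]]_p)) i 0)) =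
    (fun s => \sum_j (complex.Re (M s i j) * complex.Re ((f s : 'cV[R[i]]_p) j 0) -
                      complex.Im (M s i j) * complex.Im ((f s : 'cV[R[i]]_p) j 0))).
    apply/funext => s; rewrite mxE raddf_sum; apply: eq_bigr => j _.
    by case: (M s i j); case: ((f s : 'cV[R[i]]_p) j 0).
  by apply: measurable_sum => j; apply: measurable_funB; exact: measurable_funM.
have -> : (fun s => complex.Im ((M s *m (f s : 'cV[R[i]]_p)) i 0)) =
  (fun s => \sum_j (complex.Re (M s i j) * complex.Im ((f s : 'cV[R[i]]_p) j 0) +
                    complex.Im (M s i j) * complex.Re ((f s : 'cV[R[i]]_p) j 0))).
  apply/funext => s; rewrite mxE raddf_sum; apply: eq_bigr => j _.
  by case: (M s i j); case: ((f s : 'cV[R[i]]_p) j 0).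
by apply: measurable_sum => j; apply: measurable_funD; exact: measurable_funM.
Qed.

Lemma measurable_coords_conjM f : measurable_coords f ->
  measurable_coords (fun s => conjM (f s)).
Proof.
move=> [fRe fIm]; split=> i.
  by apply: eq_measurable_fun (fRe i) => s _; rewrite mxE; case: ((f s : 'cV[R[i]]_p) i 0).
apply: (@eq_measurable_fun _ _ _ _ _ (fun s => - complex.Im ((f s : 'cV[R[i]]_p) i 0))).
  by move=> s _; rewrite mxE; case: ((f s : 'cV[R[i]]_p) i 0).
exact: measurable_funN.
Qed.

End measurable_complex_maps.

(** * The intensity folded onto positive frequencies *)

Section folded_measure.
Context {R : realType} {p : nat}.
Variable A : 'M[R[i]]_p.
Local Notation Cp := (Cvec R p).

Lemma measurable_mulmx (M : 'M[R[i]]_p) :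
  measurable_fun setT (fun z : Cp => M *m (z : 'cV[R[i]]_p) : Cp).
Proof.
apply/measurable_coordsP/measurable_coords_mulmx => //.
exact: measurable_coords_fun.
Qed.

Lemma measurable_conjM : measurable_fun setT (fun z : Cp => conjM z : Cp).
Proof. exact/measurable_coordsP/measurable_coords_conjM/measurable_coords_fun. Qed.

Lemma measurable_reversal : measurable_fun setT (reversal A).
Proof. exact: (measurableT_comp measurable_conjM (measurable_mulmx _)). Qed.

Lemma measurable_fold_point : measurable_fun setT (@fold_point R p).
Proof.
apply: measurable_fun_ifT => //.
  by apply: measurable_fun_ltr.
apply: measurable_fun_pair.
  by apply: measurable_funN; exact: measurable_fst.
by apply: (measurableT_comp measurable_conjM); exact: measurable_snd.
Qed.

Lemma measurable_reverse_point : measurable_fun setT (reverse_point A).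
Proof.
apply: measurable_fun_pair; first exact: measurable_fst.
by apply: (measurableT_comp measurable_reversal); exact: measurable_snd.
Qed.

Variable mu : {sigma_finite_measure set Cp -> \bar R}.
Local Open Scope ereal_scope.

Definition intensity : set (xzspace R p) -> \bar R := dx_prod mu.

(* [R] carries two measurable structures with the same measurable sets but
   different displays: that of [xzspace] and that of [lebesgue_measure]. *)
Let raw_intensity : {measure set (measurableTypeR R * Cp) -> \bar R} :=
  product_measure1 (@lebesgue_measure R) mu.

Let intensity_sigma_additive : semi_sigma_additive intensity.
Proof.
by move=> F mF tF mUF; exact: (@measure_semi_sigma_additive _ _ _ raw_intensity F).
Qed.

HB.instance Definition _ := isMeasure.Build _ _ _ intensity
  (@measure0 _ _ _ raw_intensity) (@measure_ge0 _ _ _ raw_intensity) intensity_sigma_additive.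

Lemma intensity_rectangle (I : set R) (E : set Cp) : measurable I -> measurable E ->
  intensity (I `*` E) = lebesgue_measure I * mu E.
Proof. by move=> mI mE; exact: product_measure1E. Qed.

(** The preimage consists of a rectangle over positive frequencies and a reflected, conjugated one;
    reflection preserves Lebesgue measure. *)
Lemma intensity_fold_rectangle (I : set R) (E : set Cp) : measurable I -> measurable E ->
  intensity (@fold_point R p @^-1` (I `*` E)) =
  lebesgue_measure (I `&` `]0%R, +oo[) * (mu E + mu [set z | E (conjM z)]).
Proof.
move=> mI mE.
set J := I `&` `]0%R, +oo[.
pose J' : set R := [set x | I (- x)%R] `&` `]-oo, 0%R].
pose E' : set Cp := [set z | E (conjM z)].
have mE' : measurable E'.
  by rewrite -[E']setTI; exact: measurable_conjM.
have mJ : measurable J by exact: measurableI.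
have mN : measurable [set x | I (- x)%R].
  by rewrite -[X in measurable X]setTI; apply: (@oppr_measurable R setT).
have mJ' : measurable J' by exact: measurableI.
have -> : @fold_point R p @^-1` (I `*` E) = J `*` E `|` J' `*` E'.
  apply/seteqP; split=> -[x z]; rewrite /fold_point /J /J' /E' /=; case: ifPn => x0 /=.
  - by move=> [Ix Ez]; left; rewrite in_itv/= x0.
  - by move=> [Ix Ez]; right; rewrite in_itv/= leNgt.
  - by move=> [[[Ix _] Ez]|[[_]]] //; rewrite in_itv/= leNgt x0.
  - by move=> [[[_]]|[[Ix _] Ez]] //; rewrite in_itv/= (negbTE x0).
have dis : J `*` E `&` J' `*` E' = set0.
  apply/seteqP; split=> -[x z] //= [[[_ x0] _] [[_ x1] _]].
  by move: x0 x1; rewrite /= !in_itv/= andbT leNgt => ->.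
have -> : intensity (J `*` E `|` J' `*` E') = intensity (J `*` E) + intensity (J' `*` E').
  by apply: measureU => //; exact: measurableX.
rewrite !intensity_rectangle//.
(* The reflection of [J'] is [J] with possibly the point 0 added, which is null. *)
have -> : @lebesgue_measure R J' = @lebesgue_measure R J.
  have mJN : measurable [set x | J' (- x)%R].
    by rewrite -[X in measurable X]setTI; apply: (@oppr_measurable R setT).
  rewrite -(lebesgue_measureN mJ') /pushforward /=.
  have -> : -%R @^-1` J' = J `|` (I `&` [set 0%R]).
    apply/seteqP; split=> x; rewrite /J /J' /= !in_itv/= opprK andbT oppr_le0.
      move=> [Ix]; rewrite le_eqVlt => /predU1P[/esym x0|x0]; [by right|by left].
    by move=> [[Ix x0]|[Ix x0]]; split => //; rewrite ?x0// ltW.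
  have z0 : @lebesgue_measure R (I `&` [set 0%R]) = 0.
    apply/eqP; rewrite eq_le measure_ge0 andbT.
    rewrite -[leRHS](lebesgue_measure_set1 (0 : R)%R).
    by apply: le_measure; rewrite ?inE//; exact: measurableI.
  by apply: measureU0 => //; exact: measurableI.
by rewrite ge0_muleDr.
Qed.

Lemma intensity_reverse_rectangle (I : set R) (E : set Cp) :
  measurable I -> measurable E ->
  intensity ((fun s => reverse_point A (fold_point s)) @^-1` (I `*` E)) =
  lebesgue_measure (I `&` `]0%R, +oo[) *
  (mu (reversal A @^-1` E) + mu [set z | E (reversal A (conjM z))]).
Proof.
move=> mI mE; have mrE : measurable (reversal A @^-1` E).
  by rewrite -[X in measurable X]setTI; exact: measurable_reversal.
exact: (intensity_fold_rectangle mI mrE).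
Qed.

Lemma mutilde_half (C : set Cp) :
  mutilde mu C = (2^-1)%:E * (mu C + mu [set z | C (conjM z)]).
Proof.
rewrite /mutilde; congr (_ * (_ + mu _)).
apply/seteqP; split=> z /=; first by move=> [w Cw <-]; rewrite conjMK.
by move=> Cz; exists (conjM z) => //; rewrite conjMK.
Qed.

Lemma mutilde_double (C : set Cp) :
  mu C + mu [set z | C (conjM z)] = 2%:E * mutilde mu C.
Proof. by rewrite mutilde_half muleA -EFinM divff// mul1e. Qed.

End folded_measure.

(** * Sigma-finiteness of a Levy measure with finite second moment *)

Section levy_measures.
Context {R : realType} {p : nat}.
Local Notation Cp := (Cvec R p).
Implicit Types mu : {measure set Cp -> \bar R}.

Lemma sqnormE (z : Cp) : sqnorm z = \sum_i
  (complex.Re ((z : 'cV[R[i]]_p) i 0) ^+ 2 + complex.Im ((z : 'cV[R[i]]_p) i 0) ^+ 2).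
Proof.
rewrite /sqnorm mxE raddf_sum; apply: eq_bigr => i _.
by rewrite !mxE; case: ((z : 'cV[R[i]]_p) i 0) => a b /=; ring.
Qed.

Lemma sqnorm_ge0 (z : Cp) : 0 <= sqnorm z.
Proof. by rewrite sqnormE sumr_ge0// => i _; rewrite addr_ge0// sqr_ge0. Qed.

Lemma sqnorm_eq0 (z : Cp) : sqnorm z = 0 -> z = 0.
Proof.
rewrite sqnormE => /eqP; rewrite psumr_eq0; last first.
  by move=> i _; rewrite addr_ge0// sqr_ge0.
move=> /allP h; apply/matrixP => i j; rewrite ord1 mxE.
have := h i; rewrite mem_index_enum => /(_ isT)/=.
rewrite paddr_eq0 ?sqr_ge0// !sqrf_eq0 => /andP[/eqP re /eqP im].
by apply/eqP; rewrite eq_complex re im !eqxx.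
Qed.

Lemma sqnorm_conjM (z : Cp) : sqnorm (conjM z : Cp) = sqnorm z.
Proof.
rewrite !sqnormE; apply: eq_bigr => i _; rewrite mxE.
by case: ((z : 'cV[R[i]]_p) i 0) => a b /=; rewrite sqrrN.
Qed.

Lemma measurable_sqnorm : measurable_fun setT (@sqnorm R p).
Proof.
apply: (@eq_measurable_fun _ _ _ _ _ (fun z : Cp => \sum_i
  (complex.Re ((z : 'cV[R[i]]_p) i 0) ^+ 2 + complex.Im ((z : 'cV[R[i]]_p) i 0) ^+ 2))).
  by move=> z _; rewrite sqnormE.
apply: measurable_sum => i; apply: measurable_funD; apply: measurable_funX.
  exact: measurable_Cvec_Re.
exact: measurable_Cvec_Im.
Qed.

Lemma measurable_Cvec_set0 : measurable ([set 0] : set Cp).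
Proof.
have -> : [set 0] = setT `&` (@sqnorm R p @^-1` [set 0]).
  rewrite setTI; apply/seteqP; split => z /=; last exact: sqnorm_eq0.
  by move=> ->; rewrite sqnormE big1// => i _; rewrite mxE /= expr0n addr0.
exact: measurable_sqnorm.
Qed.

(** The origin belongs to every set, so that the union is the whole space; it costs nothing as
    mu({0}) = 0. Conjugation preserves each set. *)
Definition levy_cover (k : nat) : set Cp :=
  [set z | sqnorm z = 0 \/ k.+1%:R^-1 <= sqnorm z].

Lemma measurable_levy_cover k : measurable (levy_cover k).
Proof.
have -> : levy_cover k = (@sqnorm R p @^-1` [set 0]) `|`
    (@sqnorm R p @^-1` `[k.+1%:R^-1, +oo[%classic).
  by apply/seteqP; split => z; rewrite /levy_cover/= in_itv/= andbT.
by apply: measurableU; rewrite -[X in measurable X]setTI; apply: measurable_sqnorm.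
Qed.

Lemma levy_cover_conjM k : [set z | levy_cover k (conjM z)] = levy_cover k.
Proof. by apply/seteqP; split => z; rewrite /levy_cover/= sqnorm_conjM. Qed.

Lemma bigcup_levy_cover : \bigcup_k levy_cover k = setT.
Proof.
apply/seteqP; split => z // _.
have := sqnorm_ge0 z; rewrite le_eqVlt => /predU1P[/esym z0|z0].
  by exists 0%N => //; left.
have [n] := ltr_add_invr z0; rewrite add0r => nz.
by exists n => //; right; exact: ltW.
Qed.

Lemma levy_cover_nondecreasing m n : (m <= n)%N -> levy_cover m `<=` levy_cover n.
Proof.
move=> mn z [z0|zm]; [by left|right]; apply: le_trans zm.
by rewrite lef_pV2 ?posrE// ler_nat ltnS.
Qed.

(** Markov's inequality for [sqnorm] away from the origin. *)
Lemma levy_cover_finite mu k : levy_measure2 mu -> (mu (levy_cover k) < +oo)%E.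
Proof.
move=> [mu0 mufin].
pose E : set Cp := @sqnorm R p @^-1` `[k.+1%:R^-1, +oo[%classic.
have mE : measurable E.
  by rewrite -[X in measurable X]setTI; apply: measurable_sqnorm.
pose Z : set Cp := [set 0].
have m0 : measurable Z by exact: measurable_Cvec_set0.
have cE : levy_cover k `<=` Z `|` E.
  move=> z [/sqnorm_eq0 z0|zk]; first by left.
  by right; rewrite /E/= in_itv/= andbT.
apply: (@le_lt_trans _ _ (mu (Z `|` E))).
  by apply: le_measure; rewrite ?inE//; [exact: measurable_levy_cover|exact: measurableU].
apply: (@le_lt_trans _ _ (mu Z + mu E)%E); first exact: measureU2.
rewrite [mu Z]mu0 add0e.
have k0 : 0 < k.+1%:R^-1 :> R by rewrite invr_gt0.
have h : ((k.+1%:R^-1)%:E * mu E <= \int[mu]_z (sqnorm z)%:E)%E.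
  rewrite -integral_cst//.
  apply: (@le_trans _ _ (\int[mu]_(z in E) (sqnorm z)%:E)%E).
    apply: ge0_le_integral => //.
    - by move=> z _; rewrite lee_fin ltW.
    - by apply/measurable_EFinP; apply: measurable_funS measurable_sqnorm.
    - by move=> z; rewrite /E/= in_itv/= andbT lee_fin.
  apply: ge0_subset_integral => //.
  - by apply/measurable_EFinP; exact: measurable_sqnorm.
  - by move=> z _; rewrite lee_fin sqnorm_ge0.
rewrite ltey; apply/eqP => Eoo; move: h; rewrite Eoo gt0_muley ?lte_fin// leye_eq.
by move=> /eqP e; move: mufin; rewrite e ltxx.
Qed.

Lemma levy_sigma_finite mu : levy_measure2 mu -> sigma_finite setT mu.
Proof.
move=> h; exists levy_cover; first by rewrite bigcup_levy_cover.
by move=> k; split; [exact: measurable_levy_cover|exact: levy_cover_finite].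
Qed.

End levy_measures.

(** * From rectangles to all measurable sets *)

Section reversal_invariance.
Context {R : realType} {p : nat}.
Variables (A : 'M[R[i]]_p) (mu : {sigma_finite_measure set (Cvec R p) -> \bar R}).
Hypothesis mu_levy : levy_measure2 mu.

Lemma measurable_fold_reverse :
  measurable_fun setT (fun s : xzspace R p => reverse_point A (fold_point s)).
Proof. exact: (measurableT_comp (measurable_reverse_point A) (@measurable_fold_point R p)). Qed.

Definition image_measure d d' (T : measurableType d) (T' : measurableType d')
    (m : {measure set T -> \bar R}) (f : T -> T') (mf : measurable_fun setT f) :
    {measure set T' -> \bar R} :=
  measure_function_pushforward__canonical__measure_function_Measure m mf.

(** Rectangles form a pi-system on which the two image measures agree by [inv], and the rectangles
    [g k], of finite measure, exhaust the space. *)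
Lemma intensity_reverse_invariant :
  (forall E, measurable E -> (mu (reversal A @^-1` E) + mu [set z | E (reversal A (conjM z))] =
     mu E + mu [set z | E (conjM z)])%E) ->
  forall B, measurable B -> intensity mu (@fold_point R p @^-1` B) =
    intensity mu ((fun s => reverse_point A (fold_point s)) @^-1` B).
Proof.
move=> inv B mB.
pose m1 := image_measure (intensity mu) (@measurable_fold_point R p).
pose m2 := image_measure (intensity mu) measurable_fold_reverse.
pose G : set (set (xzspace R p)) :=
  [set I `*` E | I in (measurable : set (set R)) & E in (measurable : set (set (Cvec R p)))].
pose g (k : nat) : set (xzspace R p) := `[- k%:R, k%:R]%classic `*` levy_cover k.
have mR (a b : R) : measurable (`[a, b]%classic : set R) by exact: measurable_itv.
rewrite -[LHS]/(m1 B) -[RHS]/(m2 B).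
apply: (@g_sigma_algebra_measure_unique _ _ _ G _ g).
- by move=> _ [I mI [E mE <-]]; exact: measurableX.
- move=> k; exists `[- k%:R, k%:R]%classic; first exact: mR.
  by exists (levy_cover k) => //; exact: measurable_levy_cover.
- apply/seteqP; split => -[x z] // _.
  have [n _ zn] : (\bigcup_k levy_cover k) z by rewrite bigcup_levy_cover.
  pose k := maxn n (Num.truncn `|x|).+1.
  exists k => //; split => /=.
    have : `|x| <= k%:R.
      apply: (@le_trans _ _ (Num.truncn `|x|).+1%:R); first exact/ltW/truncnS_gt.
      by rewrite ler_nat leq_maxr.
    by rewrite in_itv/= ler_norml.
  by apply: levy_cover_nondecreasing zn; exact: leq_maxl.
- move=> _ _ [I mI [E mE <-]] [I' mI' [E' mE' <-]].
  exists (I `&` I'); first exact: measurableI.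
  by exists (E `&` E'); [exact: measurableI|rewrite setXI].
- move=> _ [I mI [E mE <-]].
  rewrite /m1 /m2 /= /pushforward intensity_fold_rectangle//.
  by rewrite intensity_reverse_rectangle// inv.
- move=> k; rewrite /m1 /= /pushforward intensity_fold_rectangle//; last first.
    exact: measurable_levy_cover.
  rewrite levy_cover_conjM; apply: lte_mul_pinfty => //.
  + rewrite ge0_fin_numE//.
    apply: (@le_lt_trans _ _ (@lebesgue_measure R `[- k%:R, k%:R]%classic)).
      by apply: le_measure; rewrite ?inE//; exact: measurableI.
    rewrite lebesgue_measure_itv/=; case: ifP => _; rewrite ?ltry//.
  + by apply: lte_add_pinfty; exact: levy_cover_finite.
- move: mB; rewrite -[measurable B]/((measurable : set (set (R * Cvec R p)%type)) B).
  by rewrite measurable_prod_measurableType.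
Qed.

End reversal_invariance.

(** * Recovering frequency and amplitude from the kernels *)

Section kernel_span.
Context {R : realType} {p : nat}.
Variables (H : 'M[R]_p) (A : 'M[R[i]]_p).
Local Notation XZ := (xzspace R p).
Local Notation K := (real_kernel H A).

(** The integrands of the linear combinations of coordinates of the process; each list entry holds a
    coefficient, a time and a coordinate, and repetitions are allowed. *)
Definition kernel_span : set (XZ -> R) :=
  [set f | exists q : seq (R * (R * 'I_p)),
     f = fun s => \sum_(j <- q) j.1 * K j.2.1 j.2.2 s].

Lemma sub_space_kernel_span : sub_space kernel_span.
Proof.
split.
- by exists [::]; apply/funext => s; rewrite big_nil.
- move=> _ _ [q ->] [q' ->]; exists (q ++ q').
  by apply/funext => s; rewrite big_cat.
- move=> c _ [q ->]; exists [seq (c * j.1, j.2) | j <- q].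
  apply/funext => s; rewrite big_map mulr_sumr.
  by apply: eq_bigr => j _; rewrite mulrA.
Qed.

Lemma kernel_span_kernel c t i : kernel_span (fun s => c * K t i s).
Proof. by exists [:: (c, (t, i))]; apply/funext => s; rewrite big_seq1. Qed.

Lemma kernel_span_fold f s : kernel_span f -> f (fold_point s) = f s.
Proof. by move=> [q ->]; apply: eq_bigr => j _; rewrite real_kernel_fold. Qed.

End kernel_span.

Section coordinate_limits.
Context {R : realType}.

Lemma cvg_nsqr_cosB1 (y : R) :
  n.+1%:R ^+ 2 * (cos (y / n.+1%:R) - 1) @[n --> \oo] --> - (y ^+ 2 / 2).
Proof.
have -> : (fun n : nat => n.+1%:R ^+ 2 * (cos (y / n.+1%:R) - 1)) =
  (fun n : nat => -2 * (n.+1%:R * sin (y / 2 / n.+1%:R)) ^+ 2).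
  apply/funext => n; have -> : y / n.+1%:R = (y / 2 / n.+1%:R) *+ 2.
    by rewrite -mulr_natr; field; rewrite addrC natr1 pnatr_eq0.
  by rewrite cos_mulr2n exprMn sin2cos2 -mulr_natr; ring.
have -> : - (y ^+ 2 / 2) = -2 * (y / 2) ^+ 2 by field.
apply: cvgM; first exact: cvg_cst.
have h := @cvg_nsin R (y / 2).
by rewrite expr2; apply: cvgM.
Qed.

(** [sin x = 0] gives [cos (2 x) = 1]; the bound 1/2 brings [2 x] within the reach of
    [cos_eq1_small]. *)
Lemma sin_neq0_small (x : R) : 0 < `|x| < 2^-1 -> sin x != 0.
Proof.
move=> /andP[x0 x1]; apply/negP => /eqP sx.
have : x *+ 2 = 0.
  apply: cos_eq1_small; first by rewrite normrMn -mulr_natr; lra.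
  by rewrite cos_mulr2n -[cos x ^+ 2](addrK (sin x ^+ 2)) cos2Dsin2 sx; ring.
by move=> /eqP; rewrite mulrn_eq0/= => /eqP x00; move: x0; rewrite x00 normr0 ltxx.
Qed.

Lemma cos_neq1_small (x : R) : 0 < `|x| < 2^-1 -> cos x != 1.
Proof.
move=> /andP[x0 x1]; apply/negP => /eqP cx.
have x00 : x = 0 by apply: cos_eq1_small => //; lra.
by move: x0; rewrite x00 normr0 ltxx.
Qed.

End coordinate_limits.

Section frequency_and_amplitude.
Context {R : realType} {p : nat}.
Variables (H : 'M[R]_p) (A : 'M[R[i]]_p).
Local Notation XZ := (xzspace R p).
Local Notation K := (real_kernel H A).
Local Notation amp := (amplitude H A).

Definition odd_kernel t i (s : XZ) := K t i s - K (- t) i s.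
Definition even_kernel t i (s : XZ) := K t i s + K (- t) i s.

Lemma odd_kernelE t i s : s.1 != 0 -> odd_kernel t i s =
  4 / `|s.1| * complex.Re (amp s i 0) * sin (t * `|s.1|).
Proof.
by move=> s0; rewrite /odd_kernel !real_kernelE// mulNr sinN cosN; field;
  rewrite normr_eq0.
Qed.

Lemma even_kernelE t i s : s.1 != 0 -> even_kernel t i s =
  4 / `|s.1| * complex.Im (amp s i 0) * (cos (t * `|s.1|) - 1).
Proof.
by move=> s0; rewrite /even_kernel !real_kernelE// mulNr sinN cosN; field;
  rewrite normr_eq0.
Qed.

(** Nonzero at small t unless x or the amplitude vanishes, hence usable as a denominator. *)
Definition kernel_energy t s : R :=
  \sum_i (odd_kernel t i s ^+ 2 + even_kernel t i s ^+ 2).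

(* By the duplication formulas this is [2 cos (t |x|)] times the energy, which isolates the
   frequency [|x|] from the amplitude. *)
Definition doubled_energy t s : R :=
  \sum_i (odd_kernel (2 * t) i s * odd_kernel t i s +
          even_kernel (2 * t) i s * even_kernel t i s - 2 * even_kernel t i s ^+ 2).

Lemma doubled_energyE t s : s.1 != 0 ->
  doubled_energy t s = 2 * cos (t * `|s.1|) * kernel_energy t s.
Proof.
move=> s0; rewrite /kernel_energy mulr_sumr; apply: eq_bigr => i _.
rewrite !odd_kernelE// !even_kernelE//.
have -> : 2 * t * `|s.1| = (t * `|s.1|) *+ 2 by rewrite -mulr_natr; ring.
rewrite sin_mulr2n cos_mulr2n.
move: (cos _) (sin _) (4 / _) (complex.Re _) (complex.Im _) => c u k a b.
by ring.
Qed.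

Lemma kernel_energy_ge0 t s : 0 <= kernel_energy t s.
Proof. by rewrite sumr_ge0// => i _; rewrite addr_ge0// sqr_ge0. Qed.

(** The kernels reveal |x| only where the amplitude is nonzero; elsewhere all of them vanish and 0
    is the default value. *)
Definition visible_frequency (s : XZ) : R :=
  if (s.1 != 0) && (amp s != 0) then `|s.1| else 0.

Definition visible_amplitude (s : XZ) : 'cV[R[i]]_p :=
  if s.1 != 0 then amp s else 0.

Lemma kernel_energy_neq0 t s : s.1 != 0 -> amp s != 0 ->
  0 < `|t * `|s.1| | < 2^-1 -> kernel_energy t s != 0.
Proof.
move=> s0 + ts; apply: contra => /eqP/psumr_eq0P h.
have {}h i : odd_kernel t i s ^+ 2 + even_kernel t i s ^+ 2 = 0.
  by apply: h => // j _; rewrite addr_ge0// sqr_ge0.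
apply/eqP/matrixP => i j; rewrite ord1 [RHS]mxE.
have y0 : 4 / `|s.1| != 0 by rewrite mulf_neq0// invr_eq0 normr_eq0.
have /eqP := h i; rewrite paddr_eq0 ?sqr_ge0// !sqrf_eq0 odd_kernelE// even_kernelE//.
move: (4 / _) y0 => k k0; rewrite !mulf_eq0 (negbTE k0) (negbTE (sin_neq0_small ts)) subr_eq0.
rewrite (negbTE (cos_neq1_small ts)) /= !orbF => /andP[/eqP re /eqP im].
by apply/eqP; rewrite eq_complex re im !eqxx.
Qed.

(* Where the energy vanishes the division by 0 makes the sequence 0, as it should be. *)
Lemma cvg_frequency s :
  n.+1%:R ^+ 2 * (2 * kernel_energy n.+1%:R^-1 s - doubled_energy n.+1%:R^-1 s) *
    (kernel_energy n.+1%:R^-1 s)^-1 @[n --> \oo] --> visible_frequency s ^+ 2.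
Proof.
rewrite /visible_frequency; have [s0|s0] := eqVneq s.1 0.
  rewrite /= expr0n /= (_ : (fun _ => _) = cst 0); first exact: cvg_cst.
  apply/funext => n.
  have -> : kernel_energy n.+1%:R^-1 s = 0.
    by apply: big1 => i _; rewrite /odd_kernel /even_kernel !real_kernel0//; ring.
  by rewrite invr0 mulr0.
have [v0|v0] := eqVneq (amp s) 0; rewrite /=.
  rewrite expr0n /= (_ : (fun _ => _) = cst 0); first exact: cvg_cst.
  apply/funext => n.
  have -> : kernel_energy n.+1%:R^-1 s = 0.
    apply: big1 => i _; rewrite odd_kernelE// even_kernelE// v0 mxE /=; ring.
  by rewrite invr0 mulr0.
have y0 : 0 < `|s.1| by rewrite normr_gt0.
have h := @cvg_nsqr_cosB1 R `|s.1|.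
have -> : `|s.1| ^+ 2 = -2 * (- (`|s.1| ^+ 2 / 2)) by field.
apply: (@cvg_trans _ ((fun n : nat => -2 * (n.+1%:R ^+ 2 * (cos (`|s.1| / n.+1%:R) - 1))) @ \oo));
  last by apply: cvgM => //; exact: cvg_cst.
apply: near_eq_cvg.
(* Beyond this rank [|x| / (n + 1) < 1/2], so the energy does not vanish. *)
have : \forall n \near \oo, 2 * `|s.1| < n.+1%:R.
  exists (Num.truncn (2 * `|s.1|)) => // n /= hn.
  by apply: lt_le_trans (truncnS_gt _) _; rewrite ler_nat ltnS.
apply: filterS => n hn.
have e0 : kernel_energy n.+1%:R^-1 s != 0.
  apply: kernel_energy_neq0 => //; rewrite mulrC normrM normr_id gtr0_norm ?invr_gt0//.
  by rewrite divr_gt0//= ltr_pdivrMr// mulrC -ltr_pdivrMr// invrK mulrC.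
rewrite doubled_energyE//; rewrite [_^-1 * `|s.1|]mulrC; field.
exact: e0.
Qed.

Lemma cvg_amplitude_Re s i : 4^-1 * (n.+1%:R * odd_kernel n.+1%:R^-1 i s)
  @[n --> \oo] --> complex.Re (visible_amplitude s i 0).
Proof.
rewrite /visible_amplitude; have [s0|s0] := eqVneq s.1 0; rewrite /=.
  rewrite mxE /= (_ : (fun _ => _) = cst 0); first exact: cvg_cst.
  by apply/funext => n; rewrite /odd_kernel !real_kernel0// subr0 !mulr0.
rewrite (_ : (fun _ => _) = (fun n => complex.Re (amp s i 0) / `|s.1| *
   (n.+1%:R * sin (`|s.1| / n.+1%:R)))); last first.
  by apply/funext => n; rewrite odd_kernelE// [_^-1 * `|s.1|]mulrC; field; rewrite normr_eq0.
rewrite -[X in _ --> X](divfK (_ : `|s.1| != 0)) ?normr_eq0//.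
by apply: cvgM; [exact: cvg_cst|exact: cvg_nsin].
Qed.

(** [cos - 1] is of second order, so the limit keeps a factor |x|, which has to be divided out
    afterwards. *)
Lemma cvg_amplitude_Im s i : - 2^-1 * (n.+1%:R ^+ 2 * even_kernel n.+1%:R^-1 i s)
  @[n --> \oo] --> visible_frequency s * complex.Im (visible_amplitude s i 0).
Proof.
rewrite /visible_frequency /visible_amplitude; have [s0|s0] := eqVneq s.1 0; rewrite /=.
  rewrite mul0r (_ : (fun _ => _) = cst 0); first exact: cvg_cst.
  by apply/funext => n; rewrite /even_kernel !real_kernel0// addr0 !mulr0.
have -> : (if amp s != 0 then `|s.1| else 0) * complex.Im (amp s i 0) =
    - 2 * complex.Im (amp s i 0) / `|s.1| * (- (`|s.1| ^+ 2 / 2)).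
  case: eqVneq => [->|_] /=; first by rewrite mxE /= !(mulr0, mul0r).
  by field; rewrite normr_eq0.
rewrite (_ : (fun _ => _) = (fun n => - 2 * complex.Im (amp s i 0) / `|s.1| *
   (n.+1%:R ^+ 2 * (cos (`|s.1| / n.+1%:R) - 1)))); last first.
  by apply/funext => n; rewrite even_kernelE// [_^-1 * `|s.1|]mulrC; field; rewrite normr_eq0.
by apply: cvgM; [exact: cvg_cst|exact: cvg_nsqr_cosB1].
Qed.

End frequency_and_amplitude.

(** * The folded point as a measurable function of the kernels *)

Section trig_sigma_strip.
Context {R : realType} {p : nat}.
Variables (H : 'M[R]_p) (A : 'M[R[i]]_p).
Local Notation XZ := (xzspace R p).
Local Notation K := (real_kernel H A).
Local Notation L := (kernel_span H A).

Hypothesis L_measurable : forall f, L f -> measurable_fun setT f.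

Let D : 'M[R]_p := H - (2^-1)%:M.
Let SG := g_sigma_algebraType (sublevel_sets (trig_poly L)).

Let mK t i : measurable_fun setT (K t i : SG -> R).
Proof.
apply: trig_sigma_fun => //; first exact: sub_space_kernel_span.
have := kernel_span_kernel H A 1 t i.
by congr (L _); apply/funext => s; rewrite mul1r.
Qed.

Let mO t i : measurable_fun setT (odd_kernel H A t i : SG -> R).
Proof. exact: measurable_funB. Qed.

Let mE t i : measurable_fun setT (even_kernel H A t i : SG -> R).
Proof. exact: measurable_funD. Qed.

Let mEn t : measurable_fun setT (kernel_energy H A t : SG -> R).
Proof.
by apply: measurable_sum => i; apply: measurable_funD; apply: measurable_funX.
Qed.

Let mDb t : measurable_fun setT (doubled_energy H A t : SG -> R).
Proof.
apply: measurable_sum => i; apply: measurable_funB.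
  by apply: measurable_funD; exact: measurable_funM.
by apply: measurable_funM => //; apply: measurable_funX.
Qed.

Let measurable_inv (f : SG -> R) : (forall s, 0 <= f s) -> measurable_fun setT f ->
  measurable_fun setT (fun s => (f s)^-1).
Proof.
move=> f0 mf; apply: (@eq_measurable_fun _ _ _ _ _ (fun s => f s `^ (-1))).
  by move=> s _; rewrite powR_inv1.
exact: (measurableT_comp (measurable_powR _) mf).
Qed.

Let mfreq : measurable_fun setT (visible_frequency H A : SG -> R).
Proof.
have m2 : measurable_fun setT ((fun s => visible_frequency H A s ^+ 2) : SG -> R).
  apply: (measurable_fun_cvg (h := fun n (s : SG) => n.+1%:R ^+ 2 *
      (2 * kernel_energy H A n.+1%:R^-1 s - doubled_energy H A n.+1%:R^-1 s) *
      (kernel_energy H A n.+1%:R^-1 s)^-1)) => [n|s _]; last exact: cvg_frequency.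
  apply: measurable_funM; last first.
    by apply: measurable_inv => // s; exact: kernel_energy_ge0.
  apply: measurable_funM => //; apply: measurable_funB => //.
  exact: measurable_funM.
apply: (@eq_measurable_fun _ _ _ _ _ (fun s : SG => (visible_frequency H A s ^+ 2) `^ (2^-1))).
  move=> s _; rewrite powR12_sqrt ?sqr_ge0// sqrtr_sqr ger0_norm//.
  by rewrite /visible_frequency; case: ifP.
exact: (measurableT_comp (measurable_powR _) m2).
Qed.

Let mampRe i : measurable_fun setT
  ((fun s => complex.Re (visible_amplitude H A s i 0)) : SG -> R).
Proof.
apply: (measurable_fun_cvg (h := fun n (s : SG) => 4^-1 *
    (n.+1%:R * odd_kernel H A n.+1%:R^-1 i s))) => [n|s _]; last exact: cvg_amplitude_Re.
by apply: measurable_funM => //; exact: measurable_funM.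
Qed.

(** Inverts [amplitude] by means of [powmx_opp]; it is 0 where the frequency is invisible. *)
Definition visible_fold (s : XZ) : Cvec R p :=
  invmx A *m (toC (powmx (visible_frequency H A s) D) *m
    (if visible_frequency H A s == 0 then 0 else visible_amplitude H A s)).

Let mampIm i : measurable_fun setT ((fun s => complex.Im
  ((if visible_frequency H A s == 0 then 0 else visible_amplitude H A s) i 0)) : SG -> R).
Proof.
have mv : measurable_fun setT ((fun s => visible_frequency H A s *
    complex.Im (visible_amplitude H A s i 0)) : SG -> R).
  apply: (measurable_fun_cvg (h := fun n (s : SG) => - 2^-1 *
      (n.+1%:R ^+ 2 * even_kernel H A n.+1%:R^-1 i s))) => [n|s _];
    last exact: cvg_amplitude_Im.
  by apply: measurable_funM => //; exact: measurable_funM.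
apply: (@eq_measurable_fun _ _ _ _ _ (fun s : SG => (visible_frequency H A s *
    complex.Im (visible_amplitude H A s i 0)) * (visible_frequency H A s)^-1)).
  move=> s _; have [->|f0] := eqVneq (visible_frequency H A s) 0.
    by rewrite invr0 mulr0 mxE.
  by rewrite mulrC mulKf.
apply: measurable_funM => //; apply: measurable_inv => // s.
by rewrite /visible_frequency; case: ifP.
Qed.

(** Multiplying and then dividing by the frequency imposes the default value 0 where the frequency
    is 0. *)
Let mampRe' i : measurable_fun setT ((fun s => complex.Re
  ((if visible_frequency H A s == 0 then 0 else visible_amplitude H A s) i 0)) : SG -> R).
Proof.
apply: (@eq_measurable_fun _ _ _ _ _ (fun s : SG => (visible_frequency H A s *
    complex.Re (visible_amplitude H A s i 0)) * (visible_frequency H A s)^-1)).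
  move=> s _; have [->|f0] := eqVneq (visible_frequency H A s) 0.
    by rewrite invr0 mulr0 mxE.
  by rewrite mulrC mulKf.
apply: measurable_funM; first exact: measurable_funM.
apply: measurable_inv => // s.
by rewrite /visible_frequency; case: ifP.
Qed.

Let mfold : measurable_fun setT (visible_fold : SG -> Cvec R p).
Proof.
apply/measurable_coordsP; rewrite /visible_fold.
apply: (@measurable_coords_mulmx _ _ _ SG (fun=> invmx A)).
- by move=> i j; exact: measurable_cst.
- by move=> i j; exact: measurable_cst.
apply: (@measurable_coords_mulmx _ _ _ SG (fun s => toC (powmx (visible_frequency H A s) D))).
- move=> i j; have := measurableT_comp (measurable_powmx D i j) mfreq.
  by apply: eq_measurable_fun => s _; rewrite /= mxE.
- move=> i j; rewrite (_ : (fun _ => _) = cst 0); first exact: measurable_cst.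
  by apply/funext => s; rewrite mxE.
- by split.
Qed.

Hypothesis A_unit : A \in unitmx.

Lemma fold_point_amplitude (s : XZ) : (fold_point s).2 =
  invmx A *m (toC (powmx `|s.1| D) *m amplitude H A s).
Proof.
rewrite /amplitude -!mulmxA [toC (powmx _ D) *m (_ *m _)]mulmxA -toC_mulmx powmx_opp.
by rewrite /toC map_mx1 mul1mx mulKmx.
Qed.

(** [I] and [C] avoid 0, the default value of [visible_frequency] and [visible_fold], so no
    invisible point enters the intersection. *)
Lemma trig_sigma_strip (I : set R) (C : set (Cvec R p)) :
  measurable I -> measurable C -> ~ I 0 -> ~ C 0 ->
  trig_sigma L (@fold_point R p @^-1` (I `*` C)).
Proof.
move=> mI mC I0 C0.
have -> : @fold_point R p @^-1` (I `*` C) =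
    (visible_frequency H A @^-1` I) `&` (visible_fold @^-1` C).
  apply/seteqP; split => s /=.
    rewrite fold_point1 => -[Is Cs].
    have s0 : s.1 != 0 by apply/eqP => e; apply: I0; rewrite -[0](@normr0 R R) -e.
    have v0 : amplitude H A s != 0.
      apply/eqP => e; apply: C0; rewrite fold_point_amplitude e in Cs.
      by rewrite !mulmx0 in Cs.
    rewrite /visible_fold /visible_frequency /visible_amplitude s0 v0 /=.
    by rewrite normr_eq0 (negbTE s0) -fold_point_amplitude.
  rewrite /visible_fold /visible_frequency /visible_amplitude fold_point1.
  case: ifP => [/andP[s0 v0]|_ []] //.
  by rewrite s0 normr_eq0 (negbTE s0) fold_point_amplitude.
apply: (@measurableI _ SG).
  by rewrite -[X in measurable X]setTI; exact: mfreq.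
by rewrite -[X in measurable X]setTI; exact: mfold.
Qed.

(** The kernels at times 1/n and -1/n, divided by every positive integer: if all their cosines are
    1, a divisor larger than the kernel shows by [cos_eq1_small] that the kernel is 0. The limits
    along 1/n then make the amplitude vanish, and with it z. *)
Lemma kernel_span_cover : exists2 g : nat -> XZ -> R, (forall k, L (g k)) &
  forall s, (fold_point s).1 != 0 -> (fold_point s).2 != 0 -> exists k, cos (g k s) != 1.
Proof.
pose u (j : (bool * 'I_p) * (nat * nat)) (s : XZ) : R :=
  j.2.2.+1%:R^-1 * K ((-1) ^+ j.1.1 * j.2.1.+1%:R^-1) j.1.2 s.
exists (fun k => if unpickle k is Some j then u j else cst 0).
  move=> k; case: unpickle => [j|]; first exact: kernel_span_kernel.
  by have [] := sub_space_kernel_span H A.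
move=> s; rewrite fold_point1 normr_eq0 => s0 z0.
apply: contrapT => /forallNP h.
suff v0 : amplitude H A s = 0.
  by move: z0; rewrite fold_point_amplitude v0 !mulmx0 eqxx.
have Ks n i b : K ((-1) ^+ (b : bool) * n.+1%:R^-1) i s = 0.
  set x := K _ _ _; pose m := Num.truncn `|x|.
  have : cos (m.+1%:R^-1 * x) = 1.
    by have := h (pickle ((b, i), (n, m))); rewrite pickleK => /negP/negPn/eqP.
  move/cos_eq1_small => e; have /eqP : m.+1%:R^-1 * x = 0.
    apply: e; rewrite normrM gtr0_norm ?invr_gt0// mulrC ltr_pdivrMr// mul1r.
    exact: truncnS_gt.
  by rewrite mulf_eq0 invr_eq0 pnatr_eq0 /= => /eqP.
have K1 n i : K n.+1%:R^-1 i s = 0 by have := Ks n i false; rewrite expr0 mul1r.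
have KN n i : K (- n.+1%:R^-1) i s = 0 by have := Ks n i true; rewrite expr1 mulN1r.
apply/eqP; apply: contraT => v0.
rewrite -(negbTE v0); apply/eqP/matrixP => i j; rewrite ord1 [RHS]mxE.
have re : complex.Re (amplitude H A s i 0) = 0.
  have := @cvg_amplitude_Re R p H A s i; rewrite /visible_amplitude s0.
  rewrite (_ : (fun _ => _) = cst 0) => [|].
    by move=> c; apply: (Rcvg_unique c); exact: cvg_cst.
  by apply/funext => n; rewrite /odd_kernel K1 KN subr0 !mulr0.
have im : complex.Im (amplitude H A s i 0) = 0.
  have := @cvg_amplitude_Im R p H A s i; rewrite /visible_frequency /visible_amplitude s0 v0.
  rewrite (_ : (fun _ => _) = cst 0) => [c|].
    have /eqP : `|s.1| * complex.Im (amplitude H A s i 0) = 0.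
      by apply: (Rcvg_unique c); exact: cvg_cst.
    by rewrite mulf_eq0 normr_eq0 (negbTE s0) => /eqP.
  by apply/funext => n; rewrite /even_kernel K1 KN addr0 !mulr0.
by apply/eqP; rewrite eq_complex re im !eqxx.
Qed.

End trig_sigma_strip.

(** * Time reversal *)

Section image_measures.
Context {R : realType} {d d' : measure_display}.
Context {T : measurableType d} {T' : measurableType d'}.
Variables (m : {measure set T -> \bar R}) (f : T -> T') (mf : measurable_fun setT f).

Lemma integral_image_measure (g : T' -> R) : measurable_fun setT g ->
  (\int[image_measure m mf]_y (g y)%:E = \int[m]_x (g (f x))%:E)%E.
Proof.
move=> mg; have mEg : measurable_fun setT (EFin \o g) by exact/measurable_EFinP.
rewrite [LHS]integralE [RHS]integralE; congr (_ - _)%E.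
  rewrite (ge0_integral_pushforward mf)//; last exact: measurable_funepos.
  by rewrite preimage_setT -funepos_comp.
rewrite (ge0_integral_pushforward mf)//; last exact: measurable_funeneg.
by rewrite preimage_setT -funeneg_comp.
Qed.

Lemma Rintegral_image_measure (g : T' -> R) : measurable_fun setT g ->
  \int[image_measure m mf]_y g y = \int[m]_x g (f x).
Proof. by move=> mg; rewrite /Rintegral integral_image_measure. Qed.

Lemma square_integrable_image_measure (g : T' -> R) : measurable_fun setT g ->
  square_integrable m (fun x => g (f x)) -> square_integrable (image_measure m mf) g.
Proof.
move=> mg [_ g2]; apply: square_integrableP => //.
rewrite integral_image_measure; last exact: measurable_funX.
case/integrableP: g2 => _; apply: le_lt_trans; rewrite le_eqVlt.
apply/orP; left; apply/eqP; apply: eq_integral => x _ /=.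
by rewrite ger0_norm ?sqr_ge0.
Qed.

Lemma cos_exponent_image_measure (g : T' -> R) : measurable_fun setT g ->
  cos_exponent (image_measure m mf) g = cos_exponent m (fun x => g (f x)).
Proof.
move=> mg; apply: (@Rintegral_image_measure (fun y => cos (g y) - 1)).
apply: measurable_funB => //.
exact: (measurableT_comp (continuous_measurable_fun (@continuous_cos R))).
Qed.

Lemma sin_exponent_image_measure (g : T' -> R) : measurable_fun setT g ->
  sin_exponent (image_measure m mf) g = sin_exponent m (fun x => g (f x)).
Proof.
move=> mg; apply: (@Rintegral_image_measure (fun y => sin (g y) - g y)).
apply: measurable_funB => //.
exact: (measurableT_comp (continuous_measurable_fun (@continuous_sin R))).
Qed.

End image_measures.

(** * Exponents determine the measure away from the common zeros *)

Section exponents_determine_measures.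
Context {R : realType} {d : measure_display} {S : measurableType d}.
Variables (L : set (S -> R)) (m1 m2 : {measure set S -> \bar R}).
Hypothesis Lsub : sub_space L.
Hypothesis L1 : forall f, L f -> square_integrable m1 f.
Hypothesis L2 : forall f, L f -> square_integrable m2 f.
Hypothesis cosE : forall f, L f -> cos_exponent m1 f = cos_exponent m2 f.
Hypothesis sinE : forall f, L f -> sin_exponent m1 f = sin_exponent m2 f.

(** The real part of [e^(i r) (e^(i f) - 1 - i f)]; second differences cancel the linear term. *)
Let exponent (r : R) (f : S -> R) (x : S) : R :=
  cos r * (cos (f x) - 1) - sin r * (sin (f x) - f x).

Let exponent_integrable (m : {measure set S -> \bar R}) r f :
  square_integrable m f -> Rintegrable m (exponent r f).
Proof.
move=> sf; apply: RintegrableB; apply: RintegrableZ.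
  exact: cos_integrable.
exact: sin_integrable.
Qed.

Let integral_exponent (m : {measure set S -> \bar R}) r f : square_integrable m f ->
  \int[m]_x exponent r f x = cos r * cos_exponent m f - sin r * sin_exponent m f.
Proof.
move=> sf; have ci := cos_integrable sf; have si := sin_integrable sf.
by rewrite RintegralB ?RintegralZl//; exact: RintegrableZ.
Qed.

(* Hence the exponents determine the Fourier transforms of the finite measures [(1 - cos g) m]. *)
Let cos_weight r (f g : S -> R) x : cos (f x + r) * (1 - cos (g x)) =
  exponent r f x - 2^-1 * (exponent r (f \+ g) x + exponent r (f \- g) x).
Proof.
rewrite /exponent /= !cosD !sinD !cosN !sinN.
by move: (cos _) (sin _) (cos _) (sin _) (cos _) (sin _) => a b c a' b' c'; field.
Qed.

Lemma eq_measure_exponents B : trig_sigma L B ->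
  (exists2 g : nat -> S -> R, (forall k, L (g k)) &
     forall x, B x -> exists k, cos (g k x) != 1) ->
  m1 B = m2 B.
Proof.
have [L0 LD LZ] := Lsub.
have LB f g : L f -> L g -> L (f \- g).
  move=> Lf Lg; rewrite (_ : _ \- _ = f \+ (fun x => -1 * g x)); first exact/LD/LZ.
  by apply/funext => x /=; rewrite mulN1r.
have w1 (m : {measure set S -> \bar R}) g : square_integrable m g ->
    m.-integrable setT (EFin \o (fun x => 1 - cos (g x))).
  move=> /cos_integrable/(RintegrableZ (-1)).
  by apply: eq_integrable => // x _ /=; rewrite mulN1r opprB.
have wE (m : {measure set S -> \bar R}) f g r : (forall f, L f -> square_integrable m f) ->
    L f -> L g ->
    (\int[m]_x (cos (f x + r) * (1 - cos (g x)))%:E =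
     (\int[m]_x exponent r f x - 2^-1 * (\int[m]_x exponent r (f \+ g) x +
        \int[m]_x exponent r (f \- g) x))%:E)%E.
  move=> Lm Lf Lg.
  have i0 := exponent_integrable r (Lm _ Lf).
  have i1 := exponent_integrable r (Lm _ (LD _ _ Lf Lg)).
  have i2 := exponent_integrable r (Lm _ (LB _ _ Lf Lg)).
  have i3 := RintegrableZ 2^-1 (RintegrableD i1 i2).
  rewrite -RintegralD// -RintegralZl//; last exact: RintegrableD.
  rewrite -RintegralB// EFin_Rintegral; last exact: RintegrableB.
  by apply: eq_integral => x _; rewrite cos_weight.
move=> sB cover; apply: (eq_measure_levy Lsub _ _ _ _ sB cover).
- by move=> f /L1[].
- by move=> g /L1; exact: w1.
- by move=> g /L2; exact: w1.
- move=> f g r Lf Lg; rewrite !wE// !integral_exponent//;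
    try by [exact: L1|exact: L2|exact/L1/LD|exact/L2/LD|exact/L1/LB|exact/L2/LB].
  by rewrite !cosE ?sinE//; try by [exact: LD|exact: LB].
Qed.

End exponents_determine_measures.

(** * From the folded measures to the symmetrised Levy measure *)

Section reversal_of_measures.
Context {R : realType} {p : nat}.
Variables (A : 'M[R[i]]_p) (mu : {sigma_finite_measure set (Cvec R p) -> \bar R}).
Hypotheses (A_unit : A \in unitmx) (Abar_unit : conjM A \in unitmx).
Hypothesis mu0 : mu [set 0] = 0%E.
Local Notation Cp := (Cvec R p).

Let T (z : Cp) : Cp := - (invmx (conjM A) *m A) *m (z : 'cV[R[i]]_p).
Let T' (z : Cp) : Cp := - (invmx A *m conjM A) *m (z : 'cV[R[i]]_p).

Let TK : cancel T T'.
Proof.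
move=> z; rewrite /T /T' !mulNmx mulmxN opprK mulmxA -!mulmxA mulKVmx//.
by rewrite mulKmx.
Qed.

Let T'K : cancel T' T.
Proof.
move=> z; rewrite /T /T' !mulNmx mulmxN opprK mulmxA -!mulmxA mulKVmx//.
by rewrite mulKmx.
Qed.

Let image_T (C : set Cp) : [set T z | z in C] = T' @^-1` C.
Proof.
apply/seteqP; split => z /=; first by move=> [w Cw <-]; rewrite TK.
by move=> Cz; exists (T' z).
Qed.

Let mT C : measurable C -> measurable (T @^-1` C).
Proof. by apply: measurable_preimage; exact: measurable_mulmx. Qed.

Let mT' C : measurable C -> measurable (T' @^-1` C).
Proof. by apply: measurable_preimage; exact: measurable_mulmx. Qed.

Let mconj (C : set Cp) : measurable C -> measurable [set z : Cp | C (conjM z)].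
Proof. exact: measurable_preimage (@measurable_conjM R p). Qed.

Let nu (C : set Cp) : \bar R := (mu C + mu [set z | C (conjM z)])%E.

Let nu_conjM C : nu [set z | C (conjM z)] = nu C.
Proof.
rewrite /nu addeC; congr (mu _ + _)%E.
by apply/seteqP; split => z /=; rewrite conjMK.
Qed.

Let nu_mutilde C : nu C = (2%:E * mutilde mu C)%E.
Proof. exact: mutilde_double. Qed.

Let Z : set Cp := [set 0].

Let mu_setD0 C : measurable C -> mu (C `\` Z) = mu C.
Proof.
move=> mC; apply/eqP; rewrite eq_le; apply/andP; split.
  by apply: le_measure; rewrite ?inE//; apply: measurableD => //; exact: measurable_Cvec_set0.
apply: (@le_trans _ _ (mu ((C `\` Z) `|` Z))).
  apply: le_measure; rewrite ?inE//.
    by apply: measurableU; [apply: measurableD|]; rewrite // ; exact: measurable_Cvec_set0.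
  by move=> z Cz; have [->|z0] := pselect (z = 0); [right|left].
apply: (@le_trans _ _ (mu (C `\` Z) + mu Z)%E); last by rewrite [mu Z]mu0 adde0.
apply: measureU2; last exact: measurable_Cvec_set0.
by apply: measurableD => //; exact: measurable_Cvec_set0.
Qed.

Let conjM_eq0 (z : Cp) : conjM z = 0 -> z = 0.
Proof.
by move=> z0; rewrite -[z]conjMK z0; apply/matrixP => i j; rewrite !mxE conjc0.
Qed.

Let nu_setD0 C : measurable C -> nu (C `\` Z) = nu C.
Proof.
move=> mC; rewrite /nu mu_setD0// -[in RHS](mu_setD0 (mconj mC)); congr (_ + mu _)%E.
apply/seteqP; split => z /= [Cz z0]; split => // e; apply: z0; last exact: conjM_eq0.
by rewrite e; apply/matrixP => i j; rewrite !mxE conjc0.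
Qed.

Let nu_reversal C : nu (reversal A @^-1` C) = nu (T @^-1` [set z | C (conjM z)]).
Proof. by []. Qed.

(** The hypothesis is restricted to sets avoiding 0, all that the kernels can provide; removing 0
    from a set changes neither side. *)
Lemma mutilde_reversal_invariant :
  (forall C : set Cp, measurable C -> ~ C (0 : 'cV[R[i]]_p) ->
     (mu (reversal A @^-1` C) + mu [set z | C (reversal A (conjM z))] =
      mu C + mu [set z | C (conjM z)])%E) ->
  forall C, measurable C -> mutilde mu [set T z | z in C] = mutilde mu C.
Proof.
move=> H C mC; rewrite image_T.
rewrite !mutilde_half; congr (_ * _)%E; rewrite -/(nu C) -[LHS]/(nu _).
have TT : T @^-1` (T' @^-1` C) = C by apply/seteqP; split => z /=; rewrite TK.
rewrite -[in RHS]TT -(nu_setD0 (mT' mC)) -(nu_setD0 (mT (mT' mC))).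
set E := T' @^-1` C `\` Z.
have mE : measurable E by apply: measurableD; [exact: mT'|exact: measurable_Cvec_set0].
(* The conjugation contained in [reversal] cancels the one in front of [E]. *)
have -> : T @^-1` (T' @^-1` C) `\` Z =
    reversal A @^-1` [set z | E (conjM z)].
  rewrite /E /reversal; apply/seteqP; split => z /=; rewrite conjMK => -[Cz z0]; split => //.
    by apply: contra_not z0 => e; rewrite -(TK z) /T e /T' mulmx0.
  by apply: contra_not z0 => ->; rewrite mulmx0.
have [mE' E0] : measurable ([set z | E (conjM z)] : set Cp) /\ ~ E (conjM (0 : 'cV[R[i]]_p)).
  by split; [exact: mconj|move=> [_]; apply; apply/matrixP => i j; rewrite !mxE conjc0].
by rewrite -(nu_conjM E); apply/esym; exact: (H _ mE' E0).
Qed.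

Lemma reversal_invariant_mutilde :
  (forall C, measurable C -> mutilde mu [set T z | z in C] = mutilde mu C) ->
  forall C, measurable C ->
    (mu (reversal A @^-1` C) + mu [set z | C (reversal A (conjM z))] =
     mu C + mu [set z | C (conjM z)])%E.
Proof.
move=> H C mC; have := H _ (mT (mconj mC)).
rewrite image_T (_ : T' @^-1` _ = [set z | C (conjM z)]); last first.
  by apply/seteqP; split => z /=; rewrite T'K.
move=> /(congr1 (fun x => 2%:E * x)%E); rewrite -!nu_mutilde nu_conjM => e.
by rewrite -[RHS]/(nu C) e -nu_reversal.
Qed.

End reversal_of_measures.

(** * Finite-dimensional laws and cosines of linear forms *)

Section fdd.
Context {R : realType} {d : measure_display} {Omega : measurableType d}.
Variables (P : probability Omega R) (p : nat).
Definition coef_sum n (q : seq (R * ('I_p * 'I_n))) (M : borelMx R p n) : R :=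
  \sum_(j <- q) j.1 * (M : 'M[R]_(p, n)) j.2.1 j.2.2.

Lemma measurable_coef_sum n (q : seq (R * ('I_p * 'I_n))) :
  measurable_fun setT (coef_sum q).
Proof.
apply: measurable_sum => j; apply: measurable_funM; first exact: measurable_cst.
exact: measurable_real_mx_coef.
Qed.

Variable n : nat.
Local Notation L := [set f | exists q, f = @coef_sum n q].

Lemma sub_space_coef_sum : sub_space L.
Proof.
split.
- by exists [::]; apply/funext => M; rewrite /coef_sum big_nil.
- move=> _ _ [q ->] [q' ->]; exists (q ++ q').
  by apply/funext => M; rewrite /coef_sum big_cat.
- move=> c _ [q ->]; exists [seq (c * j.1, j.2) | j <- q].
  apply/funext => M; rewrite /coef_sum big_map mulr_sumr.
  by apply: eq_bigr => j _; rewrite mulrA.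
Qed.

Lemma trig_sigma_coef_sum (B : set (borelMx R p n)) : measurable B -> trig_sigma L B.
Proof.
move=> mB; pose SG := g_sigma_algebraType (sublevel_sets (trig_poly L)).
have mid : measurable_fun setT ((fun M => M) : SG -> borelMx R p n).
  apply: (@measurable_real_mx R _ SG) => i j.
  have Lij : L (fun M => (M : 'M[R]_(p, n)) i j).
    by exists [:: (1, (i, j))]; apply/funext => M; rewrite /coef_sum big_seq1 mul1r.
  exact: (trig_sigma_fun sub_space_coef_sum Lij).
by have := mid measurableT _ mB; rewrite setTI.
Qed.

Variables Y Z : Omega -> borelMx R p n.
Hypotheses (mY : measurable_fun setT Y) (mZ : measurable_fun setT Z).

(** The Cramer-Wold device: the image laws have total mass 1, and the linear forms of the entries
    generate the Borel sets of matrices. *)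
Lemma eq_law_cos : (forall B, measurable B -> P (Y @^-1` B) = P (Z @^-1` B)) <->
  (forall q r, \int[P]_w cos (coef_sum q (Y w) + r) = \int[P]_w cos (coef_sum q (Z w) + r)).
Proof.
have mc q r : measurable_fun setT (fun M => cos (@coef_sum n q M + r)).
  apply: (measurableT_comp (continuous_measurable_fun (@continuous_cos R))).
  by apply: measurable_funD; [exact: measurable_coef_sum|exact: measurable_cst].
split=> [YZ q r|YZ B mB].
  rewrite -(Rintegral_image_measure P mY (mc q r)) -(Rintegral_image_measure P mZ (mc q r)).
  by congr fine; apply: eq_measure_integral => B mB _; exact: YZ.
rewrite -[LHS]/(image_measure P mY B) -[RHS]/(image_measure P mZ B).
apply: (@eq_finite_measure_trig _ _ R L).
- exact: sub_space_coef_sum.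
- by move=> f [q ->]; exact: measurable_coef_sum.
- by rewrite /= /pushforward preimage_setT probability_setT ltry.
- by rewrite /= /pushforward preimage_setT probability_setT ltry.
- move=> _ r [q ->]; rewrite !integral_image_measure//.
  have ci (U : Omega -> borelMx R p n) : measurable_fun setT U ->
      Rintegrable P (fun w => cos (coef_sum q (U w) + r)).
    move=> mU; apply/bounded_measurable_integrable/bounded_measurable_cos.
    exact: (measurableT_comp (measurable_coef_sum q) mU).
  by rewrite -!EFin_Rintegral ?YZ//; exact: ci.
- exact: trig_sigma_coef_sum.
Qed.

End fdd.

(** * Time reversal of the process *)

Section time_reversal.
Context {R : realType} {p : nat} {d : measure_display} {Omega : measurableType d}.
Variables (P : probability Omega R) (H : 'M[R]_p) (A : 'M[R[i]]_p).
Variables (mu : {sigma_finite_measure set (Cvec R p) -> \bar R}).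
Variables (N : Omega -> {measure set (xzspace R p) -> \bar R}) (X : R -> Omega -> 'cV[R]_p).
Hypotheses (HX : rhofLm P H A mu N X) (Abar_unit : conjM A \in unitmx).
Local Notation K := (real_kernel H A).
Local Notation L := (kernel_span H A).
Local Notation kappa := (intensity mu).
Local Notation tau := (fun s => reverse_point A (fold_point s)).

Let HN : poisson_random_measure P kappa N := rhofLm_prm HX.

Let X_integral t i : is_compensated_integral P kappa N (K t i) (fun w => X t w i 0).
Proof. exact: (rhofLm_integral HX). Qed.

Lemma kernel_span_square_integrable f : L f -> square_integrable kappa f.
Proof.
move=> [q ->]; apply: (compensated_integral_square_integrable (P := P) (N := N)).
exact: (compensated_integral_sum HN q (fun j => j.1) (fun j => X_integral j.2.1 j.2.2)).
Qed.

Let kernel_span_measurable f : L f -> measurable_fun setT f.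
Proof. by move=> /kernel_span_square_integrable[]. Qed.

Lemma kernel_span_reverse f : L f -> L (fun s => f (tau s)).
Proof.
move=> [q ->]; exists [seq (j.1, (- j.2.1, j.2.2)) | j <- q].
apply/funext => s; rewrite big_map; apply: eq_bigr => j _ /=.
by rewrite -real_kernel_reverse.
Qed.

Let mtau := @measurable_fold_reverse R p A.

(** The integrand of a linear combination at the opposite times is the original one composed with
    [tau], and the law of the combination is known through its two exponents. *)
Lemma time_reversible_exponents : time_reversible P X <->
  (forall f, L f -> cos_exponent kappa f = cos_exponent kappa (fun s => f (tau s)) /\
                    sin_exponent kappa f = sin_exponent kappa (fun s => f (tau s))).
Proof.
pose f n (t : 'I_n -> R) (q : seq (R * ('I_p * 'I_n))) s :=
  \sum_(j <- q) j.1 * K (t j.2.2) j.2.1 s.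
have fL n (t : 'I_n -> R) q : L (f n t q).
  exists [seq (j.1, (t j.2.2, j.2.1)) | j <- q].
  by apply/funext => s; rewrite big_map.
have fN n (t : 'I_n -> R) q : f n (fun j => - t j) q = fun s => f n t q (tau s).
  by apply/funext => s; apply: eq_bigr => j _; rewrite real_kernel_reverse.
have EX n (t : 'I_n -> R) q r :
  \int[P]_w cos (coef_sum q (\matrix_(i, j) X (t j) w i 0 : 'M[R]_(p, n)) + r) =
  expR (cos_exponent kappa (f n t q)) * cos (sin_exponent kappa (f n t q) + r).
  have h := compensated_integral_sum HN q (fun j => j.1) (fun j => X_integral (t j.2.2) j.2.1).
  rewrite -(compensated_integral_cos HN r h); congr fine; apply: eq_integral => w _.
  by congr (cos (_ + _))%:E; apply: eq_bigr => j _; rewrite mxE.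
have mX n (t : 'I_n -> R) :
    measurable_fun setT (fun w => (\matrix_(i, j) X (t j) w i 0 : 'M[R]_(p, n)) : borelMx R p n).
  apply: (@measurable_real_mx R) => i j.
  have [_ _ mX _] := X_integral (t j) i.
  by apply: eq_measurable_fun mX => w _; rewrite mxE.
split=> [rev _ [q ->]|E n t].
  (* Each term of [q] gets its own column, repeated times being harmless; the factor [a] supplies
     the segment used in [exponent_eq]. *)
  pose n := size q; pose q' (a : R) := [seq (a * (tnth (in_tuple q) j).1,
    ((tnth (in_tuple q) j).2.2, j)) | j <- index_enum 'I_n].
  pose t (j : 'I_n) := (tnth (in_tuple q) j).2.1.
  have fE a : f n t (q' a) = fun s => a * \sum_(j <- q) j.1 * K j.2.1 j.2.2 s.
    apply/funext => s; rewrite /f big_map mulr_sumr [in RHS]big_tnth.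
    by apply: eq_bigr => j _; rewrite mulrA.
  apply: exponent_eq.
  - by apply: kernel_span_square_integrable; exists q.
  - apply: kernel_span_square_integrable.
    have Lq : L (fun s => \sum_(j <- q) j.1 * K j.2.1 j.2.2 s) by exists q.
    exact: (kernel_span_reverse Lq).
  move=> a r; have := (eq_law_cos P (mX n (fun j => - t j)) (mX n t)).1 (rev n t) (q' a) r.
  by rewrite !EX fN fE.
apply/(eq_law_cos P (mX n (fun j => - t j)) (mX n t)) => q r.
rewrite !EX fN.
by have [-> ->] := E _ (fL n t q).
Qed.

Lemma reversal_invariant_time_reversible :
  (forall C, measurable C -> (mu (reversal A @^-1` C) + mu [set z | C (reversal A (conjM z))] =
     mu C + mu [set z | C (conjM z)])%E) ->
  time_reversible P X.
Proof.
move=> inv; apply/time_reversible_exponents => f Lf.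
pose mf := @measurable_fold_point R p.
have mLf := kernel_span_measurable Lf.
have ->: cos_exponent kappa f = cos_exponent (image_measure kappa mf) f.
  rewrite cos_exponent_image_measure//; congr fine.
  by apply: eq_integral => s _; rewrite (kernel_span_fold s Lf).
have ->: sin_exponent kappa f = sin_exponent (image_measure kappa mf) f.
  rewrite sin_exponent_image_measure//; congr fine.
  by apply: eq_integral => s _; rewrite (kernel_span_fold s Lf).
have [<- <-] := (cos_exponent_image_measure kappa mtau mLf,
  sin_exponent_image_measure kappa mtau mLf).
have E B : measurable B -> image_measure kappa mf B = image_measure kappa mtau B.
  exact: intensity_reverse_invariant (rhofLm_levy HX) inv B.
by split; congr fine; apply: eq_measure_integral => B mB _; exact: E.
Qed.

Lemma time_reversible_reversal_invariant (A_unit : A \in unitmx) :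
  time_reversible P X ->
  forall C : set (Cvec R p), measurable C -> ~ C (0 : 'cV[R[i]]_p) ->
   (mu (reversal A @^-1` C) + mu [set z | C (reversal A (conjM z))] =
     mu C + mu [set z | C (conjM z)])%E.
Proof.
move=> /time_reversible_exponents E C mC C0.
(* An interval of length 1 away from 0, so that its length drops out of both rectangle formulas. *)
pose I : set R := `]1, 2]%classic.
have mI : measurable I by exact: measurable_itv.
have I0 : ~ I 0 by rewrite /I /= in_itv/= ltr10.
have I1 : lebesgue_measure (I `&` `]0, +oo[) = 1%:E.
  rewrite setIidl; last by move=> x; rewrite /I/= !in_itv/= andbT => /andP[/(lt_trans ltr01)].
  by rewrite lebesgue_measure_itv/= lte_fin ltr1n -EFinB; congr (_%:E); ring.
have : kappa (@fold_point R p @^-1` (I `*` C)) =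
    image_measure kappa mtau (@fold_point R p @^-1` (I `*` C)).
  apply: (@eq_measure_exponents _ _ _ L kappa (image_measure kappa mtau)).
  - exact: sub_space_kernel_span.
  - exact: kernel_span_square_integrable.
  - move=> f Lf; apply: square_integrable_image_measure; first exact: kernel_span_measurable.
    exact/kernel_span_square_integrable/kernel_span_reverse.
  - move=> f Lf; rewrite cos_exponent_image_measure; last exact: kernel_span_measurable.
    by have [] := E f Lf.
  - move=> f Lf; rewrite sin_exponent_image_measure; last exact: kernel_span_measurable.
    by have [] := E f Lf.
  - exact: trig_sigma_strip.
  have [g Lg gs] := kernel_span_cover H A_unit.
  exists g => // s [Is Cs]; apply: gs; apply/eqP => e.
    by apply: I0; rewrite -e.
  by apply: C0; rewrite -e.
(* After [tau] the frequency is |x|, so a second folding acts only when x = 0, a value that [I]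
   excludes. *)
have -> : image_measure kappa mtau (@fold_point R p @^-1` (I `*` C)) =
    kappa (tau @^-1` (I `*` C)).
  congr (kappa _); apply/funext => s; rewrite /preimage /mkset.
  have [s0|s0] := eqVneq s.1 0; last first.
    congr ((I `*` C) _); move: (fold_point1 s).
    move: (fold_point s) => s' s'1; rewrite /fold_point /= s'1 normr_gt0.
    by rewrite s0.
  by apply/propext; split; rewrite /= !fold_point1 /= ?fold_point1 s0 !normr0 => -[/I0].
rewrite intensity_fold_rectangle// intensity_reverse_rectangle//.
by rewrite I1 !mul1e.
Qed.

End time_reversal.

Section levy_measure.
Context {R : realType} {p : nat} (mu : {measure set (Cvec R p) -> \bar R}).

(** The proof is an argument of this copy of [mu], so that the sigma-finite structure, which depends
    on it, can be attached. *)
Definition levy_measure (mu_levy : levy_measure2 mu) : set (Cvec R p) -> \bar R := mu.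

Variable mu_levy : levy_measure2 mu.

HB.instance Definition _ := Measure.on (levy_measure mu_levy).
HB.instance Definition _ := Measure_isSigmaFinite.Build _ _ _ (levy_measure mu_levy)
  (levy_sigma_finite mu_levy).

End levy_measure.

Theorem theorem4p2 (R : realType) (p : nat) (p_gt0 : (0 < p)%N)
    (H : 'M[R]_p) (A : 'M[R[i]]_p)
    (mu : {measure set (Cvec R p) -> \bar R})
    (d : measure_display) (Omega : measurableType d) (P : probability Omega R)
    (N : Omega -> {measure set (xzspace R p) -> \bar R})
    (X : R -> Omega -> 'cV[R]_p)
    (HH : forall a : R[i], eigenvalue (toC H) a -> 0 < complex.Re a < 1)
    (HX : rhofLm P H A mu N X)
    (Hmin : minimal_family (dx_prod (mutilde mu)) (gtilde_z H A))
    (HA : A \in unitmx) (HAbar : conjM A \in unitmx) :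
  time_reversible P X <->
  (forall C : set (Cvec R p), measurable C ->
     mutilde mu [set (- (invmx (conjM A) *m A) *m (z : 'cV[R[i]]_p) : Cvec R p)
                | z in C] = mutilde mu C).
Proof.
(* Once the record [mu] is opened, [rhofLm] for [mu] and for its sigma-finite copy [mu'] are
   convertible. *)
case: mu HX Hmin => mu mu_class HX _.
pose mu' : {sigma_finite_measure set (Cvec R p) -> \bar R} :=
  levy_measure (rhofLm_levy HX).
have HX' : rhofLm P H A mu' N X by exact: HX.
have mu0 : mu' [set 0] = 0%E by case: (rhofLm_levy HX).
split=> [rev C mC|inv].
  apply: (mutilde_reversal_invariant HA HAbar mu0) => // E mE E0.
  exact: (time_reversible_reversal_invariant HX' HAbar HA rev).
apply: (reversal_invariant_time_reversible HX' HAbar) => C mC.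
exact: (@reversal_invariant_mutilde _ _ _ mu').
Qed.
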